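(* Let $n$ be a positive integer and let $D>0$. There exists a positive continuous function $C_{n,D}(\epsilon)$ of $\epsilon>0$, depending only on $n$ and $D$, with $\lim_{\epsilon\to0}C_{n,D}(\epsilon)=0$, such that for every $M\in\mathcal A(n,D)$ we have $$\mathrm{ob}(M)<C_{n,D}(\tilde v(M)).$$
   Context: Alexandrov spaces of curvature $\ge\kappa$ are taken in the sense of Burago–Gromov–Perelman and are assumed finite-dimensional. $|x,y|$ denotes distance. $\mathcal A(n,D)$ is the family of $n$-dimensional compact Alexandrov spaces with curvature $\ge-1$ and diameter $\le D$. The normalized volume of such $M$ is $\tilde v(M)=\mathcal H^n(M)/(\mathrm{diam}\,M)^n$, where $\mathcal H^n$ is the $n$-dimensional Hausdorff measure. For a point $p$, $\Sigma_p$ is the space of directions at $p$ with its angle metric $\angle$. For $p\ne q$, $\Uparrow_p^q\subset\Sigma_p$ is the set of all directions at $p$ of minimal geodesics from $p$ to $q$, and $\uparrow_p^q$ denotes an element of $\Uparrow_p^q$. For a set $A\subset \Sigma_p$, $\angle(A,\xi)$ is the distance in $\Sigma_p$ from $\xi$ to $A$. For compact $M$ put $R=\mathrm{rad}(M)=\inf_{p\in M}\sup_{q\in M}|p,q|$. With $B(p,r)$ the open ball, for $p\ne q\in M$ define $$\mathrm{ob}(p;q)=\sup_{x\in B(p,R/2)^c}\angle(\Uparrow_p^q,\uparrow_p^x)-\pi/2$$ (supremum over all $x\in M$ with $|p,x|\ge R/2$ and all $\uparrow_p^x\in\Uparrow_p^x$), $\mathrm{ob}(p,q)=\max\{\mathrm{ob}(p;q),\mathrm{ob}(q;p)\}$,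 and the obtuse constant of $M$ $$\mathrm{ob}(M)=\liminf_{|p,q|\to0}\mathrm{ob}(p,q)\in[0,\pi/2],$$ the liminf being over pairs $p\neq q$ in $M$. *)

(* Defs.v *)
From HB Require Import structures.
From mathcomp Require Import all_boot all_order all_algebra.
From mathcomp Require Import all_classical all_reals all_analysis.

Set Implicit Arguments.
Unset Strict Implicit.
Unset Printing Implicit Defensive.

Import Order.TTheory GRing.Theory Num.Theory.
Import numFieldNormedType.Exports.

Local Open Scope classical_set_scope.
Local Open Scope ring_scope.

Section Alexandrov.
Context {R : realType}.

Definition cosh (x : R) : R := (expR x + expR (- x)) / 2.
Definition sinh (x : R) : R := (expR x - expR (- x)) / 2.

(* omega_0 = 1, omega_1 = 2, omega_n = (2 pi / n) omega_(n-2) *)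
Fixpoint unit_ball_volume (n : nat) : R :=
  match n with
  | 0 => 1
  | 1 => 2
  | m.+2 => 2 * pi / m.+2%:R * unit_ball_volume m
  end.

Section MetricSpace.
Variable M : metricType R.
Implicit Types (p q x y a b c d : M) (A : set M).

Local Notation "`d( x , y )" := (mdist x y) (at level 0, format "`d( x ,  y )").

(* The maximum with 0 only matters for the empty set. *)
Definition diam A : \bar R :=
  maxe 0%E (ereal_sup [set `d(x, y)%:E | x in A & y in A]).

Definition rad : \bar R :=
  ereal_inf [set ereal_sup [set `d(p, q)%:E | q in [set: M]] | p in [set: M]].

(* The empty set weighs 0 and a singleton weighs 1 when s = 0, so that the
   0-dimensional measure counts points. *)
Definition hausdorff_weight (s : R) A : \bar R :=
  if `[< A = set0 >] then 0%E else (diam A `^ s)%E.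

Definition hausdorff_content (s delta : R) A : \bar R :=
  ereal_inf [set (\sum_(0 <= i <oo) hausdorff_weight s (U i))%E
            | U in [set U : nat -> set M | A `<=` \bigcup_i U i /\
                      forall i, (diam (U i) <= delta%:E)%E]].

Definition hausdorff_measure_raw (s : R) A : \bar R :=
  ereal_sup [set hausdorff_content s delta A | delta in [set delta | 0 < delta]].

Definition hausdorff_dim A : \bar R :=
  ereal_inf [set s%:E | s in [set s | 0 <= s /\ hausdorff_measure_raw s A = 0%E]].

(* The factor makes H^n agree with Lebesgue measure on Euclidean n-space. *)
Definition hausdorff_measure (n : nat) A : \bar R :=
  ((unit_ball_volume n / 2 ^+ n)%:E * hausdorff_measure_raw n%:R A)%E.

Definition normalized_volume (n : nat) : R :=
  fine (hausdorff_measure n [set: M]) / fine (diam [set: M]) ^+ n.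

(* Burago-Gromov-Perelman define an intrinsic metric through finite chains
   rather than through lengths of curves. *)
Definition intrinsic : Prop :=
  forall x y (delta : R), 0 < delta ->
  exists (k : nat) (z : nat -> M),
    [/\ z 0%N = x, z k = y,
        forall i, (i < k)%N -> `d(z i, z i.+1) < delta
      & \sum_(i < k) `d(z i, z i.+1) < `d(x, y) + delta].

(* The angle at the vertex corresponding to a of the triangle in the hyperbolic
   plane of curvature -1 with the side lengths of a, b, c (law of cosines). *)
Definition hyp_comparison_angle a b c : R :=
  acos ((cosh `d(a, b) * cosh `d(a, c) - cosh `d(b, c))
        / (sinh `d(a, b) * sinh `d(a, c))).

(* The quadruple condition, which Burago-Gromov-Perelman take as the definition
   of curvature bounded below. *)
Definition curvature_ge_m1 : Prop :=
  forall x, exists2 U : set M, nbhs x U &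
    forall a b c d, U a -> U b -> U c -> U d -> uniq [:: a; b; c; d] ->
      hyp_comparison_angle a b c + hyp_comparison_angle a c d
      + hyp_comparison_angle a d b <= 2 * pi.

(* M is an n-dimensional compact Alexandrov space with curvature >= -1 and
   diameter <= D.  Compactness subsumes the (local) completeness required of an
   Alexandrov space. *)
Definition alexandrov_class (n : nat) (D : R) : Prop :=
  [/\ compact [set: M], intrinsic, curvature_ge_m1,
      hausdorff_dim [set: M] = n%:R%:E & (diam [set: M] <= D%:E)%E].

(* Unit speed minimal geodesics from p to q; the values of g outside
   [0, d(p, q)] are irrelevant. *)
Definition min_geodesic p q (g : R -> M) : Prop :=
  [/\ g 0 = p, g `d(p, q) = q &
      forall s t, 0 <= s <= `d(p, q) -> 0 <= t <= `d(p, q) ->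
        `d(g s, g t) = `|s - t|].

Definition comparison_angle p x y : R :=
  acos ((`d(p, x) ^+ 2 + `d(p, y) ^+ 2 - `d(x, y) ^+ 2)
        / (2 * `d(p, x) * `d(p, y))).

(* The limit exists for minimal geodesics in a space of curvature >= -1. *)
Definition angle p (g h : R -> M) : R :=
  lim (comparison_angle p (g st.1) (h st.2)
       @[st --> filter_prod (at_right (0 : R)) (at_right (0 : R))]).

(* A direction at p is represented by a geodesic issuing from p.  The space of
   directions is the completion of the quotient of these geodesics by the
   pseudometric [angle p]; the directions of minimal geodesics and their mutual
   distances do not depend on the completion or on the representatives. *)
Definition directions p q : set (R -> M) := [set g | min_geodesic p q g].

Definition angle_to_set p (A : set (R -> M)) (h : R -> M) : \bar R :=
  ereal_inf [set (angle p g h)%:E | g in A].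

Definition ob_at p q : \bar R :=
  (ereal_sup [set angle_to_set p (directions p q) h
             | h in \bigcup_(x in [set x | (fine rad / 2 <= `d(p, x))%R])
                      directions p x]
   - (pi / 2)%:E)%E.

Definition ob_pair p q : \bar R := maxe (ob_at p q) (ob_at q p).

Definition obtuse_constant : \bar R :=
  limf_einf (fun pq : M * M => ob_pair pq.1 pq.2)
    (filter_from [set delta : R | 0 < delta]
       (fun delta => [set pq : M * M | pq.1 != pq.2 /\ `d(pq.1, pq.2) < delta])).

End MetricSpace.
End Alexandrov.

(* Main.v *)
(* Suppose ob(M) > c. Locally at p, every direction towards a nearby point q
   then makes an angle of at least pi/2 + c with some minimal geodesic from p
   (or, with the roles exchanged, from q) to a far point. This forces M to be
   noncollapsed, as follows.

   Start from m pairs of points which are nearly opposite as seen from a whole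
   ball of radius comparable to diam M, with linearly independent directions.
   If m < n then the m distance functions cannot be locally bi-Lipschitz,
   since otherwise M would have dimension at most m; so there are arbitrarily
   close p, q that they hardly separate, i.e. the direction from p to q is
   almost orthogonal to the m given ones. By the Lang-Schroeder-Sturm inequality
   (the cosines of the angles at p form a copositive matrix) a direction in the
   span of the given ones makes an angle of at most about pi/2 with such a
   direction. So the geodesic towards the far point leaves the span by a definite
   amount, and a piece of it yields the pair number m + 1.

   With n pairs, the distance map to R^n is open at a scale comparable to diam M,
   its image contains a cube of comparable side, and being 1-Lipschitz in each
   coordinate it bounds H^n(M) from below.

   Angles are replaced by comparison cosines throughout. All of the geometry
   comes from one inequality, [straight], which is Toponogov's theorem for
   degenerate quadruples; it is globalized by the hinge argument of Alexander,
   Kapovitch and Petrunin. *)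

(* The scale below which all pairs p, q are obtuse depends on M and is not controlled, so nothing
   about p and q themselves has definite size. Only the geodesic to the far point does: it is at
   least diam M / 4 long, and monotonicity of comparison angles carries what is known about its germ
   at p to a point at distance t, a fixed multiple of diam M. This is why the constants [kap],
   [eps], [lam] of the induction depend on n, D and c alone. Linear independence is measured on the
   Gram matrix [G]: its quadratic form is at least [kap] times the squared l1 norm of the
   coefficients. In each dimension [kap] is fixed before the tolerance [eps], which must be small
   compared with it. The bound v(c) on the normalized volume comes for each c separately, with no
   continuity or monotonicity in c. An infimum over c of affine functions of the volume turns these
   bounds into one function that is automatically monotone and locally Lipschitz. *)
Require Import Defs.
From HB Require Import structures.
From mathcomp Require Import all_boot all_order all_algebra.
From mathcomp Require Import all_classical all_reals all_analysis.
From mathcomp Require Import ring lra.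

Import Order.TTheory GRing.Theory Num.Theory.
Import numFieldNormedType.Exports.

Set Implicit Arguments.
Unset Strict Implicit.
Unset Printing Implicit Defensive.

Local Open Scope classical_set_scope.
Local Open Scope ring_scope.

(** * Hyperbolic functions *)

(* Locked copies: unification must not unfold the exponentials when it looks
   for sums and products. *)
HB.lock Definition ch (R : realType) (x : R) : R := cosh x.
HB.lock Definition sh (R : realType) (x : R) : R := sinh x.

Arguments ch {R}.
Arguments sh {R}.

Section HyperbolicFunctions.
Variable R : realType.
Implicit Types x y a b c t D : R.

Lemma chN x : ch (- x) = ch x.
Proof. by rewrite ch.unlock /cosh opprK addrC. Qed.

Lemma shN x : sh (- x) = - sh x.
Proof. by rewrite sh.unlock /sinh opprK -mulNr opprB. Qed.

Lemma ch0 : ch (0 : R) = 1.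
Proof. by rewrite ch.unlock /cosh oppr0 expR0; lra. Qed.

Lemma sh0 : sh (0 : R) = 0.
Proof. by rewrite sh.unlock /sinh oppr0 subrr mul0r. Qed.

Lemma chD x y : ch (x + y) = ch x * ch y + sh x * sh y.
Proof. by rewrite ch.unlock sh.unlock /cosh /sinh opprD !expRD; field. Qed.

Lemma shD x y : sh (x + y) = sh x * ch y + ch x * sh y.
Proof. by rewrite ch.unlock sh.unlock /cosh /sinh opprD !expRD; field. Qed.

Lemma chB x y : ch (x - y) = ch x * ch y - sh x * sh y.
Proof. by rewrite chD chN shN mulrN. Qed.

Lemma shB x y : sh (x - y) = sh x * ch y - ch x * sh y.
Proof. by rewrite shD chN shN mulrN. Qed.

Lemma ch2_sh2 x : ch x ^+ 2 - sh x ^+ 2 = 1.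
Proof. by rewrite !expr2 -chB subrr ch0. Qed.

Lemma ch_tangent x y : ch x + (y - x) * sh x <= ch y.
Proof.
have h (u v : R) : expR u * (1 + (v - u)) <= expR v.
  have -> : expR v = expR u * expR (v - u) by rewrite -expRD; congr expR; ring.
  by rewrite ler_wpM2l ?expR_ge0 ?expR_ge1Dx.
by have := h x y; have := h (- x) (- y); rewrite ch.unlock sh.unlock /cosh /sinh; nra.
Qed.

Lemma ch_ge1 x : 1 <= ch x.
Proof. by have := ch_tangent 0 x; rewrite ch0 sh0 mulr0 addr0. Qed.

Lemma ch_gt0 x : 0 < ch x.
Proof. exact: lt_le_trans (ch_ge1 x). Qed.

Lemma is_derive_sh x : is_derive x 1 sh (ch x).
Proof.
have -> : @sh R = (fun u => 2^-1 *: (expR u - expR (- u))).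
  by apply/funext => u; rewrite sh.unlock /sinh mulrC.
by apply: is_derive_eq; rewrite ch.unlock /cosh /GRing.scale /= mulrN1 opprK mulrC.
Qed.

Lemma sh_mvt x y : x <= y -> exists2 z, x <= z <= y & sh y - sh x = ch z * (y - x).
Proof.
move=> xy.
have [z + ->] := @MVT_segment R sh ch x y xy (fun z _ => is_derive_sh z)
  (derivable_within_continuous (fun z _ => @ex_derive _ _ _ _ _ _ _ (is_derive_sh z))).
by rewrite in_itv /=; exists z.
Qed.

Lemma sh_le x y : x <= y -> sh x <= sh y.
Proof.
move=> xy; have [z _ e] := sh_mvt xy.
by rewrite -subr_ge0 e mulr_ge0 ?subr_ge0// ltW// ch_gt0.
Qed.

Lemma sh_ge x : 0 <= x -> x <= sh x.
Proof.
move=> x0; have [z _] := sh_mvt x0; rewrite sh0 !subr0 => ->.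
by rewrite ler_peMl ?ch_ge1.
Qed.

Lemma sh_ge0 x : 0 <= x -> 0 <= sh x.
Proof. by move=> x0; exact: le_trans (sh_ge x0). Qed.

Lemma sh_gt0 x : 0 < x -> 0 < sh x.
Proof. by move=> x0; apply: lt_le_trans (sh_ge (ltW x0)). Qed.

Lemma ch_le x y : 0 <= x -> x <= y -> ch x <= ch y.
Proof.
move=> x0 xy; apply: le_trans (ch_tangent x y).
by rewrite lerDl mulr_ge0 ?subr_ge0 ?sh_ge0.
Qed.

Lemma ch_norm x : ch `|x| = ch x.
Proof. by case: (ger0P x) => _; rewrite ?chN. Qed.

Lemma ch_le_norm x y : `|x| <= y -> ch x <= ch y.
Proof. by move=> xy; rewrite -(ch_norm x) ch_le. Qed.

Lemma sh_le_mul x : 0 <= x -> sh x <= x * ch x.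
Proof.
move=> x0; have [z /andP[z0 zx]] := sh_mvt x0; rewrite sh0 !subr0 => ->.
by rewrite mulrC ler_wpM2l// ch_le.
Qed.

Lemma ch_sub_le x y : ch y - ch x <= (y - x) * sh y.
Proof. by have := ch_tangent y x; lra. Qed.

Lemma ch_sub1_ge x : x ^+ 2 / 2 <= ch x - 1.
Proof.
have -> : ch x = 1 + 2 * sh (x / 2) ^+ 2.
  have -> : ch x = ch (x / 2 + x / 2) by congr ch; lra.
  by rewrite chD; have := ch2_sh2 (x / 2); nra.
have : (x / 2) ^+ 2 <= sh (x / 2) ^+ 2.
  wlog x0 : x / 0 <= x => [hw|].
    have [|/ltW x0] := leP 0 x; first exact: hw.
    have := hw (- x); rewrite oppr_ge0 => /(_ x0).
    by rewrite mulNr shN !sqrrN.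
  have h0 : 0 <= x / 2 by lra.
  by rewrite ler_sqr ?nnegrE ?sh_ge// sh_ge0.
by nra.
Qed.

Lemma ch_sub1_le x X : 0 <= x <= X -> ch x - 1 <= x ^+ 2 * ch X.
Proof.
move=> /andP[x0 xX]; have := ch_sub_le 0 x; rewrite ch0 subr0.
have := sh_le_mul x0; have := ch_le x0 xX => h1 h2 h3.
apply: le_trans h3 _; rewrite expr2 -mulrA ler_wpM2l//.
by apply: le_trans h2 _; rewrite ler_wpM2l.
Qed.

(* The cosine of the angle opposite to the side c of a hyperbolic triangle with
   sides a, b, c. *)
Definition hypcos a b c := (ch a * ch b - ch c) / (sh a * sh b).

Lemma hypcosC a b c : hypcos a b c = hypcos b a c.
Proof. by rewrite /hypcos [ch b * _]mulrC [sh b * _]mulrC. Qed.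

Lemma hypcosE a b c : 0 < a -> 0 < b ->
  sh a * sh b * hypcos a b c = ch a * ch b - ch c.
Proof.
move=> /sh_gt0 a0 /sh_gt0 b0; rewrite /hypcos mulrC divfK//.
by rewrite mulf_neq0 ?gt_eqF.
Qed.

Lemma hypcos_bound a b c : 0 < a -> 0 < b -> `|a - b| <= c -> c <= a + b ->
  -1 <= hypcos a b c <= 1.
Proof.
move=> a0 b0 abc cab; have E := hypcosE c a0 b0.
have sab : 0 < sh a * sh b by rewrite mulr_gt0 ?sh_gt0.
have c0 : 0 <= c by apply: le_trans abc.
have := ch_le_norm abc; have := ch_le c0 cab.
rewrite chD chB => h1 h2; apply/andP; split; nra.
Qed.

Lemma hypcos_same a : 0 < a -> hypcos a a 0 = 1.
Proof.
move=> a0; have := hypcosE 0 a0 a0; rewrite ch0 -!expr2.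
have := ch2_sh2 a; have s : 0 < sh a by exact: sh_gt0.
have s2 : 0 < sh a ^+ 2 by rewrite exprn_gt0.
by move=> h1 h2; nra.
Qed.

Lemma hypcos_opposite a b : 0 < a -> 0 < b -> hypcos a b (a + b) = -1.
Proof.
move=> a0 b0; have := hypcosE (a + b) a0 b0; rewrite chD.
have : 0 < sh a * sh b by rewrite mulr_gt0 ?sh_gt0.
by move=> h1 h2; nra.
Qed.

(** First variation with an explicit error: if moving by [t] shortens the long side [A] at rate [D],
    the cosine of the angle is about [D]. Expanding cosh (A - t D) splits it into [v] = sinh (t D) /
    sinh t, which is close to [D], and [u], which is of order t / A. *)
Lemma hypcos_quotient X A t D : 0 < t -> t <= A -> A <= X -> -1 <= D <= 1 ->
  `|hypcos A t (A - t * D) - D| <= t / A * (ch X + X * sh X).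
Proof.
move=> t0 tA AX /andP[D1 D2].
have A0 : 0 < A by lra.
have sA := sh_gt0 A0; have st := sh_gt0 t0.
have := hypcosE (A - t * D) A0 t0.
set k := hypcos _ _ _; rewrite chB => E.
have tAX : ch t - 1 <= t * sh X.
  have := ch_sub_le 0 t; rewrite ch0 subr0 => h.
  by apply: le_trans h _; rewrite ler_pM2l// sh_le//; lra.
have cX : ch A <= ch X by apply: ch_le => //; lra.
have sX : 0 <= sh X by apply: sh_ge0; lra.
pose u := ch A * (ch t - ch (t * D)) / (sh A * sh t).
pose v := sh (t * D) / sh t.
have kuv : k = u + v.
  apply: (@mulfI _ (sh A * sh t)); first by rewrite mulf_neq0 ?gt_eqF.
  rewrite E /u /v; move: (sh A) (sh t) sA st => x y x0 y0.
  by field; rewrite !gt_eqF.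
have tD : ch (t * D) <= ch t.
  by apply: ch_le_norm; rewrite normrM gtr0_norm// ler_piMr ?(ltW t0)// ler_norml D1.
have u0 : 0 <= u.
  by apply: divr_ge0; apply: mulr_ge0; rewrite ?subr_ge0 ?(ltW sA) ?(ltW st) ?(ltW (ch_gt0 _)).
have u1 : u <= t / A * ch X.
  have h : ch t - ch (t * D) <= t * sh t.
    have := ch_sub_le 0 t; rewrite ch0 subr0.
    by have := ch_ge1 (t * D); lra.
  rewrite /u ler_pdivrMr ?mulr_gt0//.
  have h2 := sh_ge (ltW A0).
  have -> : t / A * ch X * (sh A * sh t) = ch X * (t * sh t) * (sh A / A).
    by field; rewrite gt_eqF.
  have h3 : 1 <= sh A / A by rewrite ler_pdivlMr// mul1r.
  have h4 : ch A * (ch t - ch (t * D)) <= ch X * (t * sh t).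
    by apply: ler_pM => //; [exact/ltW/ch_gt0|rewrite subr_ge0].
  apply: le_trans h4 _; rewrite ler_peMr//.
  by apply: mulr_ge0; [exact/ltW/ch_gt0|apply: mulr_ge0; exact: ltW].
have v1 : `|v - D| <= ch t - 1.
  rewrite /v; have : forall d, 0 <= d <= 1 ->
     `|sh (t * d) / sh t - d| <= ch t - 1.
    move=> d /andP[d0 d1].
    have td : 0 <= t * d by rewrite mulr_ge0// ltW.
    have tdt : t * d <= t by rewrite ler_piMr// ltW.
    have h1 := sh_ge td; have h2 := sh_le_mul (ltW t0).
    have h3 := sh_le_mul td; have h4 := sh_ge (ltW t0).
    have h5 := ch_le td tdt; have h6 := ch_ge1 t.
    have h7 : sh (t * d) <= t * d * ch t by apply: le_trans h3 _; rewrite ler_wpM2l.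
    have lo : d - (ch t - 1) <= sh (t * d) / sh t.
      rewrite ler_pdivlMr//.
      have [dc|dc] := leP (d - (ch t - 1)) 0.
        by apply: le_trans (le_trans td h1); rewrite mulr_le0_ge0// ltW.
      have e1 : (d - (ch t - 1)) * sh t <= (d - (ch t - 1)) * (t * ch t).
        by rewrite ler_wpM2l// ltW.
      have e2 : 0 <= t * ((ch t - 1) * (ch t - d)) by rewrite !mulr_ge0//; lra.
      by lra.
    have up : sh (t * d) / sh t <= ch t - 1 + d.
      rewrite ler_pdivrMr//.
    have e1 : (ch t - 1 + d) * t <= (ch t - 1 + d) * sh t.
      by rewrite ler_wpM2l//; lra.
    have e2 : 0 <= t * ((ch t - 1) * (1 - d)) by rewrite !mulr_ge0//; lra.
    by lra.
    by rewrite ler_norml; lra.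
  move=> hd; have [D0|/ltW D0] := leP 0 D; first by apply: hd; rewrite D0.
  have := hd (- D); rewrite mulrN shN mulNr -opprD normrN; apply.
  by rewrite oppr_ge0 D0; lra.
rewrite kuv.
have h : t * sh X <= t / A * (X * sh X).
  have -> : t / A * (X * sh X) = t * sh X * (X / A) by ring.
  by rewrite ler_peMr ?mulr_ge0// ?(ltW t0)// ler_pdivlMr// mul1r.
apply: (@le_trans _ _ (u + `|v - D|)).
  by rewrite -addrA -[X in _ <= X + _](ger0_norm u0) ler_normD.
by rewrite mulrDr; lra.
Qed.

End HyperbolicFunctions.

(** * Geodesics *)

Section MetricGeometry.
Variables (R : realType) (M : metricType R).
Implicit Types p q x y z u v w : M.

Lemma mdist_norm x y z : `|mdist x y - mdist x z| <= mdist y z.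
Proof.
have := metric_triangle x y z; have := metric_triangle x z y.
by rewrite (metric_sym z y) ler_norml; lra.
Qed.

Lemma ultra_fmap (T U : Type) (f : T -> U) (F : set_system T) :
  UltraFilter F -> UltraFilter (f @ F).
Proof.
move=> FU; split; first exact: fmap_proper_filter.
move=> G GP FG; apply/seteqP; split=> // A GA.
have [//|FA] := in_ultra_setVsetC (f @^-1` A) FU.
have GA' : G (~` A) by apply: FG.
have : G set0 by rewrite -(setICr A); exact: filterI.
by move/filter_not_empty.
Qed.

Definition between x w y := mdist x w + mdist w y = mdist x y.

(** A chain of mesh and excess [e], parametrized by accumulated length [S]. Rounding a parameter to
    a vertex costs [e] at each end. *)
Lemma approx_geodesic p q (e : R) : intrinsic M -> 0 < e ->
  exists g : R -> M,
    [/\ forall s t, 0 <= s <= mdist p q -> 0 <= t <= mdist p q ->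
          mdist (g s) (g t) <= `|s - t| + 2 * e,
        mdist p (g 0) <= e & mdist (g (mdist p q)) q <= 2 * e].
Proof.
move=> Mi e0; have [k [z [z0 zk zs zl]]] := Mi p q e e0.
pose S i := \sum_(j < i) mdist (z j) (z j.+1).
have SS i : S i.+1 = S i + mdist (z i) (z i.+1) by rewrite /S big_ord_recr.
have Sd i j : (i <= j)%N -> mdist (z i) (z j) <= S j - S i.
  elim: j => [|j IH]; first by rewrite leqn0 => /eqP ->; rewrite mdistxx subrr.
  rewrite leq_eqVlt => /orP[/eqP ->|]; first by rewrite mdistxx subrr.
  rewrite ltnS => /IH h; rewrite SS.
  by have := metric_triangle (z i) (z j) (z j.+1); lra.
have Sdn i j : mdist (z i) (z j) <= `|S i - S j|.
  have [ij|/ltnW ij] := leqP i j.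
    by apply: le_trans (Sd _ _ ij) _; rewrite distrC ler_norm.
  by rewrite metric_sym; apply: le_trans (Sd _ _ ij) _; rewrite ler_norm.
have index t : 0 <= t <= mdist p q -> exists2 i, (i <= k)%N & `|S i - t| <= e.
  move=> /andP[t0 tL].
  have : t <= S k by have := Sd 0 k (leq0n k); rewrite z0 zk /S big_ord0; lra.
  suff : forall j, (j <= k)%N -> t <= S j -> exists2 i, (i <= j)%N & `|S i - t| <= e.
    by move=> /(_ k (leqnn k)).
  elim=> [_|j IH jk]; rewrite ?SS /=.
    by rewrite /S big_ord0 => h; exists 0%N => //; rewrite big_ord0 ler_norml; lra.
  have [tj _|tj h] := leP t (S j).
    by have [i ij ?] := IH (ltnW jk) tj; exists i => //; exact: leqW.
  exists j.+1 => //; rewrite SS; have := zs j jk.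
  by rewrite ler_norml; lra.
have {index} index (t : R) : exists i, 0 <= t <= mdist p q -> (i <= k)%N /\ `|S i - t| <= e.
  have [h|h] := pselect (0 <= t <= mdist p q).
    by have [i ? ?] := index t h; exists i.
  by exists 0%N.
have [f fP] := choice index.
exists (z \o f); split=> [s t /fP[_ hs] /fP[_ ht]| |] /=.
- apply: le_trans (Sdn _ _) _.
  by move: hs ht (ler_norm (s - t)) (ler_norm (- (s - t))); rewrite normrN !ler_norml; lra.
- have [_] := fP (0 : R) (introT andP (conj (lexx 0) (mdist_ge0 p q))).
  move=> h; rewrite -z0; apply: le_trans (Sdn _ _) _.
  by rewrite /S big_ord0 add0r normrN -[X in `|X|]subr0.
- have [fk h] := fP (mdist p q) (introT andP (conj (mdist_ge0 p q) (lexx _))).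
  move: fk h; set i := f _ => fk h; rewrite -[q in mdist _ q]zk; apply: le_trans (Sd _ _ fk) _.
  by move: h zl; rewrite ler_norml -/(S k); lra.
Qed.

(** Along one ultrafilter the approximate geodesics converge at all parameters at once, which
    replaces the diagonal argument of Arzela-Ascoli. Only the 1-Lipschitz bound passes to the limit;
    the reverse inequality follows, since the pieces before s, from s to t and after t must add up
    to at least d(p, q). *)
Lemma exists_min_geodesic p q : compact [set: M] -> intrinsic M ->
  exists g, min_geodesic p q g.
Proof.
move=> Mc Mi; set L := mdist p q.
have e0 (N : nat) : 0 < (N.+1%:R : R)^-1 by rewrite invr_gt0.
have [G GP] := choice (fun N => approx_geodesic p q Mi (e0 N)).
have [U [UU oU]] := ultraFilterLemma (@eventually_filter).
have UF : ProperFilter U := @ultra_proper _ _ UU.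
have lim (t : R) : exists x, (fun N => G N t) @ U --> x.
  move: Mc; rewrite compact_ultra => /(_ _ (ultra_fmap (fun N => G N t) UU)).
  by case=> [|x [_ ?]]; [exact: filterT|exists x].
have [g gP] := choice lim.
have gU (t e : R) : 0 < e -> U [set N | mdist (g t) (G N t) < e].
  by move=> e_gt0; have := gP t _ (nbhsx_ballx (g t) e e_gt0); rewrite ballEmdist.
have eU (e : R) : 0 < e -> U [set N : nat | (N.+1%:R : R)^-1 < e].
  by move=> e_gt0; apply: oU; exact: near_infty_natSinv_lt (PosNum e_gt0).
have Uex (A : set nat) : U A -> exists N, A N by move=> /filter_ex.
have lip (s t : R) : 0 <= s <= L -> 0 <= t <= L -> mdist (g s) (g t) <= `|s - t|.
  move=> hs ht; apply/ler_addgt0Pr => e e_gt0.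
  have e4 : 0 < e / 4 by lra.
  have [N [/= [h1 h2] h3]] := Uex _ (filterI (filterI (gU s _ e4) (gU t _ e4)) (eU _ e4)).
  have [h _ _] := GP N; have {}h := h s t hs ht; move: h h3; set iN := _^-1 => h h3.
  have := metric_triangle (g s) (G N s) (g t).
  have := metric_triangle (G N s) (G N t) (g t).
  by rewrite (metric_sym (G N t)); lra.
have g0 : g 0 = p.
  apply/esym/mdist_positivity/eqP; rewrite eq_le mdist_ge0 andbT.
  apply/ler_addgt0Pr => e e_gt0; have e4 : 0 < e / 4 by lra.
  have [N [/= h1 h2]] := Uex _ (filterI (gU 0 _ e4) (eU _ e4)).
  have [_ h _] := GP N; move: h h2; set iN := _^-1 => h h2; have := metric_triangle p (G N 0) (g 0).
  by rewrite (metric_sym (G N 0)); lra.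
have gL : g L = q.
  apply/mdist_positivity/eqP; rewrite eq_le mdist_ge0 andbT.
  apply/ler_addgt0Pr => e e_gt0; have e4 : 0 < e / 4 by lra.
  have [N [/= h1 h2]] := Uex _ (filterI (gU L _ e4) (eU _ e4)).
  have [_ _ h] := GP N; move: h h2; set iN := _^-1 => h h2; have := metric_triangle (g L) (G N L) q.
  by rewrite -/L in h; lra.
exists g; split=> // s t.
wlog st : s t / s <= t => [hw hs ht|hs ht].
  have [st|/ltW ts] := leP s t; first exact: hw.
  by rewrite metric_sym distrC; exact: hw.
have L0 : 0 <= L by exact: mdist_ge0.
have := lip _ _ hs ht; rewrite ler0_norm ?subr_le0// opprB => h.
move: hs ht => /andP[s0 sL] /andP[t0 tL].
have h0 : mdist (g 0) (g s) <= s.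
  apply: le_trans (lip _ _ _ _) _; rewrite ?lexx ?s0//.
  by rewrite sub0r normrN ger0_norm.
have h1 : mdist (g t) (g L) <= L - t.
  apply: le_trans (lip _ _ _ _) _; rewrite ?lexx ?t0 ?L0//.
  by rewrite distrC ger0_norm// subr_ge0.
have := metric_triangle p (g s) q; have := metric_triangle (g s) (g t) q.
by rewrite -/L; move: h0 h1; rewrite g0 gL => h0 h1 h2 h3; apply/eqP; rewrite eq_le h; lra.
Qed.

End MetricGeometry.

(** * Comparison angles *)

Section Comparison.
Variables (R : realType) (M : metricType R).
Implicit Types p q x y z u v w : M.

Local Notation "`d( x , y )" := (mdist x y) (at level 0, format "`d( x ,  y )").

Definition hcos p x y : R := hypcos `d(p, x) `d(p, y) `d(x, y).

Lemma hcosC p x y : hcos p x y = hcos p y x.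
Proof. by rewrite /hcos hypcosC (metric_sym x y). Qed.

(** With the denominators cleared, the law of cosines also holds for p = x and p = y, where both
    sides vanish. *)
Lemma hcosE p x y :
  sh `d(p, x) * sh `d(p, y) * hcos p x y = ch `d(p, x) * ch `d(p, y) - ch `d(x, y).
Proof.
have [->|px] := eqVneq p x; first by rewrite mdistxx sh0 ch0 !mul0r mul1r subrr.
have [->|py] := eqVneq p y.
  by rewrite mdistxx sh0 ch0 mulr0 mul0r mulr1 (metric_sym x) subrr.
by apply: hypcosE; rewrite mdist_gt0.
Qed.

Lemma hcos_bound p x y : p != x -> p != y -> -1 <= hcos p x y <= 1.
Proof.
move=> px py; apply: hypcos_bound; rewrite ?mdist_gt0 ?mdist_norm//.
by rewrite (metric_sym p x); exact: metric_triangle.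
Qed.

Lemma hcos_same p x : p != x -> hcos p x x = 1.
Proof. by move=> px; rewrite /hcos mdistxx hypcos_same// mdist_gt0. Qed.

Lemma hcos_opposite u w v : between u w v -> w != u -> w != v -> hcos w u v = -1.
Proof.
move=> uwv wu wv; rewrite /hcos -uwv (metric_sym u w).
by rewrite hypcos_opposite// mdist_gt0.
Qed.

(* Equivalently: along a geodesic with midpoint w and ends u, v the function
   f = cosh d(z, -) satisfies f'' <= f. *)
Definition straight u w v z :=
  sh `d(w, v) * ch `d(z, u) + sh `d(u, w) * ch `d(z, v) <= ch `d(z, w) * sh `d(u, v).

(** Two angles in [0, pi] add up to at most pi iff their cosines have a nonnegative sum, so
    [straight] says that adjacent comparison angles at [w] add up to at most pi. The sinh factors
    cover the degenerate positions. *)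
Lemma straightE u w v z : between u w v ->
  straight u w v z <->
  0 <= sh `d(w, u) * sh `d(w, v) * sh `d(w, z) * (hcos w u z + hcos w v z).
Proof.
move=> uwv; rewrite /straight -uwv shD (metric_sym u w) ![`d(z, _)]metric_sym.
have := hcosE w u z; have := hcosE w v z.
move: (hcos w u z) (hcos w v z) => k1 k2 E2 E1.
have -> : sh `d(w, u) * sh `d(w, v) * sh `d(w, z) * (k1 + k2) =
  sh `d(w, v) * (sh `d(w, u) * sh `d(w, z) * k1) +
  sh `d(w, u) * (sh `d(w, v) * sh `d(w, z) * k2) by ring.
rewrite E1 E2 -subr_ge0.
by set A := (X in 0 <= X <-> _); set B := (X in _ <-> 0 <= X); have -> : A = B by rewrite /A /B; ring.
Qed.

Lemma straight_hcos u w v z : between u w v -> w != u -> w != v -> w != z ->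
  straight u w v z -> 0 <= hcos w u z + hcos w v z.
Proof.
move=> uwv wu wv wz /(straightE z uwv); rewrite pmulr_rge0//.
by rewrite !mulr_gt0// sh_gt0// mdist_gt0.
Qed.

Lemma hcos_straight u w v z : between u w v ->
  (w != u -> w != v -> w != z -> 0 <= hcos w u z + hcos w v z) -> straight u w v z.
Proof.
move=> uwv h; apply/straightE => //.
have [->|wu] := eqVneq w u; first by rewrite mdistxx sh0 !mul0r.
have [->|wv] := eqVneq w v; first by rewrite mdistxx sh0 mulr0 !mul0r.
have [->|wz] := eqVneq w z; first by rewrite mdistxx sh0 mulr0 !mul0r.
by rewrite mulr_ge0 ?h// ltW// !mulr_gt0// sh_gt0// mdist_gt0.
Qed.

(** By [straight], q is at least as far from [p0] as in the model triangle of x, p, q; hence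
    shortening a side from p to [p0] can only enlarge the comparison angle at x. *)
Lemma hcos_mono1 x p0 p q : between x p0 p -> x != p0 -> x != q ->
  straight x p0 p q -> hcos x p0 q <= hcos x p q.
Proof.
move=> xp xp0 xq; rewrite /straight => h.
have p0_gt0 : 0 < `d(x, p0) by rewrite mdist_gt0.
have p_gt0 : 0 < `d(x, p) by rewrite -xp ltr_pwDl ?mdist_ge0.
have q_gt0 : 0 < `d(x, q) by rewrite mdist_gt0.
have E0 := hcosE x p0 q; have E := hcosE x p q.
have S : 0 < sh `d(x, p) * sh `d(x, p0) * sh `d(x, q) by rewrite !mulr_gt0// sh_gt0.
rewrite -(ler_pM2l S).
have -> : sh `d(x, p) * sh `d(x, p0) * sh `d(x, q) * hcos x p0 q =
  sh `d(x, p) * (sh `d(x, p0) * sh `d(x, q) * hcos x p0 q) by ring.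
have -> : sh `d(x, p) * sh `d(x, p0) * sh `d(x, q) * hcos x p q =
  sh `d(x, p0) * (sh `d(x, p) * sh `d(x, q) * hcos x p q) by ring.
rewrite E0 E; move: h.
have -> : `d(p0, p) = `d(x, p) - `d(x, p0) by rewrite -xp; ring.
rewrite shB (metric_sym q x) (metric_sym q p) (metric_sym q p0) => h.
rewrite -subr_ge0; move: h; rewrite -subr_ge0.
by set A := (X in 0 <= X -> _); set B := (X in _ -> 0 <= X); have -> : A = B by rewrite /A /B; ring.
Qed.

Hypotheses (Mc : compact [set: M]) (Mi : intrinsic M).

Lemma exists_between x y (s : R) : 0 <= s <= `d(x, y) ->
  exists w, [/\ `d(x, w) = s, `d(w, y) = `d(x, y) - s & between x w y].
Proof.
move=> sxy; have [g [g0 gL gP]] := exists_min_geodesic x y Mc Mi.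
have d0 : 0 <= `d(x, y) by exact: mdist_ge0.
have h1 : `d(x, g s) = s.
  by rewrite -[in LHS]g0 gP ?lexx//= sub0r normrN ger0_norm; case/andP: sxy.
have h2 : `d(g s, y) = `d(x, y) - s.
  rewrite -[in LHS]gL gP ?lexx ?d0// distrC ger0_norm// subr_ge0.
  by case/andP: sxy.
by exists (g s); split=> //; rewrite /between h1 h2; ring.
Qed.

Lemma acos_sum_le_pi (k1 k2 : R) : -1 <= k1 <= 1 -> -1 <= k2 <= 1 ->
  acos k1 + acos k2 <= pi -> 0 <= k1 + k2.
Proof.
move=> h1 h2 h; have h3 : acos k1 <= acos (- k2) by rewrite acosN//; lra.
have h2' : -1 <= - k2 <= 1 by lra.
rewrite -lerBlDr sub0r -(acosK h1) -[X in X <= _](acosK h2').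
by rewrite leNgt ltr_cos ?in_itv/= ?acos_ge0 ?acos_lepi //= -leNgt.
Qed.

(** In the quadruple condition at w the angle between u and v is pi, which leaves at most pi for the
    other two. The radius is uniform by compactness: centers [W N] of counterexamples at scale 1 /
    (N + 1) would accumulate at some x, whose neighbourhood [U] contains an entire counterexample.
    The cases z = u and z = v are separate because the condition asks for distinct points. *)
Lemma local_straight : curvature_ge_m1 M -> exists2 r : R, 0 < r &
  forall u w v z, between u w v -> `d(w, u) < r -> `d(w, v) < r -> `d(w, z) < r ->
    straight u w v z.
Proof.
move=> Mk; apply: contrapT => no.
pose bad w (r : R) := exists u v z, [/\ between u w v, `d(w, u) < r,
   `d(w, v) < r, `d(w, z) < r & ~ straight u w v z].
have ex N : exists w, bad w (N.+1%:R)^-1.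
  apply: contrapT => h; apply: no; exists (N.+1%:R)^-1; first by rewrite invr_gt0.
  move=> u w v z *; apply: contrapT => ns; apply: h.
  by exists w, u, v, z; split.
have [W WP] := choice ex.
have [x [_ xW]] := Mc (fmap_proper_filter W eventually_filter) filterT.
have [U xU UP] := Mk x.
have [e e0 xeU] : exists2 e : R, 0 < e & forall y, `d(x, y) < e -> U y.
  move/nbhs_ballP: xU => [e /= e0 h]; exists e => // y xy.
  by apply: h; rewrite ballEmdist.
have e2 : 0 < e / 2 by lra.
have [y [[N Ne Wy] yx]] : (W @` [set N | (N.+1%:R : R)^-1 < e / 2]) `&` ball x (e / 2) !=set0.
  apply: xW; last exact: nbhsx_ballx.
  have : \oo [set N | (N.+1%:R : R)^-1 < e / 2] by exact: near_infty_natSinv_lt (PosNum e2).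
  by apply: filterS => N hN; exists N.
move: Ne => /= Ne; have xw : `d(x, W N) < e / 2 by move: yx; rewrite ballEmdist -Wy.
have [u [v [z [uwv wu wv wz]]]] := WP N; apply.
move: Ne wu wv wz; set i := _^-1 => Ne wu wv wz.
have near a : `d(W N, a) < i -> U a.
  by move=> h; apply: xeU; have := metric_triangle x (W N) a; lra.
have Uw : U (W N) by apply: xeU; lra.
apply: hcos_straight => // wu0 wv0 wz0.
have [zu|zu] := eqVneq z u.
  by rewrite zu hcos_same// hcosC hcos_opposite// subrr.
have [zv|zv] := eqVneq z v.
  by rewrite zv hcos_same// hcos_opposite// addrC subrr.
have uv : u != v.
  rewrite -mdist_gt0 -uwv ltr_pwDl ?mdist_ge0// mdist_gt0 eq_sym//.
have /= := UP (W N) u v z Uw (near _ wu) (near _ wv) (near _ wz).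
rewrite !inE !negb_or wu0 wv0 wz0 uv (eq_sym u z) zu (eq_sym v z) zv => /(_ isT).
have hE a b c : hyp_comparison_angle a b c = acos (hcos a b c).
  by rewrite /hcos /hypcos ch.unlock sh.unlock.
rewrite !hE (hcos_opposite uwv)// acosN1 => h.
rewrite (hcosC _ u z) addrC; apply: acos_sum_le_pi; rewrite ?hcos_bound//.
by lra.
Qed.

End Comparison.

(** * Globalization *)

Lemma exists_min4 (R : realFieldType) (a b c d : R) : 0 < a -> 0 < b -> 0 < c -> 0 < d ->
  exists m, [/\ 0 < m, m <= a, m <= b, m <= c & m <= d].
Proof.
move=> a0 b0 c0 d0; exists (Num.min a (Num.min b (Num.min c d))).
by rewrite !lt_min a0 b0 c0 d0 !ge_min !lexx !orbT.
Qed.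

Section Globalization.
Variables (R : realType) (M : metricType R).
Implicit Types p q x y z u v w : M.

Local Notation "`d( x , y )" := (mdist x y) (at level 0, format "`d( x ,  y )").

Hypotheses (Mc : compact [set: M]) (Mi : intrinsic M).

(** Hinge comparison for side lengths of sum below [l]. The germs of the sides at x are represented
    by points [p0], [q0] within [r] of x, so that no limit of angles occurs. *)
Definition hinge (r l : R) := forall x p q p0 q0, between x p0 p -> between x q0 q ->
  0 < `d(x, p0) < r -> 0 < `d(x, q0) < r -> `d(x, p) + `d(x, q) < l ->
  hcos x p0 q0 <= hcos x p q.

Definition all_straight (r : R) := forall u w v z, between u w v ->
  `d(w, u) < r -> `d(w, v) < r -> `d(w, z) < r -> straight u w v z.

Lemma hinge_local (r l : R) : all_straight l -> hinge r l.
Proof.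
move=> st x p q p0 q0 xp xq /andP[xp0 _] /andP[xq0 _] l0.
have h1 := metric_triangle p0 x q; have h2 := metric_triangle q0 x p0.
have p_ge0 := mdist_ge0 p0 p; have q_ge0 := mdist_ge0 q0 q.
move: xp xq (xp) (xq); rewrite {1 2}/between => exp exq xp xq.
have nx a : 0 < `d(x, a) -> x != a by rewrite mdist_gt0.
rewrite (metric_sym p0 x) in h1; rewrite (metric_sym q0 x) in h2.
apply: (@le_trans _ _ (hcos x p0 q)).
  rewrite ![hcos x p0 _]hcosC; apply: hcos_mono1; rewrite ?nx//.
  by apply: st => //; rewrite ?(metric_sym q0 x); lra.
apply: hcos_mono1; rewrite ?nx//; first by lra.
by apply: st => //; rewrite ?(metric_sym p0 x); lra.
Qed.

(* The extended model side: the distance from q to p when the model triangle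
   with sides a1, b, d is extended beyond a1 to the length a. *)
Lemma extended_side (a b d a1 k : R) :
  sh a1 * sh b * k = ch a1 * ch b - ch d ->
  sh a1 * (ch a * ch b - sh a * sh b * k) = sh a * ch d - sh (a - a1) * ch b.
Proof.
move=> E; have -> : sh a1 * (ch a * ch b - sh a * sh b * k) =
  sh a1 * (ch a * ch b) - sh a * (sh a1 * sh b * k) by ring.
by rewrite E shB; ring.
Qed.

(** The same extended side as in [extended_side], read from the other end of the side [a1], where
    the extension makes the supplementary angle, of cosine [- k]. *)
Lemma extended_side_back (a b d a1 k : R) :
  sh a1 * sh d * k = ch a1 * ch d - ch b ->
  sh a1 * (ch (a - a1) * ch d + sh (a - a1) * sh d * k) =
  sh a * ch d - sh (a - a1) * ch b.
Proof.
move=> E; have -> : sh a1 * (ch (a - a1) * ch d + sh (a - a1) * sh d * k) =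
  sh a1 * ch (a - a1) * ch d + sh (a - a1) * (sh a1 * sh d * k) by ring.
rewrite E; have -> : sh a = sh ((a - a1) + a1) by congr sh; ring.
by move: (a - a1) => a'; rewrite shD; ring.
Qed.

(** If the excess a1 + b - d is small, the model triangle is almost degenerate, and its extended
    side is almost a + b. *)
Lemma extended_side_defect (a b d a1 : R) : 0 <= d ->
  sh a1 * ch (a + b) - sh a * ((a1 + b - d) * sh (a1 + b)) <=
    sh a * ch d - sh (a - a1) * ch b \/ a < 0.
Proof.
move=> d0; have [a_ge0|] := leP 0 a; [left|by right].
have h := ch_sub_le d (a1 + b).
have : sh a * (ch (a1 + b) - ch d) <= sh a * ((a1 + b - d) * sh (a1 + b)).
  by rewrite ler_wpM2l// sh_ge0.
have -> : sh (a - a1) * ch b = sh a * ch (a1 + b) - sh a1 * ch (a + b).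
  by rewrite shB !chD; ring.
by rewrite mulrBr; lra.
Qed.

(* Moving the vertex x of a hinge towards the farther end p by s does not increase
   its model side; unless this shortens the hinge by e, the hinge is so close to
   a straight one that its model side is at least d(p, q), up to C e. *)
Lemma hinge_extend (r l : R) : 0 < r -> r < l / 18 -> all_straight r ->
  hinge r (2 / 3 * l) -> hinge r l.
Proof.
move=> r0 rl st hl; have l0 : 0 < l by lra.
have s18 : 0 < sh (l / 18) by apply: sh_gt0; lra.
have shl : 0 <= sh l by apply: sh_ge0; lra.
have [C C0 hC] : exists2 C, 0 <= C & sh (l / 18) * C = sh l * sh l.
  exists (sh l * sh l / sh (l / 18)); last by rewrite mulrC divfK// gt_eqF.
  by rewrite divr_ge0 ?mulr_ge0// ltW.
(* [N] counts the steps of size [e] by which the hinge exceeds 2 l / 3. Each move of the vertex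
   takes one step off, and the error [C * e] is handed on unchanged instead of accumulating, so [e]
   may tend to 0. *)
suff key : forall (e : R), 0 < e -> forall (N : nat) x p q p0 q0,
    between x p0 p -> between x q0 q ->
    0 < `d(x, p0) < r -> 0 < `d(x, q0) < r ->
    `d(x, p) + `d(x, q) < l -> `d(x, p) + `d(x, q) < 2 / 3 * l + N%:R * e ->
    ch `d(p, q) - C * e <=
      ch `d(x, p) * ch `d(x, q) - sh `d(x, p) * sh `d(x, q) * hcos x p0 q0.
  move=> x p q p0 q0 xp xq xp0 xq0 xl.
  have p_gt0 : 0 < `d(x, p).
    by rewrite -xp ltr_pwDl ?mdist_ge0//; case/andP: xp0.
  have q_gt0 : 0 < `d(x, q).
    by rewrite -xq ltr_pwDl ?mdist_ge0//; case/andP: xq0.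
  have spq : 0 < sh `d(x, p) * sh `d(x, q) by rewrite mulr_gt0// sh_gt0.
  rewrite -(ler_pM2l spq) hcosE.
  suff : ch `d(p, q) <= ch `d(x, p) * ch `d(x, q) -
      sh `d(x, p) * sh `d(x, q) * hcos x p0 q0 by lra.
  apply/ler_addgt0Pr => e e0; pose e1 := e / (C + 1).
  have e1_gt0 : 0 < e1 by rewrite /e1 divr_gt0//; lra.
  have Ce : C * e1 <= e.
    have : (C + 1) * e1 = e by rewrite /e1 mulrC divfK//; lra.
    by lra.
  pose N := (Num.bound (l / e1)).
  have Nl : l < N%:R * e1.
    rewrite -ltr_pdivrMr//; apply: le_lt_trans (archi_boundP _); first exact: lexx.
    by rewrite divr_ge0// ltW.
  have := key e1 e1_gt0 N x p q p0 q0 xp xq xp0 xq0 xl.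
  move=> /(_ ltac:(lra)); lra.
move=> e e0; have Ce0 : 0 <= C * e by rewrite mulr_ge0// ltW.
have base x p q p0 q0 : between x p0 p -> between x q0 q ->
    0 < `d(x, p0) < r -> 0 < `d(x, q0) < r -> `d(x, p) + `d(x, q) < 2 / 3 * l ->
    ch `d(p, q) - C * e <=
      ch `d(x, p) * ch `d(x, q) - sh `d(x, p) * sh `d(x, q) * hcos x p0 q0.
  move=> xp xq xp0 xq0 /(hl _ _ _ _ _ xp xq xp0 xq0) h.
  have := hcosE x p q.
  have : sh `d(x, p) * sh `d(x, q) * hcos x p0 q0 <= sh `d(x, p) * sh `d(x, q) * hcos x p q.
    by rewrite ler_wpM2l// mulr_ge0// sh_ge0// mdist_ge0.
  by lra.
elim=> [|N IH] x p q p0 q0 xp xq xp0 xq0 xl.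
  by rewrite mul0r addr0; exact: base.
wlog ba : p q p0 q0 xp xq xp0 xq0 xl / `d(x, q) <= `d(x, p).
  move=> hw; have [h|/ltW h] := leP `d(x, q) `d(x, p); first exact: hw.
  have := hw q p q0 p0 xq xp xq0 xp0 ltac:(lra) h.
  by rewrite (metric_sym q p) hcosC [ch `d(x, q) * _]mulrC [sh `d(x, q) * _]mulrC
     [`d(x, q) + _]addrC.
have [h _|h hN] := ltP (`d(x, p) + `d(x, q)) (2 / 3 * l); first exact: base.
set a := `d(x, p) in xl ba h hN *; set b := `d(x, q) in xl ba h hN *.
have b0 : 0 < b by rewrite /b -xq ltr_pwDl ?mdist_ge0//; case/andP: xq0.
pose s := (2 / 3 * l - b) / 3.
have sl : l / 18 < s by rewrite /s; lra.
have s_gt0 : 0 < s by lra.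
have sa : s < a by rewrite /s; lra.
have s_small : 2 * s + b < 2 / 3 * l by rewrite /s; lra.
have /andP[xp0_gt0 xp0_lt] := xp0.
have [x' [p0x' x'p p0x'p]] : exists x', [/\ `d(p0, x') = s - `d(x, p0),
    `d(x', p) = `d(p0, p) - (s - `d(x, p0)) & between p0 x' p].
  by apply: (exists_between Mc Mi); move: xp; rewrite /between -/a; lra.
have {}x'p : `d(x', p) = a - s by rewrite x'p /a -xp; ring.
have xx' : `d(x, x') = s.
  apply/eqP; rewrite eq_le; apply/andP; split.
    by have := metric_triangle x p0 x'; lra.
  by have := metric_triangle x x' p; rewrite -/a; lra.
have xp0x' : between x p0 x' by rewrite /between p0x' xx'; ring.
have xx'p : between x x' p by rewrite /between xx' x'p -/a; ring.
have x0a : 0 <= a by lra.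
set H := (X in _ <= X); set d := `d(x', q).
have d0 : 0 <= d by exact: mdist_ge0.
have ss : 0 < sh s by exact: sh_gt0.
have ssa : 0 <= sh a by exact: sh_ge0.
have ssa' : 0 <= sh (a - s) by apply: sh_ge0; lra.
(* [E] is cosh of the extended side: the model triangle of x, x', q with the side from x through x'
   prolonged to length a. *)
pose E := (sh a * ch d - sh (a - s) * ch b) / sh s.
have sE : sh s * E = sh a * ch d - sh (a - s) * ch b.
  by rewrite /E mulrC divfK// gt_eqF.
have EH : E <= H.
  rewrite -(ler_pM2l ss) sE.
  have := hcosE x x' q; rewrite xx' -/b -/d => /(extended_side a) <-.
  rewrite ler_pM2l// /H -/a -/b lerB// ler_wpM2l ?mulr_ge0 ?(sh_ge0 (ltW b0))//.
  by apply: hl => //; rewrite xx' -/b; lra.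
apply: le_trans EH; rewrite -(ler_pM2l ss) sE.
have pq_ge0 := mdist_ge0 p q.
have [de|de] := ltP (s + b - d) e.
  have [] := @extended_side_defect a b d s d0; last by lra.
  move=> hE; apply: le_trans hE; rewrite mulrBr.
  have h1 : ch `d(p, q) <= ch (a + b).
    apply: ch_le => //; rewrite /a /b (metric_sym x p); exact: metric_triangle.
  have h2 : sh s * ch `d(p, q) <= sh s * ch (a + b) by rewrite ler_pM2l.
  have h3 : sh a * ((s + b - d) * sh (s + b)) <= sh s * (C * e).
    apply: (@le_trans _ _ (sh l * (e * sh l))); last first.
      have -> : sh l * (e * sh l) = sh (l / 18) * (C * e).
        by transitivity (sh l * sh l * e); [ring|rewrite -hC; ring].
      by rewrite ler_wpM2r// sh_le//; lra.
    apply: ler_pM => //.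
    - rewrite mulr_ge0//; last by apply: sh_ge0; lra.
      by have := metric_triangle x' x q; rewrite (metric_sym x' x) xx' -/d -/b; lra.
    - by apply: sh_le; lra.
    - have i2 : sh (s + b) <= sh l by apply: sh_le; lra.
      apply: ler_pM => //; last by lra.
        by have := metric_triangle x' x q; rewrite (metric_sym x' x) xx' -/d -/b; lra.
      by apply: sh_ge0; lra.
  by lra.
have [dz|dn0] := eqVneq x' q.
  have d_0 : d = 0 by rewrite /d dz mdistxx.
  have bs : b = s by rewrite /b -dz.
  have pqE : `d(p, q) = a - s by rewrite -dz metric_sym x'p.
  rewrite d_0 ch0 bs pqE.
  have e1 : sh a = sh (a - s) * ch s + ch (a - s) * sh s.
    by rewrite -shD; congr sh; ring.
  have : 0 <= sh s * (C * e) by rewrite mulr_ge0// ltW.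
  by rewrite e1; lra.
have d_gt0 : 0 < d by rewrite /d mdist_gt0.
have as_gt0 : 0 < a - s by rewrite subr_gt0.
have [m [m_gt0 mr2 ma ms md]] := exists_min4 (divr_gt0 r0 (ltr0n _ 2)) as_gt0 s_gt0 d_gt0.
have mr : m < r by lra.
have [v0 [x'v0 _ x'v0p]] : exists v, [/\ `d(x', v) = m, `d(v, p) = `d(x', p) - m & between x' v p].
  by apply: (exists_between Mc Mi); rewrite x'p; lra.
have [u0 [x'u0 u0x x'u0x]] : exists v, [/\ `d(x', v) = m, `d(v, x) = `d(x', x) - m & between x' v x].
  by apply: (exists_between Mc Mi); rewrite (metric_sym x' x) xx'; lra.
have [q1 [x'q1 _ x'q1q]] : exists v, [/\ `d(x', v) = m, `d(v, q) = `d(x', q) - m & between x' v q].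
  by apply: (exists_between Mc Mi); rewrite -/d; lra.
have u0v0 : between u0 x' v0.
  rewrite /between; apply/eqP; rewrite eq_le; apply/andP; split; last exact: metric_triangle.
  have := metric_triangle x u0 p; have := metric_triangle u0 v0 p.
  move: x'v0p; rewrite /between (metric_sym u0 x') (metric_sym x u0) u0x.
  by rewrite (metric_sym x' x) xx' x'u0 x'v0 x'p -/a; lra.
have adj : 0 <= hcos x' u0 q1 + hcos x' v0 q1.
  apply: straight_hcos => //; rewrite -?mdist_gt0 ?x'u0 ?x'v0 ?x'q1//.
  by apply: st; rewrite ?x'u0 ?x'v0 ?x'q1.
have back : hcos x' u0 q1 <= hcos x' x q.
  by apply: hl => //; rewrite ?x'u0 ?x'q1 ?m_gt0// (metric_sym x' x) xx' -/d; lra.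
have := IH x' p q v0 q1 x'v0p x'q1q; rewrite x'v0 x'q1 m_gt0 mr => /(_ isT isT).
rewrite x'p -/d => /(_ ltac:(lra)); rewrite -natr1 in hN.
have hN' : a - s + d < 2 / 3 * l + N%:R * e by rewrite mulrDl mul1r in hN; lra.
move=> /(_ hN') hIH.
have := hcosE x' x q; rewrite (metric_sym x' x) xx' -/b -/d => /(extended_side_back a) <-.
rewrite ler_pM2l//; apply: le_trans hIH _.
have : sh (a - s) * sh d * - hcos x' v0 q1 <= sh (a - s) * sh d * hcos x' x q.
  by rewrite ler_wpM2l ?mulr_ge0 ?(sh_ge0 d0)//; lra.
by rewrite mulrN; lra.
Qed.

Lemma hinge_global : curvature_ge_m1 M -> exists2 r : R, 0 < r &
  all_straight r /\ forall l, hinge r l.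
Proof.
move=> /(local_straight Mc)[r r0 st].
(* Germs of size r / 20 meet the condition of [hinge_extend] at all sizes r (3/2)^k with k > 0,
   while [hinge_local] with the full radius r starts the induction at size r. *)
have st18 : all_straight (r / 20).
  by move=> u w v z uwv *; apply: st => //; lra.
exists (r / 20); first by lra.
split=> // l.
have hk k : hinge (r / 20) (r * (3 / 2) ^+ k).
  elim: k => [|k IH]; first by rewrite expr0 mulr1; exact: hinge_local.
  have k1 : 1 <= (3 / 2 : R) ^+ k.+1 by rewrite exprn_ege1//; lra.
  apply: hinge_extend => //; first by lra.
    have rk : r <= r * (3 / 2) ^+ k.+1 by rewrite ler_peMr// ltW.
    by lra.
  by have -> : 2 / 3 * (r * (3 / 2) ^+ k.+1) = r * (3 / 2) ^+ k by rewrite exprS; field.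
have [k kl] : exists k, l <= r * (3 / 2) ^+ k.
  have h k : 1 + k%:R / 2 <= (3 / 2 : R) ^+ k.
    elim: k => [|k IH]; first by rewrite expr0; lra.
    by have k0 : 0 <= k%:R :> R by []; rewrite exprS -natr1; lra.
  exists (Num.bound (2 * `|l| / r)).
  have := archi_boundP (divr_ge0 (mulr_ge0 (ler0n _ 2) (normr_ge0 l)) (ltW r0)).
  set N := Num.bound _ => hN; rewrite ltr_pdivrMr// in hN.
  have := h N; rewrite -(ler_pM2l r0); have := ler_norm l; nra.
by move=> x p q p0 q0 xp xq xp0 xq0 hx; apply: hk (lt_le_trans hx kl).
Qed.

End Globalization.

(** Pull u, v, z toward w until the local inequality applies. By the global hinge comparison both
    cosines at w only grow when the original points are restored. *)
Lemma straight_global (R : realType) (M : metricType R) (u w v z : M) :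
  compact [set: M] -> intrinsic M -> curvature_ge_m1 M ->
  between u w v -> straight u w v z.
Proof.
move=> Mc Mi /(hinge_global Mc Mi)[r r0 [st hg]] uwv.
apply: hcos_straight => // wu wv wz.
move: wu wv wz; rewrite -!mdist_gt0 => wu wv wz.
have [m [m_gt0 mr2 mu mv mz]] := exists_min4 (divr_gt0 r0 (ltr0n _ 2)) wu wv wz.
have mr : m < r by lra.
have pick a : m <= mdist w a -> exists b, mdist w b = m /\ between w b a.
  move=> h; have [|b [? _ ?]] := @exists_between _ _ Mc Mi w a m; last by exists b.
  by rewrite (ltW m_gt0).
have [u0 [wu0 bu]] := pick u mu; have [v0 [wv0 bv]] := pick v mv.
have [z0 [wz0 bz]] := pick z mz.
have u0v0 : between u0 w v0.
  rewrite /between; apply/eqP; rewrite eq_le; apply/andP; split; last exact: metric_triangle.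
  have := metric_triangle u u0 v; have := metric_triangle u0 v0 v.
  move: bu bv uwv; rewrite /between (metric_sym u0 w) (metric_sym u w) (metric_sym u u0); lra.
have : 0 <= hcos w u0 z0 + hcos w v0 z0.
  apply: straight_hcos => //; rewrite -?mdist_gt0 ?wu0 ?wv0 ?wz0//.
  by apply: st; rewrite ?wu0 ?wv0 ?wz0.
have mmr : 0 < m < r by rewrite m_gt0.
have h1 : hcos w u0 z0 <= hcos w u z by apply: (hg (mdist w u + mdist w z + 1)); rewrite ?wu0 ?wz0//; lra.
have h2 : hcos w v0 z0 <= hcos w v z by apply: (hg (mdist w v + mdist w z + 1)); rewrite ?wv0 ?wz0//; lra.
lra.
Qed.

(** * The Lang-Schroeder-Sturm inequality *)

Lemma exists_fin_lower_bound (R : realFieldType) (I : finType) (f : I -> R) :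
  (forall i, 0 < f i) -> exists2 m, 0 < m & forall i, m <= f i.
Proof.
move=> f0; exists (\big[Num.min/1]_i f i).
  by apply: lt_bigmin => [|i _]; [exact: ltr01|exact: f0].
by move=> i; exact: bigmin_le.
Qed.

Lemma exists_small (R : realFieldType) (k e : R) : 0 < e ->
  exists2 s, 0 < s & forall t, 0 <= t <= s -> k * t <= e.
Proof.
move=> e0; have k0 : 0 < `|k| + 1 by rewrite ltr_wpDl.
exists (e / (`|k| + 1)); first by rewrite divr_gt0.
move=> t /andP[t0]; rewrite ler_pdivlMr// => h; apply: le_trans h.
by rewrite mulrC ler_wpM2l//; have := ler_norm k; lra.
Qed.

Section LangSchroederSturm.
Variables (R : realType) (M : metricType R) (D : R).
Implicit Types p q x y z u v w : M.

Local Notation "`d( x , y )" := (mdist x y) (at level 0, format "`d( x ,  y )").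

Lemma lipschitz_continuous (f : M -> R) (C : R) :
  (forall x y, f x - f y <= C * `d(x, y)) -> continuous f.
Proof.
move=> fC x; apply/cvgrPdist_lt => e e0.
have C0 : 0 < `|C| + 1 by rewrite ltr_wpDl.
have : nbhs x (ball x (e / (`|C| + 1))) by apply: nbhsx_ballx; rewrite divr_gt0.
apply: filterS => y; rewrite ballEmdist /= ltr_pdivlMr// => xy.
have := fC x y; have := fC y x; rewrite (metric_sym y x) => h1 h2.
have h3 : C * `d(x, y) <= `d(x, y) * (`|C| + 1).
  by rewrite mulrC ler_wpM2l ?mdist_ge0//; have := ler_norm C; lra.
by rewrite ltr_norml; lra.
Qed.

Hypotheses (Mc : compact [set: M]) (Mi : intrinsic M) (Mk : curvature_ge_m1 M).
Hypothesis MD : forall x y, `d(x, y) <= D.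

Lemma ch_mdist_lip x y z : ch `d(x, y) - ch `d(x, z) <= sh D * `d(y, z).
Proof.
have := ch_sub_le `d(x, z) `d(x, y).
have := mdist_norm x y z; have := mdist_ge0 x z; have := MD x y.
have := mdist_ge0 x y; have := mdist_ge0 y z.
move: `d(x, y) `d(x, z) `d(y, z) => a b c c0 a0 aD b0 abc h.
have [ab|ba] := leP a b.
  by have := ch_le a0 ab; have := sh_ge0 (le_trans a0 aD); nra.
apply: le_trans h _; rewrite [sh D * _]mulrC; apply: ler_pM => //.
- by rewrite subr_ge0 ltW.
- exact: sh_ge0.
- by apply: le_trans abc; rewrite ler_norm.
- exact: sh_le.
Qed.

(** The algebra of [variation_toward]: w lies between p and y, and z between w and x i. [straight]
    for z over p, w, y bounds [X] = cosh d(p, z) by means of [Y] = cosh d(y, z), and [straight] for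
    y over w, z, x i bounds [Y] below. Together they bound d(p, z) by the model side with the angle
    supplementary to the one of cosine [k]. *)
Lemma opposite_side (X Y ct st cL sL cs ss cP sP Cj k : R) :
  0 < ss -> 0 < sL -> 0 <= sP ->
  ss * X + sP * Y <= ct * (sP * cs + cP * ss) ->
  (sL * ct - cL * st) * cs + st * Cj <= Y * sL ->
  ss * sL * k = cs * cL - Cj -> X <= cP * ct + sP * st * k.
Proof.
move=> ss0 sL0 sP0 A1 A2 E.
have Y1 : ct * cs - st * ss * k <= Y.
  rewrite -(ler_pM2r sL0); apply: le_trans A2.
  have -> : (ct * cs - st * ss * k) * sL = ct * cs * sL - st * (ss * sL * k) by ring.
  by rewrite E le_eqVlt; apply/orP; left; apply/eqP; ring.
rewrite -(ler_pM2l ss0).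
have := ler_wpM2l sP0 Y1; lra.
Qed.

Section Sums.
Variables (I : finType) (x : I -> M) (l : I -> R).
Hypothesis l0 : forall i, 0 <= l i.

Let F y := \sum_i l i * ch `d(x i, y).

Lemma weighted_lip y z : F y - F z <= (\sum_i l i) * sh D * `d(y, z).
Proof.
rewrite /F -sumrB mulr_suml mulr_suml; apply: ler_sum => i _.
by rewrite -mulrBr -mulrA ler_wpM2l// ch_mdist_lip.
Qed.

Lemma weighted_straight u w v : between u w v ->
  sh `d(w, v) * F u + sh `d(u, w) * F v <= F w * sh `d(u, v).
Proof.
move=> uwv; rewrite /F !mulr_sumr mulr_suml -big_split /=; apply: ler_sum => i _.
have := ler_wpM2l (l0 i) (straight_global (x i) Mc Mi Mk uwv); rewrite /straight.
by lra.
Qed.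

Lemma weighted_ge0 y : 0 <= F y.
Proof. by apply: sumr_ge0 => i _; rewrite mulr_ge0// ltW// ch_gt0. Qed.

(* As B grows, the maximizer y of F - B cosh d(p, -) tends to p. Since F need not
   be differentiable at y, the variations start at points w just before y on a
   geodesic from p. *)
Section Maximizer.
Variables (p y : M) (B : R).
Hypotheses (B0 : 0 <= B)
  (ymax : forall z, F z - B * ch `d(p, z) <= F y - B * ch `d(p, y)).

(** Compares the maximum with the value at the point at distance [t] from w toward x i. The
    alternative w = p serves the case y = p; there sinh d(p, w) = 0 removes the meaningless
    cosine. *)
Lemma variation_toward i w (t : R) : between p w y -> w != y \/ w = p ->
  0 < t -> t <= `d(w, x i) ->
  sh t * (F (x i) - ch `d(w, x i) * F w
          - B * sh `d(p, w) * sh `d(w, x i) * hcos w y (x i)) <=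
  sh `d(w, x i) * ((F y - B * ch `d(p, y)) - ch t * (F w - B * ch `d(p, w))).
Proof.
move=> pwy wyp t0 tL; set L := `d(w, x i) in tL *.
have L0 : 0 < L by lra.
have [|z [wz zx wzx]] := @exists_between _ _ Mc Mi w (x i) t; first by rewrite (ltW t0).
have sL := sh_gt0 L0; have st := sh_gt0 t0.
have sP : 0 <= sh `d(p, w) by rewrite sh_ge0// mdist_ge0.
have shz : sh `d(z, x i) = sh L * ch t - ch L * sh t by rewrite zx shB.
have pz : ch `d(p, z) <= ch `d(p, w) * ch t + sh `d(p, w) * sh t * hcos w y (x i).
  case: wyp => [wy|wp]; last first.
    by rewrite wp -wp wz wp mdistxx ch0 sh0 !mul0r mul1r addr0.
  apply: (@opposite_side _ (ch `d(y, z)) _ _ (ch L) (sh L) (ch `d(w, y)) (sh `d(w, y)) _ _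
    (ch `d(y, x i))) => //.
  - by rewrite sh_gt0// mdist_gt0.
  - have := straight_global z Mc Mi Mk pwy; rewrite /straight -pwy shD.
    by rewrite (metric_sym z p) (metric_sym z y) (metric_sym z w) wz.
  - by have := straight_global y Mc Mi Mk wzx; rewrite /straight shz wz (metric_sym y w).
  - exact: hcosE.
have := weighted_straight wzx; rewrite shz wz -/L => h1.
have h2 := ymax z; have h3 := ler_wpM2l B0 pz.
have h4 : F z <= F y - B * ch `d(p, y) + B * (ch `d(p, w) * ch t + sh `d(p, w) * sh t * hcos w y (x i)).
  by lra.
have := ler_wpM2r (ltW sL) h4; lra.
Qed.

Lemma variation_sum w (t : R) : between p w y -> w != y \/ w = p ->
  0 < t -> (forall i, t <= `d(w, x i)) ->
  sh t * (\sum_i l i * F (x i) - F y ^+ 2 - B * sh `d(p, y) * `d(w, y) * F y) <=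
  F y * ((F y - B * ch `d(p, y)) - (F w - B * ch `d(p, w))
         + (ch t - 1) * (B * ch `d(p, y))).
Proof.
move=> pwy wyp t0 tL.
pose S := \sum_i l i * sh `d(w, x i).
pose K := \sum_i l i * (sh `d(w, x i) * hcos w y (x i)).
have FwE : \sum_i l i * ch `d(w, x i) = F w.
  by apply: eq_bigr => i _; rewrite metric_sym.
have sum_var : sh t * (\sum_i l i * F (x i) - F w ^+ 2 - B * sh `d(p, w) * K) <=
    S * ((F y - B * ch `d(p, y)) - ch t * (F w - B * ch `d(p, w))).
  rewrite expr2 -{1}FwE /S /K !mulr_suml [X in _ - X]mulr_sumr -!sumrB mulr_sumr.
  apply: ler_sum => i _; have := ler_wpM2l (l0 i) (variation_toward pwy wyp t0 (tL i)).
  by rewrite mulrA; congr (_ <= _); ring.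
have Py : `d(p, w) <= `d(p, y) by rewrite -pwy lerDl mdist_ge0.
have chP : ch `d(p, w) <= ch `d(p, y) by rewrite ch_le// mdist_ge0.
have chP0 := ch_gt0 `d(p, y); have shP : sh `d(p, w) <= sh `d(p, y) by exact: sh_le.
have shP0 : 0 <= sh `d(p, w) by rewrite sh_ge0// mdist_ge0.
have Fy0 := weighted_ge0 y; have Fw0 := weighted_ge0 w.
have Fwy : F w <= F y.
  by have := ymax w; have := ler_wpM2l B0 chP; lra.
have SF : S <= F w.
  rewrite -FwE; apply: ler_sum => i _; rewrite ler_wpM2l//.
  by have := ch2_sh2 `d(w, x i); have := ch_gt0 `d(w, x i); nra.
have S0 : 0 <= S by apply: sumr_ge0 => i _; rewrite mulr_ge0// sh_ge0// mdist_ge0.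
(* Since w is no farther from p than y, maximality gives F w <= F y. The identity sinh d(w, y) K =
   cosh d(w, y) F w - F y then makes [K] at most of order d(w, y), so the first-order effect of the
   penalty vanishes as w tends to y. *)
have BK : B * sh `d(p, w) * K <= B * sh `d(p, y) * `d(w, y) * F y.
  case: wyp => [wy|wp]; last first.
    rewrite wp mdistxx sh0 mulr0 mul0r !mulr_ge0//; last exact: mdist_ge0.
    by rewrite sh_ge0// mdist_ge0.
  have sg : 0 < sh `d(w, y) by rewrite sh_gt0// mdist_gt0.
  have KE : sh `d(w, y) * K = ch `d(w, y) * F w - F y.
    rewrite /K -FwE /F !mulr_sumr -sumrB; apply: eq_bigr => i _.
    have := hcosE w y (x i); rewrite (metric_sym (x i) y) => e.
    by transitivity (l i * (sh `d(w, y) * sh `d(w, x i) * hcos w y (x i))); [ring|rewrite e; ring].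
  have Kle : K <= `d(w, y) * F y.
    rewrite -(ler_pM2l sg) KE.
    have h1 := ch_sub_le 0 `d(w, y); rewrite ch0 subr0 in h1.
    have h2 := ler_wpM2r Fy0 h1.
    have h3 : ch `d(w, y) * F w <= ch `d(w, y) * F y by rewrite ler_wpM2l// ltW// ch_gt0.
    by lra.
  have h4 : B * sh `d(p, w) * K <= B * sh `d(p, w) * (`d(w, y) * F y).
    by rewrite ler_wpM2l// mulr_ge0.
  apply: le_trans h4 _; rewrite -[X in _ <= X]mulrA ler_wpM2r//.
    by rewrite mulr_ge0// mdist_ge0.
  by rewrite ler_wpM2l.
have FF : F w ^+ 2 <= F y ^+ 2 by rewrite ler_sqr.
have st := sh_gt0 t0; have ct := ch_ge1 t.
have lhs : sh t * (\sum_i l i * F (x i) - F y ^+ 2 - B * sh `d(p, y) * `d(w, y) * F y) <=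
    sh t * (\sum_i l i * F (x i) - F w ^+ 2 - B * sh `d(p, w) * K).
  by rewrite ler_pM2l// lerB// lerB.
apply: le_trans lhs _; apply: le_trans sum_var _.
have mx := ymax w.
have rhs : (F y - B * ch `d(p, y)) - ch t * (F w - B * ch `d(p, w)) <=
   (F y - B * ch `d(p, y)) - (F w - B * ch `d(p, w)) + (ch t - 1) * (B * ch `d(p, y)).
  have e1 : 0 <= (ch t - 1) * (B * ch `d(p, y) - B * ch `d(p, w) + F w).
    apply: mulr_ge0; first by rewrite subr_ge0.
    by rewrite addr_ge0// subr_ge0 ler_wpM2l.
  by lra.
have rhs0 : 0 <= (F y - B * ch `d(p, y)) - (F w - B * ch `d(p, w)) + (ch t - 1) * (B * ch `d(p, y)).
  apply: addr_ge0; first by rewrite subr_ge0.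
  by rewrite mulr_ge0// ?subr_ge0// mulr_ge0// ltW.
apply: le_trans (ler_wpM2l S0 rhs) _; apply: ler_wpM2r => //.
exact: le_trans Fwy.
Qed.

Lemma maximizer_inequality : (forall i, x i != y) ->
  \sum_i l i * F (x i) <= F y ^+ 2.
Proof.
move=> xy; rewrite -subr_le0 leNgt; apply/negP.
set eta := _ - _ => eta0.
have [m m0 mx] : exists2 m, 0 < m & forall i, m <= `d(y, x i).
  apply: exists_fin_lower_bound => i; by rewrite mdist_gt0 eq_sym.
have Fy0 := weighted_ge0 y.
have chP0 : 0 <= B * ch `d(p, y) by rewrite mulr_ge0// ltW// ch_gt0.
have [t1 t10 ht1] := exists_small (F y * (B * ch `d(p, y))) (divr_gt0 eta0 (ltr0n _ 4)).
pose t := Num.min t1 (m / 2).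
have t0 : 0 < t by rewrite /t lt_min t10 divr_gt0.
have tt1 : t <= t1 by rewrite ge_min lexx.
have tm : t <= m / 2 by rewrite ge_min lexx orbT.
have st := sh_gt0 t0.
pose Lip := (\sum_i l i) * sh D + B * sh D.
(* The step [t] is fixed first; only then is w taken so close to y that its errors are small
   compared with sinh t times [eta]. *)
have ste : 0 < sh t * eta / 4 by rewrite divr_gt0// mulr_gt0.
have [s1 s10 hs1] := exists_small (F y * Lip) ste.
have [s2 s20 hs2] := exists_small (B * sh `d(p, y) * F y) (divr_gt0 eta0 (ltr0n _ 4)).
have conclude w : between p w y -> w != y \/ w = p -> `d(w, y) <= s1 ->
    `d(w, y) <= s2 -> `d(w, y) <= m / 2 -> False.
  move=> pwy wyp ws1 ws2 wm; have d0 := mdist_ge0 w y.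
  have := @variation_sum w t pwy wyp t0.
  have tw i : t <= `d(w, x i).
    by have := metric_triangle y w (x i); have := mx i; rewrite (metric_sym y w); lra.
  move=> /(_ tw).
  have -> : \sum_i l i * F (x i) - F y ^+ 2 - B * sh `d(p, y) * `d(w, y) * F y =
    eta - B * sh `d(p, y) * F y * `d(w, y) by rewrite /eta; ring.
  have e2 := hs2 _ (introT andP (conj d0 ws2)).
  have e1 := hs1 _ (introT andP (conj d0 ws1)).
  have et := ht1 _ (introT andP (conj (ltW t0) tt1)).
  have lip : (F y - B * ch `d(p, y)) - (F w - B * ch `d(p, w)) <= Lip * `d(w, y).
    have := weighted_lip y w; have := ler_wpM2l B0 (ch_mdist_lip p w y).
    by rewrite (metric_sym y w) /Lip; lra.
  have h1 := ch_sub_le 0 t; rewrite ch0 subr0 in h1.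
  have lip' := ler_wpM2l Fy0 lip.
  have h2 := ler_wpM2r chP0 h1; have h3 := ler_wpM2l Fy0 h2.
  have h4 := ler_wpM2l (ltW st) e2; have h5 := ler_wpM2l (ltW st) et.
  clear -ste e1 lip' h3 h4 h5; lra.
have [py|py] := eqVneq p y.
  apply: (conclude y); rewrite ?py ?mdistxx ?(ltW s10) ?(ltW s20) ?ltW ?divr_gt0//.
    by rewrite /between mdistxx addr0.
  by right.
pose s := Num.min (Num.min s1 s2) (Num.min (m / 2) `d(p, y)).
have s0 : 0 < s by rewrite /s !lt_min s10 s20 divr_gt0// mdist_gt0.
have [w [_ wy pwy]] : exists w, [/\ `d(p, w) = `d(p, y) - s,
    `d(w, y) = `d(p, y) - (`d(p, y) - s) & between p w y].
  apply: (exists_between Mc Mi); rewrite lerBlDr lerDl (ltW s0) subr_ge0 andbT.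
  by rewrite /s !ge_min lexx !orbT.
have {}wy : `d(w, y) = s by rewrite wy; ring.
apply: (conclude w) => //; rewrite ?wy /s ?ge_min ?lexx ?orbT//.
by left; rewrite -mdist_gt0 wy.
Qed.

End Maximizer.

(** With mu i = l i sinh d(p, x i), the difference of the two sides is the quadratic form of the
    cosines at p evaluated at mu. The inequality holds at the maximizers y of the penalized function
    and passes to p by the Lipschitz bound on F. *)
Lemma weighted_lss p : (forall i, x i != p) ->
  \sum_i l i * F (x i) <= F p ^+ 2.
Proof.
move=> xp; apply/ler_addgt0Pr => e e0.
have [m m0 mx] : exists2 m, 0 < m & forall i, m <= `d(p, x i).
  by apply: exists_fin_lower_bound => i; rewrite mdist_gt0 eq_sym.
pose Lip := (\sum_i l i) * sh D.
pose G := (\sum_i l i) * ch D.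
have FG z : F z <= G.
  rewrite /F /G mulr_suml; apply: ler_sum => i _; rewrite ler_wpM2l//.
  by rewrite ch_le// mdist_ge0.
have [s s0 hs] := exists_small (2 * G * Lip) e0.
pose r := Num.min s (m / 2).
have r0 : 0 < r by rewrite /r lt_min s0 divr_gt0.
have G0 : 0 <= G by apply: le_trans (weighted_ge0 p) (FG p).
(* As cosh x - 1 >= x^2 / 2, at distance [r] from p the penalty exceeds the upper bound [G] of F, so
   the maximum lies within [r] of p. *)
pose B := (G + 1) / (r ^+ 2 / 2).
have r2 : 0 < r ^+ 2 / 2 by rewrite divr_gt0// exprn_gt0.
have B0 : 0 <= B by rewrite /B divr_ge0// ?ltW//; lra.
have Br : B * (r ^+ 2 / 2) = G + 1 by rewrite /B divfK// gt_eqF.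
have M0 : [set: M] !=set0 by exists p.
have [|y _ ymax] := @compact_EVT_max M R (fun z => F z - B * ch `d(p, z)) setT M0 Mc.
  apply: continuous_subspaceT.
  apply: (@lipschitz_continuous _ (Lip + B * sh D)) => u v.
  have := weighted_lip u v; have := ler_wpM2l B0 (ch_mdist_lip p v u).
  by rewrite (metric_sym v u) /Lip; lra.
have {}ymax z : F z - B * ch `d(p, z) <= F y - B * ch `d(p, y) by apply: ymax; rewrite inE.
have py : `d(p, y) < r.
  rewrite ltNge; apply/negP => h.
  have := ymax p; rewrite mdistxx ch0 mulr1.
  have h1 := ch_sub1_ge `d(p, y).
  have h2 : r ^+ 2 / 2 <= `d(p, y) ^+ 2 / 2.
    by rewrite ler_pM2r ?invr_gt0// ler_sqr ?nnegrE ?mdist_ge0// ltW.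
  have h3 : B * (r ^+ 2 / 2) <= B * (ch `d(p, y) - 1).
    by rewrite ler_wpM2l// (le_trans h2).
  by have := FG y; have := weighted_ge0 p; lra.
have rs : r <= s by rewrite ge_min lexx.
have rm : r <= m / 2 by rewrite ge_min lexx orbT.
have xy i : x i != y.
  apply/eqP => h; have := mx i; rewrite h; lra.
apply: le_trans (maximizer_inequality B0 ymax xy) _.
have FyFp : F y - F p <= Lip * `d(p, y) by rewrite (metric_sym p y); exact: weighted_lip.
have := hs `d(p, y); rewrite mdist_ge0 (le_trans (ltW py) rs) => /(_ isT).
have := FG y; have := FG p; have := weighted_ge0 y; have := weighted_ge0 p.
move: (F y) (F p) FyFp => a b ab b0 a0 bG aG h.
rewrite -lerBlDl subr_sqr.
apply: le_trans h; have -> : 2 * G * Lip * `d(p, y) = (Lip * `d(p, y)) * (2 * G) by ring.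
have Lip0 : 0 <= Lip * `d(p, y).
  rewrite /Lip !mulr_ge0 ?mdist_ge0 ?sumr_ge0//.
  by apply: sh_ge0; apply: le_trans (MD p p); exact: mdist_ge0.
apply: (@le_trans _ _ (Lip * `d(p, y) * (a + b))).
  by rewrite ler_wpM2r// addr_ge0.
by rewrite ler_wpM2l//; lra.
Qed.

End Sums.

Lemma hcos_copositive (I : finType) (x : I -> M) (mu : I -> R) p :
  (forall i, 0 <= mu i) -> (forall i, p != x i) ->
  0 <= \sum_i \sum_j mu i * mu j * hcos p (x i) (x j).
Proof.
move=> mu0 px.
have S0 i : 0 < sh `d(p, x i) by rewrite sh_gt0// mdist_gt0.
pose l i := mu i / sh `d(p, x i).
have l0 i : 0 <= l i by rewrite divr_ge0// ltW.
have lS i : l i * sh `d(p, x i) = mu i by rewrite divfK// gt_eqF.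
have xp i : x i != p by rewrite eq_sym.
have := @weighted_lss I x l l0 p xp; rewrite -subr_ge0 => h.
apply: le_trans h _; rewrite le_eqVlt; apply/orP; left; apply/eqP.
rewrite expr2 mulr_suml -sumrB; apply: eq_bigr => i _.
rewrite !mulr_sumr -sumrB; apply: eq_bigr => j _.
rewrite -!lS (metric_sym (x i) p) (metric_sym (x j) p).
transitivity (l i * l j * (sh `d(p, x i) * sh `d(p, x j) * hcos p (x i) (x j))).
  by rewrite hcosE (metric_sym (x j)); ring.
by ring.
Qed.

End LangSchroederSturm.

(** * Strainers *)

Section Strainers.
Variables (R : realType) (M : metricType R) (D : R).
Implicit Types p q x y z u v w a b : M.

Local Notation "`d( x , y )" := (mdist x y) (at level 0, format "`d( x ,  y )").

Hypotheses (Mc : compact [set: M]) (Mi : intrinsic M) (Mk : curvature_ge_m1 M).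
Hypothesis MD : forall x y, `d(x, y) <= D.

Lemma hcos_mono x p0 p q : between x p0 p -> x != p0 -> x != q ->
  hcos x p0 q <= hcos x p q.
Proof. by move=> xp xp0 xq; apply: hcos_mono1 => //; exact: straight_global. Qed.

Lemma hcos_mono2 x p0 p q0 q : between x p0 p -> between x q0 q ->
  x != p0 -> x != q0 -> hcos x p0 q0 <= hcos x p q.
Proof.
move=> xp xq xp0 xq0; apply: (@le_trans _ _ (hcos x p q0)); first exact: hcos_mono.
rewrite ![hcos x p _]hcosC; apply: hcos_mono => //.
by rewrite -mdist_gt0 -xp ltr_pwDl ?mdist_ge0 ?mdist_gt0.
Qed.

(** By first variation, nearly the cosine at p between the directions of a and q. Unlike cosines,
    slopes are exactly antisymmetric in p, q and average along geodesics. *)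
Definition slope a p q : R := (`d(p, a) - `d(q, a)) / `d(p, q).

Lemma slopeC a p q : slope a q p = - slope a p q.
Proof. by rewrite /slope (metric_sym q p) -mulNr opprB. Qed.

Lemma slope_bound a p q : p != q -> -1 <= slope a p q <= 1.
Proof.
rewrite -mdist_gt0 => pq; have := mdist_norm a p q.
by rewrite (metric_sym a p) (metric_sym a q) -ler_norml /slope normrM normfV
  (gtr0_norm pq) ler_pdivrMr// mul1r.
Qed.

Definition slope_const : R := ch D + D * sh D.

Lemma D_ge0 (x : M) : 0 <= D.
Proof. by apply: le_trans (MD x x); exact: mdist_ge0. Qed.

Lemma slope_const_ge0 (x : M) : 0 <= slope_const.
Proof.
by rewrite addr_ge0 ?(ltW (ch_gt0 _))// mulr_ge0 ?sh_ge0 ?(D_ge0 x).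
Qed.

Lemma hcos_slope p a q : p != q -> `d(p, q) <= `d(p, a) ->
  `|hcos p a q - slope a p q| <= `d(p, q) / `d(p, a) * slope_const.
Proof.
move=> pq pqa; have pq0 : 0 < `d(p, q) by rewrite mdist_gt0.
have := hypcos_quotient pq0 pqa (MD p a) (slope_bound a pq).
rewrite /hcos; set s := slope a p q.
suff -> : `d(p, a) - `d(p, q) * s = `d(a, q) by [].
by rewrite /s /slope mulrC divfK ?gt_eqF// (metric_sym a q); ring.
Qed.

Lemma hcos_copositive3 p a b z (al be ga : R) :
  p != a -> p != b -> p != z -> 0 <= al -> 0 <= be -> 0 <= ga ->
  0 <= al ^+ 2 + be ^+ 2 + ga ^+ 2 + 2 * (al * be * hcos p a b
     + al * ga * hcos p a z + be * ga * hcos p b z).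
Proof.
move=> pa pb pz al0 be0 ga0.
have := @hcos_copositive _ _ _ Mc Mi Mk MD 'I_3 (fun k => nth a [:: a; b; z] k)
  (fun k => nth 0 [:: al; be; ga] k) p.
rewrite !big_ord_recl !big_ord0 /= !hcos_same//.
rewrite (hcosC p b a) (hcosC p z a) (hcosC p z b) => h.
have {}h := h _ _; apply: le_trans (h _ _) _.
- by case=> [[|[|[|]]]] //=.
- by case=> [[|[|[|]]]] //=.
by rewrite le_eqVlt; apply/orP; left; apply/eqP; ring.
Qed.

(** Copositivity with weights 1, 1, e. A defect e^2 in the opposition of a and b costs order e here,
    whence the tolerance [eps ^+ 2] in [strained]. *)
Lemma hcos_near_opposite p a b z (e : R) : 0 < e -> p != a -> p != b -> p != z ->
  hcos p a b <= -1 + e ^+ 2 -> - (2 * e) <= hcos p a z + hcos p b z.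
Proof.
move=> e0 pa pb pz h; rewrite -(ler_pM2l e0).
have := @hcos_copositive3 p a b z 1 1 e pa pb pz ler01 ler01 (ltW e0).
have : 0 <= e ^+ 2 by rewrite exprn_ge0// ltW.
by lra.
Qed.

Definition sg (e : bool) : R := if e then 1 else -1.

(* The directions of A true i and A false i are nearly opposite, and G is nearly
   the Gram matrix of the directions of the points A true i, at every point of
   U.  Only upper bounds on the cosines are needed, since copositivity of the
   cosines provides the lower ones. *)
Definition strained (m : nat) (A : bool -> nat -> M) (G : nat -> nat -> R)
    (eps ell : R) (U : set M) : Prop :=
  forall q, U q ->
    (forall e i, (i < m)%N -> ell <= `d(q, A e i)) /\
    (forall e e' i j, (i < m)%N -> (j < m)%N ->
      hcos q (A e i) (A e' j) <= sg e * sg e' * G i j + eps ^+ 2).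

(** * Slopes of the distances to a strainer *)

Section Slopes.
Variables (m : nat) (A : bool -> nat -> M) (G : nat -> nat -> R).
Variables (eps ell th : R) (U : set M).
Hypotheses (AU : strained m A G eps ell U) (G1 : forall i, G i i = 1).
Hypotheses (eps0 : 0 < eps) (ell0 : 0 < ell) (th0 : 0 < th) (th1 : th <= 1).

Lemma strained_neq q e i : U q -> (i < m)%N -> q != A e i.
Proof. by move=> /AU[h _] im; rewrite -mdist_gt0; apply: lt_le_trans (h e i im). Qed.

Lemma strained_slope q q' e i : U q -> q != q' -> (i < m)%N ->
  `d(q, q') <= th * ell ->
  `|hcos q (A e i) q' - slope (A e i) q q'| <= th * slope_const.
Proof.
move=> Uq qq im qe; have := AU Uq => -[/(_ e i im) le _].
have C0 := slope_const_ge0 q.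
have d0 : 0 < `d(q, A e i) by apply: lt_le_trans le.
have h1 : `d(q, q') <= th * `d(q, A e i) by apply: le_trans qe _; rewrite ler_pM2l.
have h2 : `d(q, q') <= `d(q, A e i) by apply: le_trans h1 _; rewrite ler_piMl// ltW.
apply: le_trans (hcos_slope qq h2) _; rewrite ler_wpM2r//.
by rewrite ler_pdivrMr.
Qed.

Definition slope_error : R := 2 * eps + 3 * (th * slope_const).

(** Copositivity bounds the sum of the cosines toward opposite points only from below. The upper
    bound is the same lower bound at q', looking back at q, since slopes change sign when the pair
    is reversed. *)
Lemma strained_hcos q q' e i : U q -> U q' -> q != q' -> (i < m)%N ->
  `d(q, q') <= th * ell ->
  `|hcos q (A e i) q' - sg e * slope (A true i) q q'| <= slope_error.
Proof.
move=> Uq Uq' qq im qe.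
have opp p z : U p -> p != z -> - (2 * eps) <= hcos p (A true i) z + hcos p (A false i) z.
  move=> Up pz; apply: hcos_near_opposite; rewrite ?strained_neq//.
  have [_ /(_ true false i i im im)] := AU Up.
  by rewrite /= G1; lra.
have h e1 := strained_slope e1 Uq qq im qe.
have qq' : q' != q by rewrite eq_sym.
have h' e1 : `|hcos q' (A e1 i) q - slope (A e1 i) q' q| <= th * slope_const.
  by apply: strained_slope => //; rewrite metric_sym.
have := opp _ _ Uq qq; have := opp _ _ Uq' qq'.
move: (h true) (h false) (h' true) (h' false); rewrite /slope_error !ler_norml.
have C0 : 0 <= th * slope_const by rewrite mulr_ge0 ?(ltW th0)// (slope_const_ge0 q).
rewrite ![slope _ q' q]slopeC; move: C0.
by case: e => /=; lra.
Qed.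

(** * The distance of a direction from the span of a strainer *)

Section Span.
Variables (p y q y' q' : M) (eta c : R) (s : nat -> R).
Hypotheses (Up : U p) (Uy : U y) (Uq : U q) (py : p != y) (pq : p != q).
Hypotheses (dpy : `d(p, y) <= th * ell) (dpq : `d(p, q) <= th * ell).
Hypotheses (pyy : between p y' y) (pqq : between p q' q) (py' : p != y') (pq' : p != q').
Hypothesis eta_slope : forall i, (i < m)%N -> `|slope (A true i) p q| <= eta.
Hypotheses (c0 : 0 < c) (yq : hcos p y' q' <= - c).

Let al i := slope (A true i) p y.
Let S : R := \sum_(i < m) `|s i|.
(** Copositivity admits only nonnegative weights, so the coefficient - s i is carried by [A true i]
    when it is positive and its absolute value by [A false i] when it is negative. *)
Let w (r : bool * 'I_m) : R := Num.max 0 (- (sg r.1 * s r.2)).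

Let w_ge0 r : 0 <= w r.
Proof. by rewrite /w le_max lexx. Qed.

Let w_signed (v : 'I_m -> R) : \sum_r w r * (sg r.1 * v r.2) = - \sum_(i < m) s i * v i.
Proof.
rewrite -(pair_bigA _ (fun e (i : 'I_m) => w (e, i) * (sg e * v i))) /= big_bool /= -big_split -sumrN /=.
apply: eq_bigr => i _; rewrite /w /= !mulN1r opprK !mul1r.
have -> : - (s i * v i) = (Num.max 0 (- s i) - Num.max 0 (s i)) * v i.
  by rewrite -mulNr; congr (_ * _); case: (lerP 0 (- s i)); case: (lerP 0 (s i)); lra.
by rewrite mulrBl mulrN.
Qed.

Let w_sum : \sum_r w r = S.
Proof.
rewrite -(pair_bigA _ (fun e (i : 'I_m) => w (e, i))) /= big_bool /= -big_split /=.
apply: eq_bigr => i _; rewrite /w /= !mulN1r opprK !mul1r.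
by case: (lerP 0 (- s i)); case: (lerP 0 (s i)); case: (ger0P (s i)); lra.
Qed.

Let near_y : \sum_r w r * hcos p y' (A r.1 r.2) <= - \sum_(i < m) s i * al i + slope_error * S.
Proof.
rewrite -w_sum -w_signed mulr_sumr -big_split /=; apply: ler_sum => -[e i] _ /=.
rewrite [slope_error * _]mulrC -mulrDr ler_wpM2l//.
have h := hcos_mono pyy py' (strained_neq e Up (ltn_ord i)).
apply: le_trans h _; rewrite hcosC.
by have := strained_hcos e Up Uy py (ltn_ord i) dpy; rewrite ler_norml /al; lra.
Qed.

Let near_q : \sum_r w r * hcos p q' (A r.1 r.2) <= (eta + slope_error) * S.
Proof.
rewrite -w_sum mulr_sumr; apply: ler_sum => -[e i] _ /=.
rewrite [_ * w _]mulrC ler_wpM2l//.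
have h := hcos_mono pqq pq' (strained_neq e Up (ltn_ord i)).
apply: le_trans h _; rewrite hcosC.
have := strained_hcos e Up Uq pq (ltn_ord i) dpq.
have := eta_slope (ltn_ord i); rewrite !ler_norml.
by case: e => /=; lra.
Qed.

Let gram : \sum_r \sum_r' w r * w r' * hcos p (A r.1 r.2) (A r'.1 r'.2) <=
  \sum_(i < m) \sum_(j < m) s i * s j * G i j + eps ^+ 2 * S ^+ 2.
Proof.
have -> : \sum_(i < m) \sum_(j < m) s i * s j * G i j =
    \sum_r \sum_r' w r * w r' * (sg r.1 * sg r'.1 * G r.2 r'.2).
  transitivity (\sum_r w r * (sg r.1 * \sum_r' w r' * (sg r'.1 * G r.2 r'.2))).
    rewrite (w_signed (fun i => \sum_r' w r' * (sg r'.1 * G i r'.2))) -sumrN.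
    apply: eq_bigr => i _; rewrite (w_signed (fun j => G i j)) mulrN opprK mulr_sumr.
    by apply: eq_bigr => j _; rewrite mulrA.
  apply: eq_bigr => r _; rewrite !mulr_sumr; apply: eq_bigr => r' _; ring.
have -> : eps ^+ 2 * S ^+ 2 = \sum_r \sum_r' w r * w r' * eps ^+ 2.
  rewrite -w_sum mulrC expr2 !mulr_suml; apply: eq_bigr => r _.
  by rewrite mulr_sumr mulr_suml.
rewrite -big_split; apply: ler_sum => r _; rewrite -big_split; apply: ler_sum => r' _ /=.
rewrite -mulrDr ler_wpM2l ?mulr_ge0//.
by have [_] := AU Up; apply.
Qed.

(** The right side stands for the squared distance from the direction of y to the combination of the
    strainer directions with coefficients s. Apply copositivity to y', q' and the strainer points
    with weights 1, c, w: the first two contribute at most 1 + c^2 - 2 c^2 = 1 - c^2, and q' is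
    almost orthogonal to the span. *)
Lemma strained_span :
  c ^+ 2 - 2 * slope_error * S - eps ^+ 2 * S ^+ 2 - 2 * c * (eta + slope_error) * S <=
  1 - 2 * (\sum_(i < m) s i * al i) + \sum_(i < m) \sum_(j < m) s i * s j * G i j.
Proof.
pose x (k : bool + bool * 'I_m) :=
  match k with inl e => if e then y' else q' | inr r => A r.1 r.2 end.
pose mu (k : bool + bool * 'I_m) : R :=
  match k with inl e => if e then 1 else c | inr r => w r end.
have := @hcos_copositive _ _ _ Mc Mi Mk MD _ x mu p.
have mu0 k : 0 <= mu k by case: k => [[]|r] //=; rewrite ltW.
have px k : p != x k by case: k => [[]|[e i]] //=; exact: strained_neq.
move=> /(_ mu0 px); rewrite big_sumType /= !big_bool /= !big_sumType /= !big_bool /=.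
under [X in _ <= _ + X]eq_bigr do rewrite big_sumType /= big_bool /=.
rewrite !big_split /= !hcos_same// (hcosC p q' y').
have -> : \sum_i w i * 1 * hcos p (A i.1 i.2) y' = \sum_r w r * hcos p y' (A r.1 r.2).
  by apply: eq_bigr => r _; rewrite mulr1 hcosC.
have -> : \sum_i w i * c * hcos p (A i.1 i.2) q' = c * \sum_r w r * hcos p q' (A r.1 r.2).
  by rewrite mulr_sumr; apply: eq_bigr => r _; rewrite hcosC; ring.
have -> : \sum_i 1 * w i * hcos p y' (A i.1 i.2) = \sum_r w r * hcos p y' (A r.1 r.2).
  by apply: eq_bigr => r _; rewrite mul1r.
have -> : \sum_i c * w i * hcos p q' (A i.1 i.2) = c * \sum_r w r * hcos p q' (A r.1 r.2).
  by rewrite mulr_sumr; apply: eq_bigr => r _; rewrite mulrA.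
have h1 := near_y; have h2 := ler_wpM2l (ltW c0) near_q; have h3 := gram.
have h4 := ler_wpM2l (ltW c0) yq.
move: h1 h2 h3 h4.
move: (\sum_r w r * hcos p y' _) (\sum_r w r * hcos p q' _) (\sum_r \sum_r' _).
move: (\sum_(i < m) s i * al i) (\sum_i \sum_j _) S slope_error (hcos p y' q') => *.
lra.
Qed.

End Span.

(* Moving on from p through y to y2 on a geodesic, the pair (y2, p) is nearly
   opposite at the points near y. *)
Section NewPair.
Variables (p y y2 q : M) (t ze : R).
Hypotheses (Up : U p) (Uy : U y) (Uy2 : U y2) (Uq : U q).
Hypotheses (t0 : 0 < t) (pyt : `d(p, y) = t) (yy2t : `d(y, y2) = t) (pyy2 : between p y y2).
Hypotheses (t2 : 2 * t <= th * ell) (ze0 : 0 <= ze) (ze1 : ze <= 1 / 2).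
Hypothesis (qy : `d(q, y) <= ze * t).

Let zet : ze * t <= t / 2.
Proof. by have := ler_wpM2r (ltW t0) ze1; lra. Qed.

Lemma new_pair_far : t / 2 <= `d(q, y2) /\ t / 2 <= `d(q, p).
Proof.
have := metric_triangle y q y2; have := metric_triangle y q p.
by rewrite (metric_sym y q) (metric_sym y p) pyt yy2t; move: zet qy; lra.
Qed.

(** With u, v the distances from q to y2 and p, 1 + cosine equals (cosh (u + v) - cosh 2t) / (sinh u
    sinh v). The excess u + v - 2t is at most 2 ze t, while u and v are at least t / 2. *)
Lemma new_pair_opposite : hcos q y2 p <= -1 + 8 * ze * ch (2 * D).
Proof.
have [uf vf] := new_pair_far.
have u_le : `d(q, y2) <= t + ze * t by have := metric_triangle q y y2; rewrite yy2t; move: qy; lra.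
have v_le : `d(q, p) <= t + ze * t.
  by have := metric_triangle q y p; rewrite (metric_sym y p) pyt; move: qy; lra.
have t_gt0 := t0; have ze_ge0 := ze0; have ze_le := zet.
have cE : `d(y2, p) = 2 * t by rewrite metric_sym -pyy2 pyt yy2t; ring.
have E := hcosE q y2 p; rewrite cE in E.
have uD := MD q y2; have vD := MD q p.
move: `d(q, y2) `d(q, p) (hcos q y2 p) uf vf u_le v_le E uD vD => u v k uf vf u_le v_le E uD vD.
have u0 : 0 < u by lra.
have v0 : 0 < v by lra.
have su := sh_gt0 u0; have sv := sh_gt0 v0.
have suv : 0 < sh u * sh v by rewrite mulr_gt0.
have E' : sh u * sh v * (1 + k) = ch (u + v) - ch (2 * t) by rewrite chD; lra.
have s0 : 0 <= sh (u + v) by apply: sh_ge0; lra.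
have h1 : ch (u + v) - ch (2 * t) <= 2 * (ze * t) * ((u + v) * ch (2 * D)).
  apply: le_trans (ch_sub_le _ _) _; apply: (@le_trans _ _ (2 * (ze * t) * sh (u + v))).
    by rewrite ler_wpM2r//; lra.
  rewrite ler_wpM2l ?mulr_ge0 ?(ltW t0)//.
  apply: le_trans (sh_le_mul _) _; first by lra.
  by rewrite ler_wpM2l ?ch_le//; lra.
have h2 : 2 * (ze * t) * ((u + v) * ch (2 * D)) <= u * v * (8 * ze * ch (2 * D)).
  have h3 : t * (u + v) <= 4 * (u * v) by nra.
  have h4 : 0 <= 2 * ze * ch (2 * D) by rewrite !mulr_ge0// ltW// ch_gt0.
  by have := ler_wpM2l h4 h3; lra.
have h3 : u * v * (8 * ze * ch (2 * D)) <= sh u * sh v * (8 * ze * ch (2 * D)).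
  rewrite ler_wpM2r//; first by rewrite !mulr_ge0// ltW// ch_gt0.
  by apply: ler_pM; rewrite ?(ltW u0) ?(ltW v0) ?sh_ge ?(ltW u0) ?(ltW v0).
have : sh u * sh v * (1 + k) <= sh u * sh v * (8 * ze * ch (2 * D)).
  by rewrite E'; apply: le_trans h1 _; apply: le_trans h2 h3.
by rewrite ler_pM2l//; lra.
Qed.

Let slope_move a b : `d(y, b) = t -> t / 2 <= `d(q, b) ->
  `|slope a q b - slope a y b| <= 2 * ze.
Proof.
move=> yb qb; have qb0 : 0 < `d(q, b) by move: t0; lra.
have qy1 := qy; have t_gt0 := t0.
have qb1 : q != b by rewrite -mdist_gt0.
have := slope_bound a qb1; set D1 := slope a q b.
have e1 : `d(q, b) * D1 = `d(q, a) - `d(b, a) by rewrite /D1 /slope mulrC divfK// gt_eqF.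
have e2 : t * slope a y b = `d(y, a) - `d(b, a) by rewrite -yb /slope yb mulrC divfK// gt_eqF.
have h1 := mdist_norm a q y; have h2 := mdist_norm b q y.
rewrite (metric_sym b q) (metric_sym b y) yb in h2.
rewrite (metric_sym a q) (metric_sym a y) in h1.
move: h1 h2; rewrite !ler_norml => h1 h2 h3.
set D2 := slope a y b in e2 *.
have h4 : t * (D1 - D2) = (t - `d(q, b)) * D1 + (`d(q, a) - `d(y, a)) by lra.
have h5 : `|t * (D1 - D2)| <= t * (2 * ze).
  rewrite h4; apply: le_trans (ler_normD _ _) _.
  have i1 : `|(t - `d(q, b)) * D1| <= ze * t * 1.
    by rewrite normrM ler_pM// ler_norml; lra.
  have i2 : `|(`d(q, a) - `d(y, a))| <= ze * t by rewrite ler_norml; lra.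
  by lra.
by move: h5; rewrite normrM (gtr0_norm t0) (ler_pM2l t0) ler_norml.
Qed.

Let ypt : `d(y, p) = t.
Proof. by rewrite metric_sym. Qed.

Let tell : t <= th * ell.
Proof. by move: t2 t0; lra. Qed.

Let py_neq : p != y.
Proof. by rewrite -mdist_gt0 pyt. Qed.

Lemma new_pair_back e i : (i < m)%N ->
  hcos q (A e i) p <= - (sg e * slope (A true i) p y) + (slope_error + 2 * ze).
Proof.
move=> im; have [_ vf] := new_pair_far.
have qp : q != p by rewrite -mdist_gt0; move: vf t0; lra.
have qpt : `d(q, p) <= th * ell.
  by have := metric_triangle q y p; rewrite ypt; move: zet qy t2 t0; lra.
have := strained_hcos e Uq Up qp im qpt.
have := slope_move (A true i) ypt vf.
rewrite (slopeC _ y p) !ler_norml.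
by case: e => /=; lra.
Qed.

(** Monotonicity of the cosine from y to y2 holds for [A true i] and [A false i], whose slopes are
    opposite, so the slopes from p to y and to y2 agree up to 2 [slope_error]. The latter is the
    mean of the slopes over the two halves, which leaves 4 [slope_error] for the second half;
    converting a slope into a cosine adds one more. *)
Lemma new_pair_forth e i : (i < m)%N ->
  hcos q (A e i) y2 <= sg e * slope (A true i) p y + (5 * slope_error + 2 * ze).
Proof.
move=> im; have [uf _] := new_pair_far.
have qy2 : q != y2 by rewrite -mdist_gt0; move: uf t0; lra.
have qyt : `d(q, y2) <= th * ell.
  by have := metric_triangle q y y2; rewrite yy2t; move: zet qy t2 t0; lra.
have py2t : `d(p, y2) = 2 * t by rewrite -pyy2 pyt yy2t; ring.
have py2 : p != y2 by rewrite -mdist_gt0 py2t mulr_gt0.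
have mono e1 : hcos p (A e1 i) y <= hcos p (A e1 i) y2.
  by rewrite ![hcos p (A e1 i) _]hcosC; apply: hcos_mono => //; exact: strained_neq.
have pyt' : `d(p, y) <= th * ell by rewrite pyt.
have py2t' : `d(p, y2) <= th * ell by rewrite py2t.
have s1 e1 := strained_hcos e1 Up Uy py_neq im pyt'.
have s2 e1 := strained_hcos e1 Up Uy2 py2 im py2t'.
have s3 := strained_hcos e Uq Uy2 qy2 im qyt.
have s4 := slope_move (A true i) yy2t uf.
have add : slope (A true i) p y2 = (slope (A true i) p y + slope (A true i) y y2) / 2.
  have tn0 : t != 0 by rewrite gt_eqF.
  rewrite /slope py2t pyt yy2t.
  by field.
move: (mono true) (mono false) (s1 true) (s1 false) (s2 true) (s2 false) s3 s4.
by rewrite add !ler_norml; case: e => /=; lra.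
Qed.

End NewPair.
End Slopes.
End Strainers.

(** * Extending strainers *)

(** [tau] bounds the squared distance of the new unit vector from the old span. If its coefficient
    is at least kap / 4 times the l1 norm of the others, scale that bound ([k1]); otherwise the old
    form absorbs the mixed term ([k2]). *)
Lemma gram_extend (R : realFieldType) (kap tau : R) : 0 < kap -> 0 < tau ->
  exists2 kap', 0 < kap' & forall (m : nat) (G : nat -> nat -> R) (al : nat -> R),
    (forall i, (i < m)%N -> `|al i| <= 1) ->
    (forall s : nat -> R, kap * (\sum_(i < m) `|s i|) ^+ 2 <=
      \sum_(i < m) \sum_(j < m) s i * s j * G i j) ->
    (forall s : nat -> R, tau <= 1 - 2 * (\sum_(i < m) s i * al i) +
      \sum_(i < m) \sum_(j < m) s i * s j * G i j) ->
    forall (s : nat -> R) (sg : R), kap' * (\sum_(i < m) `|s i| + `|sg|) ^+ 2 <=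
      \sum_(i < m) \sum_(j < m) s i * s j * G i j + 2 * sg * (\sum_(i < m) s i * al i) + sg ^+ 2.
Proof.
move=> kap0 tau0.
pose k1 := tau / (1 + 4 / kap) ^+ 2; pose k2 := kap / 2 / (1 + kap / 4) ^+ 2.
have d1 : 0 < 1 + 4 / kap by rewrite addr_gt0// divr_gt0.
have d2 : 0 < 1 + kap / 4 by rewrite addr_gt0// divr_gt0.
have k10 : 0 < k1 by rewrite divr_gt0// exprn_gt0.
have k20 : 0 < k2 by rewrite !divr_gt0// exprn_gt0.
have k1E : k1 * (1 + 4 / kap) ^+ 2 = tau by rewrite /k1 divfK// gt_eqF// exprn_gt0.
have k2E : k2 * (1 + kap / 4) ^+ 2 = kap / 2 by rewrite /k2 divfK// gt_eqF// exprn_gt0.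
exists (Num.min k1 k2); first by rewrite lt_min k10.
move=> m G al al1 Gpos Gtau s sig.
have S0 : 0 <= \sum_(i < m) `|s i| by apply: sumr_ge0.
have sal : `|\sum_(i < m) s i * al i| <= \sum_(i < m) `|s i|.
  apply: le_trans (ler_norm_sum _ _ _) _; apply: ler_sum => i _.
  by rewrite normrM ler_piMr// al1.
have Gs := Gpos s.
have [h|h] := leP (kap / 4 * \sum_(i < m) `|s i|) `|sig|.
  apply: (@le_trans _ _ (tau * sig ^+ 2)).
    have h1 : \sum_(i < m) `|s i| + `|sig| <= (1 + 4 / kap) * `|sig|.
      have -> : (1 + 4 / kap) * `|sig| = `|sig| + 4 / kap * `|sig| by ring.
      rewrite addrC lerD2l -(ler_pM2l (divr_gt0 kap0 (ltr0n _ 4))).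
      apply: le_trans h _; have kn : kap != 0 by rewrite gt_eqF.
      by have -> : kap / 4 * (4 / kap * `|sig|) = `|sig| by field.
    have h2 : (\sum_(i < m) `|s i| + `|sig|) ^+ 2 <= ((1 + 4 / kap) * `|sig|) ^+ 2.
      by rewrite ler_sqr// nnegrE ?addr_ge0// mulr_ge0// ltW.
    apply: (@le_trans _ _ (k1 * ((1 + 4 / kap) * `|sig|) ^+ 2)).
      by apply: ler_pM => //; rewrite ?exprn_ge0 ?addr_ge0// ?le_min ?(ltW k10) ?(ltW k20) ?ge_min ?lexx.
    by rewrite exprMn mulrA k1E real_normK// num_real.
  have [->|sig0] := eqVneq sig 0.
    rewrite expr0n /= !mulr0 mul0r !addr0; apply: le_trans Gs.
    by rewrite mulr_ge0 ?exprn_ge0// ltW.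
  have := Gtau (fun i => - (s i / sig)).
  have -> : \sum_(i < m) - (s i / sig) * al i = - (\sum_(i < m) s i * al i) / sig.
    by rewrite -sumrN mulr_suml; apply: eq_bigr => i _; field.
  have -> : \sum_(i < m) \sum_(j < m) - (s i / sig) * - (s j / sig) * G i j =
     (\sum_(i < m) \sum_(j < m) s i * s j * G i j) / sig ^+ 2.
    rewrite mulr_suml; apply: eq_bigr => i _; rewrite mulr_suml.
    by apply: eq_bigr => j _; field.
  have sig2 : 0 < sig ^+ 2 by rewrite exprn_even_gt0.
  rewrite -(ler_pM2r sig2) => h'; apply: le_trans h' _.
  rewrite le_eqVlt; apply/orP; left; apply/eqP.
  by move: (\sum_(i < m) s i * al i) (\sum_(i < m) _) => a b; field.
set S := \sum_(i < m) `|s i| in S0 h sal Gs *.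
have h1 : - (2 * `|sig| * S) <= 2 * sig * \sum_(i < m) s i * al i.
  have : `|2 * sig * \sum_(i < m) s i * al i| <= 2 * `|sig| * S.
    by rewrite !normrM normr_nat ler_wpM2l// mulr_ge0.
  by rewrite ler_norml => /andP[].
have h2 : 2 * `|sig| * S <= kap / 2 * S ^+ 2.
  have : `|sig| * S <= kap / 4 * S * S by rewrite ler_wpM2r// ltW.
  by lra.
apply: (@le_trans _ _ (kap / 2 * S ^+ 2)); last first.
  by have := sqr_ge0 sig; lra.
have h3 : (S + `|sig|) ^+ 2 <= ((1 + kap / 4) * S) ^+ 2.
  rewrite ler_sqr ?nnegrE ?addr_ge0//; first by lra.
  by rewrite mulr_ge0// ltW.
apply: (@le_trans _ _ (k2 * ((1 + kap / 4) * S) ^+ 2)).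
  by apply: ler_pM => //; rewrite ?exprn_ge0 ?addr_ge0// ?le_min ?(ltW k10) ?(ltW k20) ?ge_min ?lexx ?orbT.
by rewrite exprMn mulrA k2E.
Qed.

Section InductionStep.
Variables (R : realType) (D c : R).
Hypotheses (c0 : 0 < c) (c1 : c <= 1).

(** An obtuse angle at p, expressed by comparison cosines at arbitrarily small scales instead of a
    limit. *)
Definition far_obtuse (M : metricType R) (ell : R) (p q : M) := exists x (h g : R -> M),
  [/\ ell <= mdist p x, min_geodesic p x h, min_geodesic p q g &
    forall eta, 0 < eta -> exists2 s, 0 < s < eta & hcos p (h s) (g s) <= - c].

(* [os_vertical] is how the Hausdorff dimension n enters. *)
Record obtuse_space (n : nat) (M : metricType R) (d0 : R) : Prop := ObtuseSpace {
  os_compact : compact [set: M];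
  os_intrinsic : intrinsic M;
  os_curvature : curvature_ge_m1 M;
  os_diam : forall x y : M, mdist x y <= D;
  os_pos : 0 < d0;
  os_point : exists p : M, True;
  os_vertical : forall m (f : nat -> M) p (rho eta del : R), (m < n)%N ->
    0 < rho -> 0 < eta -> 0 < del -> exists p' q',
      [/\ mdist p p' < rho, mdist p q' < rho, p' != q', mdist p' q' < del &
        forall i, (i < m)%N -> `|mdist p' (f i) - mdist q' (f i)| <= eta * mdist p' q'];
  os_obtuse : exists2 del : R, 0 < del & forall p q : M, p != q -> mdist p q < del ->
    far_obtuse (d0 / 4) p q \/ far_obtuse (d0 / 4) q p }.

Definition strainer (M : metricType R) (d0 : R) (m : nat) (kap eps lam : R) :=
  exists (p : M) (A : bool -> nat -> M) (G : nat -> nat -> R),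
  [/\ forall i, G i i = 1,
      forall s : nat -> R, kap * (\sum_(i < m) `|s i|) ^+ 2 <=
        \sum_(i < m) \sum_(j < m) s i * s j * G i j &
      strained m A G eps (lam * d0) [set q | mdist p q < lam * d0]].

(** * One more pair at a definite scale *)

Section StrainerExtend.
Variables (M : metricType R) (d0 : R) (n m : nat) (A : bool -> nat -> M).
Variables (G : nat -> nat -> R) (kap kap' eps th b ze eps' ell rho t : R) (p q p0 : M).
Hypotheses (os : obtuse_space n M d0) (G1 : forall i, G i i = 1).
Hypothesis Gpos : forall s : nat -> R, kap * (\sum_(i < m) `|s i|) ^+ 2 <=
  \sum_(i < m) \sum_(j < m) s i * s j * G i j.
Hypothesis AU : strained m A G eps ell [set q | mdist p0 q < rho].
Hypotheses (kap0 : 0 < kap) (eps0 : 0 < eps) (ell0 : 0 < ell) (th0 : 0 < th) (th1 : th <= 1).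
(** [b] bounds all errors of the given strainer. [bS] keeps the total error of [strained_span] below
    c^2 / 2 for coefficients of l1 norm at most 2 / kap; [bE] and [zeE] fit the errors of the new
    pair into [eps' ^+ 2]. *)
Hypotheses (b0 : 0 < b) (b1 : b <= 1) (Eb : slope_error D eps th <= b) (epsb : eps <= b).
Hypothesis bS : b * (2 * (2 / kap) + (2 / kap) ^+ 2 + 4 * c * (2 / kap)) <= c ^+ 2 / 2.
Hypotheses (bE : 10 * b <= eps' ^+ 2) (ze0 : 0 < ze) (ze1 : ze <= 1 / 2).
Hypothesis zeE : 16 * ze * ch (2 * D) <= eps' ^+ 2.
Hypothesis gram : forall (m : nat) (G : nat -> nat -> R) (al : nat -> R),
  (forall i, (i < m)%N -> `|al i| <= 1) ->
  (forall s : nat -> R, kap * (\sum_(i < m) `|s i|) ^+ 2 <=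
    \sum_(i < m) \sum_(j < m) s i * s j * G i j) ->
  (forall s : nat -> R, c ^+ 2 / 2 <= 1 - 2 * (\sum_(i < m) s i * al i) +
    \sum_(i < m) \sum_(j < m) s i * s j * G i j) ->
  forall (s : nat -> R) (sg : R), kap' * (\sum_(i < m) `|s i| + `|sg|) ^+ 2 <=
    \sum_(i < m) \sum_(j < m) s i * s j * G i j + 2 * sg * (\sum_(i < m) s i * al i) + sg ^+ 2.
Hypotheses (p0p : mdist p0 p < rho / 2) (p0q : mdist p0 q < rho / 2) (pq : p != q).
Hypotheses (pqth : mdist p q <= th * ell).
Hypothesis etab : forall i, (i < m)%N -> `|slope (A true i) p q| <= b.
Hypotheses (t0 : 0 < t) (td : 2 * t <= d0 / 4) (tth : 2 * t <= th * ell).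
Hypotheses (trho : 2 * t < rho / 2) (tell : t <= ell).

Variables (x : M) (h g : R -> M).
Hypotheses (px : d0 / 4 <= mdist p x) (hgeo : min_geodesic p x h) (ggeo : min_geodesic p q g).
Hypothesis obt : forall eta, 0 < eta -> exists2 s, 0 < s < eta & hcos p (h s) (g s) <= - c.

Let Mc := os_compact os.
Let Mi := os_intrinsic os.
Let Mk := os_curvature os.
Let MD := os_diam os.

Let y := h t.
Let y2 := h (2 * t).

Let hd s u : 0 <= s -> s <= u -> u <= 2 * t -> mdist (h s) (h u) = u - s.
Proof.
case: hgeo => _ _ hh s_ge0 su ut.
have u0 := le_trans s_ge0 su; have ux : u <= mdist p x.
  by apply: le_trans ut (le_trans td px).
rewrite hh ?s_ge0 ?u0 ?ux ?(le_trans su ux)//.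
by rewrite distrC ger0_norm// subr_ge0.
Qed.

Let h0 : h 0 = p.
Proof. by case: hgeo. Qed.

Let t_ge0 : 0 <= t.
Proof. exact: ltW. Qed.

Let t2_ge : t <= 2 * t.
Proof. by move: t0; lra. Qed.

Let py : mdist p y = t.
Proof. by rewrite -h0 hd// subr0. Qed.

Let yy2 : mdist y y2 = t.
Proof. by rewrite hd//; ring. Qed.

Let pyy2 : between p y y2.
Proof.
rewrite /between py yy2 -h0 hd//; first by ring.
by rewrite mulr_ge0.
Qed.

Let py_neq : p != y.
Proof. by rewrite -mdist_gt0 py. Qed.

Let U := [set q | mdist p0 q < rho].

Let rho0 : 0 < rho.
Proof. by move: t0 trho; lra. Qed.

Let Up : U p.
Proof. by move: p0p rho0; rewrite /U /=; lra. Qed.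

Let Uq : U q.
Proof. by move: p0q rho0; rewrite /U /=; lra. Qed.

Let Uy : U y.
Proof. by move: p0p trho t0 (metric_triangle p0 p y); rewrite py /U /=; lra. Qed.

Let Uy2 : U y2.
Proof. by move: p0p trho t0 (metric_triangle p0 p y2); rewrite -pyy2 py yy2 /U /=; lra. Qed.

Let pyth : mdist p y <= th * ell.
Proof. by rewrite py; move: t0 tth; lra. Qed.

Let al i := slope (A true i) p y.

Let al1 i : (i < m)%N -> `|al i| <= 1.
Proof. by move=> _; rewrite ler_norml; exact: slope_bound. Qed.

Let pq0 : 0 < mdist p q.
Proof. by rewrite mdist_gt0. Qed.

(** The error of [strained_span] grows with the coefficients. Beyond l1 norm 2 / kap the Gram form
    alone outweighs the linear term. *)
Let span_far (s : nat -> R) : 2 / kap < \sum_(i < m) `|s i| ->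
  c ^+ 2 / 2 <= 1 - 2 * (\sum_(i < m) s i * al i) +
      \sum_(i < m) \sum_(j < m) s i * s j * G i j.
Proof.
set S := \sum_(i < m) `|s i| => Sk.
have k2 : kap * (2 / kap) = 2 by rewrite mulrC divfK// gt_eqF.
have S0 : 0 <= S by apply: sumr_ge0.
have sal : \sum_(i < m) s i * al i <= S.
  apply: le_trans (ler_norm _) _; apply: le_trans (ler_norm_sum _ _ _) _.
  by apply: ler_sum => i _; rewrite normrM ler_piMr// al1.
have h1 : 2 * S <= kap * S ^+ 2.
  rewrite expr2 mulrA ler_wpM2r// -k2 ler_pM2l//; exact: ltW.
have h2 : c ^+ 2 <= 1 by rewrite expr_le1// ltW.
by have := Gpos s; rewrite -/S; lra.
Qed.

Let span_near (s : nat -> R) : \sum_(i < m) `|s i| <= 2 / kap ->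
  c ^+ 2 / 2 <= 1 - 2 * (\sum_(i < m) s i * al i) +
      \sum_(i < m) \sum_(j < m) s i * s j * G i j.
Proof.
set S := \sum_(i < m) `|s i| => Sk.
have S0 : 0 <= S by apply: sumr_ge0.
have tq : 0 < Num.min t (mdist p q) by rewrite lt_min t0.
have [s0 /andP[s00 s0lt] obs] := obt tq.
move: s0lt; rewrite lt_min => /andP[/ltW s0t /ltW s0q].
have s0_ge0 := ltW s00.
have py' : mdist p (h s0) = s0 by rewrite -[p]h0 hd ?subr0// (le_trans s0t).
have [g0 gq gg] := ggeo.
have pq' : mdist p (g s0) = s0.
  rewrite -[p in LHS]g0 gg ?lexx ?mdist_ge0 ?s0_ge0//.
  by rewrite sub0r normrN gtr0_norm.
have q'q : mdist (g s0) q = mdist p q - s0.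
  rewrite -[q in LHS]gq gg ?lexx ?mdist_ge0 ?s0_ge0//.
  by rewrite distrC ger0_norm// subr_ge0.
have y'y : mdist (h s0) y = t - s0 by rewrite hd.
have b1' : between p (h s0) y by rewrite /between py' y'y py; ring.
have b2' : between p (g s0) q by rewrite /between pq' q'q; ring.
have n1 : p != h s0 by rewrite -mdist_gt0 py'.
have n2 : p != g s0 by rewrite -mdist_gt0 pq'.
have := @strained_span R M D Mc Mi Mk MD m A G eps ell th U AU G1 eps0 ell0 th0 th1
  p y q (h s0) (g s0) b c s Up Uy Uq py_neq pq pyth pqth b1' b2' n1 n2 etab c0 obs.
rewrite -/S; apply: le_trans.
have E0 : 0 <= slope_error D eps th.
  rewrite /slope_error addr_ge0// !mulr_ge0 ?(ltW eps0) ?(ltW th0)//.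
  exact: (slope_const_ge0 MD p).
move: (slope_error _ _ _) E0 Eb => E E0 Eb'.
have i1 : E * S <= b * (2 / kap) by apply: ler_pM.
have i2 : eps ^+ 2 * S ^+ 2 <= b * (2 / kap) ^+ 2.
  apply: ler_pM; rewrite ?sqr_ge0//; last first.
    by rewrite ler_sqr// nnegrE divr_ge0// ltW.
  apply: (@le_trans _ _ (b ^+ 2)); first by rewrite ler_sqr// nnegrE ltW.
  by rewrite expr2 ler_piMl// ltW.
have i3 : c * ((b + E) * S) <= c * (2 * b * (2 / kap)).
  rewrite ler_wpM2l ?(ltW c0)//; apply: ler_pM => //; first by rewrite addr_ge0// ltW.
  by rewrite mulr_natl mulr2n lerD2l.
by move: bS i1 i2 i3; move: (2 / kap) => u; lra.
Qed.

Let A' e i := if i == m then (if e then y2 else p) else A e i.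
Let G' i j := if i == m then (if j == m then 1 else al j) else if j == m then al i else G i j.

Let G'_form (s : nat -> R) : \sum_(i < m.+1) \sum_(j < m.+1) s i * s j * G' i j =
  \sum_(i < m) \sum_(j < m) s i * s j * G i j + 2 * s m * (\sum_(i < m) s i * al i) + s m ^+ 2.
Proof.
have nm (i : 'I_m) : (i == m :> nat) = false by rewrite ltn_eqF.
rewrite big_ord_recr /=.
have -> : \sum_(i < m) \sum_(j < m.+1) s i * s j * G' i j =
    \sum_(i < m) \sum_(j < m) s i * s j * G i j + s m * \sum_(i < m) s i * al i.
  rewrite mulr_sumr -big_split /=; apply: eq_bigr => i _; rewrite big_ord_recr /=.
  congr (_ + _); last by rewrite /G' nm eqxx; ring.
  by apply: eq_bigr => j _; rewrite /G' !nm.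
have -> : \sum_(j < m.+1) s m * s j * G' m j = s m * \sum_(i < m) s i * al i + s m ^+ 2.
  rewrite big_ord_recr /= /G' !eqxx mulr1; congr (_ + _).
  by rewrite mulr_sumr; apply: eq_bigr => i _; rewrite nm mulrA.
by ring.
Qed.

Let eps_le : eps ^+ 2 <= eps' ^+ 2.
Proof.
have h1 : eps ^+ 2 <= b ^+ 2 by rewrite ler_sqr// nnegrE ltW.
have h2 : b ^+ 2 <= b by rewrite expr2 ler_piMl// ltW.
by move: bE b0; lra.
Qed.

Let ze_le : 16 * ze <= eps' ^+ 2.
Proof.
by apply: le_trans zeE; rewrite ler_peMr ?ch_ge1// mulr_ge0// ltW.
Qed.

Let zet : ze * t <= t / 2.
Proof. by have := ler_wpM2r (ltW t0) ze1; lra. Qed.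

Let A'_strained : strained m.+1 A' G' eps' (ze * t) [set q | mdist y q < ze * t].
Proof.
move=> z /= yz; have zy : mdist z y <= ze * t by rewrite metric_sym ltW.
have Uz : U z.
  move: p0p trho yz t0 zet (metric_triangle p0 p y) (metric_triangle p0 y z).
  by rewrite py /U /=; lra.
have [far1 far2] := new_pair_far t0 py yy2 ze1 zy.
split=> [e i|e e' i j].
  rewrite /A' ltnS leq_eqVlt; case: eqP => [_ _|_ /= im].
    by case: e; apply: le_trans zet _.
  have [hz _] := AU Uz; apply: le_trans (hz e i im).
  by apply: le_trans zet _; apply: le_trans tell; move: t0; lra.
have back := @new_pair_back R M D Mc Mi Mk MD m A G eps ell th U AU G1 eps0 ell0 th0 th1
  p y y2 z t ze Up Uz t0 py yy2 tth ze1 zy.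
have forth := @new_pair_forth R M D Mc Mi Mk MD m A G eps ell th U AU G1 eps0 ell0 th0 th1
  p y y2 z t ze Up Uy Uy2 Uz t0 py yy2 pyy2 tth ze1 zy.
have cross e1 e2' k : (k < m)%N ->
    hcos z (A e1 k) (if e2' then y2 else p) <= sg R e1 * sg R e2' * al k + eps' ^+ 2.
  move=> km; case: e2'.
    apply: le_trans (forth e1 k km) _; rewrite mulr1 lerD2l.
    by move: Eb bE ze_le ze0 b0; lra.
  apply: le_trans (back e1 k km) _; rewrite mulrN1 mulNr lerD2l.
  by move: Eb bE ze_le ze0 b0; lra.
have opp : hcos z y2 p <= -1 + eps' ^+ 2.
  apply: le_trans (@new_pair_opposite R M D MD p y y2 z t ze t0 py yy2 pyy2 (ltW ze0) ze1 zy) _.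
  by rewrite lerD2l; move: zeE (sqr_ge0 eps'); lra.
have same a : t / 2 <= mdist z a -> hcos z a a <= 1 + eps' ^+ 2.
  move=> za; rewrite hcos_same ?lerDl ?sqr_ge0// -mdist_gt0.
  by apply: lt_le_trans za; rewrite divr_gt0.
rewrite /A' /G' !ltnS (leq_eqVlt i) (leq_eqVlt j).
case: (eqVneq i m) => [_ _|_ /= im]; case: (eqVneq j m) => [_ _|_ /= jm].
+ case: e; case: e' => /=; rewrite ?mulr1 ?mulrN1 ?mulN1r ?opprK; [exact: same|exact: opp| |exact: same].
  by rewrite hcosC.
+ by rewrite hcosC [sg R e * _]mulrC; exact: cross.
+ exact: cross.
+ by have [_ hz] := AU Uz; apply: le_trans (hz e e' i j im jm) _; rewrite lerD2l.
Qed.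

Lemma strainer_extend_at : exists (y : M) (A' : bool -> nat -> M) (G' : nat -> nat -> R),
  [/\ forall i, G' i i = 1,
      forall s : nat -> R, kap' * (\sum_(i < m.+1) `|s i|) ^+ 2 <=
        \sum_(i < m.+1) \sum_(j < m.+1) s i * s j * G' i j &
      strained m.+1 A' G' eps' (ze * t) [set q | mdist y q < ze * t]].
Proof.
exists y, A', G'; split=> //; first by move=> i; rewrite /G'; case: eqP.
move=> s; rewrite big_ord_recr G'_form; apply: (gram al1 Gpos) => s'.
by have [/span_near|/span_far] := leP (\sum_(i < m) `|s' i|) (2 / kap).
Qed.

End StrainerExtend.

(** [kap] precedes [eps] because the step to m + 1 calls the hypothesis with an [eps] chosen small
    in terms of its [kap]; [lam] precedes M because the volume bound must be uniform. *)
Lemma exists_strainer n m : (m <= n)%N -> exists2 kap : R, 0 < kap &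
  forall eps, 0 < eps -> exists2 lam : R, 0 < lam & forall M d0,
    obtuse_space n M d0 -> strainer M d0 m kap eps lam.
Proof.
elim: m => [_|m IH mn].
  exists 1 => // eps eps0; exists 1 => // M d0 os.
  have [p _] := os_point os.
  exists p, (fun _ _ => p), (fun _ _ => 1); split=> //.
  by move=> s; rewrite !big_ord0 expr0n mulr0.
have [kap kap0 {}IH] := IH (ltnW mn).
have c20 : 0 < c ^+ 2 / 2 by rewrite divr_gt0// exprn_gt0.
have [kap' kap'0 gram] := gram_extend kap0 c20.
exists kap' => // eps' eps'0.
have e'0 : 0 < eps' ^+ 2 by rewrite exprn_gt0.
have [b1 b10 hb1] := exists_small (2 * (2 / kap) + (2 / kap) ^+ 2 + 4 * c * (2 / kap)) c20.
have [b [b0 bb1 b_1 be _]] := exists_min4 b10 (ltr01 : 0 < 1 :> R) (divr_gt0 e'0 (ltr0n _ 10))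
  (ltr01 : 0 < 1 :> R).
have [ze1 ze10 hze] := exists_small (16 * ch (2 * D)) e'0.
have [ze [ze0 zze1 ze_half _ _]] := exists_min4 ze10 (divr_gt0 (ltr01 : 0 < 1 :> R) (ltr0n _ 2))
  (ltr01 : 0 < 1 :> R) (ltr01 : 0 < 1 :> R).
have [th1 th10 hth] := exists_small (3 * slope_const D) (divr_gt0 b0 (ltr0n _ 2)).
have [th [th0 thth1 th_1 _ _]] := exists_min4 th10 (ltr01 : 0 < 1 :> R) (ltr01 : 0 < 1 :> R)
  (ltr01 : 0 < 1 :> R).
pose eps := b / 4; have eps0 : 0 < eps by rewrite divr_gt0.
have [lam lam0 {}IH] := IH eps eps0.
have [l1 [l10 l1lam l1_1 _ _]] := exists_min4 lam0 (ltr01 : 0 < 1 :> R) (ltr01 : 0 < 1 :> R)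
  (ltr01 : 0 < 1 :> R).
exists (ze * (th * l1 / 16)); first by rewrite !(mulr_gt0, divr_gt0).
move=> M d0 os; have [p0 [A [G [G1 Gpos AU]]]] := IH M d0 os.
have d00 := os_pos os.
have ell0 : 0 < lam * d0 by rewrite mulr_gt0.
have thell : 0 < th * (lam * d0) by rewrite mulr_gt0.
have [del del0 obt] := os_obtuse os.
have half : 0 < lam * d0 / 2 by rewrite divr_gt0.
have [del' [del'0 dd1 dd2 _ _]] := exists_min4 del0 thell (ltr01 : 0 < 1 :> R) (ltr01 : 0 < 1 :> R).
have [p [q [p0p p0q pq pqd vert]]] := os_vertical os (A true) p0 mn half b0 del'0.
have pq0 : 0 < mdist p q by rewrite mdist_gt0.
have slope_pq i : (i < m)%N -> `|slope (A true i) p q| <= b.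
  move=> im; rewrite /slope normrM normfV (gtr0_norm pq0) ler_pdivrMr//; exact: vert.
(* With [l1] at most 1 and [lam], the factor 1/16 fits 2 t below d0 / 4, th * ell and rho / 2. The
   new radius ze * t is the announced multiple of [d0]. *)
pose t := th * l1 / 16 * d0.
have t0 : 0 < t by rewrite !(mulr_gt0, divr_gt0).
have tl : 16 * t = th * (l1 * d0) by rewrite /t; field.
have l1d : 0 < l1 * d0 by rewrite mulr_gt0.
have h1 : l1 * d0 <= d0 by rewrite ler_piMl// ltW.
have h2 : l1 * d0 <= lam * d0 by rewrite ler_pM2r.
have h3 : th * (l1 * d0) <= l1 * d0 by rewrite ler_piMl// ltW.
have h4 : th * (l1 * d0) <= th * (lam * d0) by rewrite ler_pM2l.
have Eb : slope_error D eps th <= b.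
  have := hth th; rewrite (ltW th0) thth1 => /(_ isT); rewrite /slope_error /eps; lra.
have epsb : eps <= b by rewrite /eps; lra.
have bS : b * (2 * (2 / kap) + (2 / kap) ^+ 2 + 4 * c * (2 / kap)) <= c ^+ 2 / 2.
  by rewrite mulrC; apply: hb1; rewrite (ltW b0).
have bE : 10 * b <= eps' ^+ 2 by lra.
have zeE : 16 * ze * ch (2 * D) <= eps' ^+ 2.
  by rewrite -mulrA [ze * _]mulrC mulrA; apply: hze; rewrite (ltW ze0).
have t_d : 2 * t <= d0 / 4 by lra.
have t_th : 2 * t <= th * (lam * d0) by lra.
have t_rho : 2 * t < lam * d0 / 2 by lra.
have t_ell : t <= lam * d0 by lra.
have tE : ze * (th * l1 / 16) * d0 = ze * t by rewrite /t; ring.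
rewrite /strainer tE.
have [fo|fo] := obt p q pq (lt_le_trans pqd dd1).
  have [x [h [g [px hgeo ggeo hg]]]] := fo.
  exact: (@strainer_extend_at M d0 n m A G kap kap' eps th b ze eps' (lam * d0) (lam * d0) t p q p0
   os G1 Gpos AU kap0 eps0 ell0 th0 th_1 b0 b_1 Eb epsb bS bE ze0 ze_half zeE gram p0p p0q pq
   (le_trans (ltW pqd) dd2) slope_pq t0 t_d t_th t_rho t_ell x h g px hgeo ggeo hg).
have qp : q != p by rewrite eq_sym.
have qpd : mdist q p <= th * (lam * d0) by rewrite metric_sym (le_trans (ltW pqd) dd2).
have slope_qp i : (i < m)%N -> `|slope (A true i) q p| <= b.
  by rewrite slopeC normrN; exact: slope_pq.
have [x [h [g [px hgeo ggeo hg]]]] := fo.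
exact: (@strainer_extend_at M d0 n m A G kap kap' eps th b ze eps' (lam * d0) (lam * d0) t q p p0
   os G1 Gpos AU kap0 eps0 ell0 th0 th_1 b0 b_1 Eb epsb bS bE ze0 ze_half zeE gram p0q p0p qp
   qpd slope_qp t0 t_d t_th t_rho t_ell x h g px hgeo ggeo hg).
Qed.

End InductionStep.

(** * Dimension *)

Section Dimension.
Variables (R : realType) (M : metricType R).
Implicit Types (p q x y z : M) (A : set M).

Lemma diam_le A (a : R) : 0 <= a -> (forall x y, A x -> A y -> mdist x y <= a) ->
  (diam A <= a%:E)%E.
Proof.
move=> a0 h; rewrite /diam ge_max lee_fin a0 /=.
by apply: ge_ereal_sup => _ [x Ax [y Ay <-]]; rewrite lee_fin h.
Qed.

Lemma hausdorff_weight_ge0 (s : R) A : (0 <= hausdorff_weight s A)%E.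
Proof. by rewrite /hausdorff_weight; case: asboolP => // _; exact: poweR_ge0. Qed.

Lemma hausdorff_weight_le (s : R) A (a : R) : 0 <= s -> 0 <= a ->
  (forall x y, A x -> A y -> mdist x y <= a) -> (hausdorff_weight s A <= (a `^ s)%:E)%E.
Proof.
move=> s0 a0 h; rewrite /hausdorff_weight; case: asboolP => [_|_].
  by rewrite lee_fin powR_ge0.
rewrite -poweR_EFin; apply: gt0_ler_poweR => //; last exact: diam_le.
- by rewrite in_itv /= leey andbT /diam le_max lexx.
- by rewrite in_itv /= leey andbT lee_fin.
Qed.

Lemma hausdorff_content_ge0 (s del : R) A : (0 <= hausdorff_content s del A)%E.
Proof.
apply: le_ereal_inf_tmp => _ [U _ <-].
by apply: nneseries_ge0 => i _ _; exact: hausdorff_weight_ge0.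
Qed.

Lemma hausdorff_content_fin_cover (s del a : R) (L : nat) (U : nat -> set M) :
  0 <= s -> 0 <= a -> a <= del -> [set: M] `<=` \bigcup_i U i ->
  (forall i x y, U i x -> U i y -> mdist x y <= a) ->
  (forall i, (L <= i)%N -> U i = set0) ->
  (hausdorff_content s del [set: M] <= (L%:R * a `^ s)%:E)%E.
Proof.
move=> s0 a0 adel cov Ud U0; apply: ge_ereal_inf.
exists (\sum_(0 <= i <oo) hausdorff_weight s (U i))%E.
  exists U => //; split=> // i; apply: diam_le; first exact: le_trans adel.
  by move=> x y Ux Uy; apply: le_trans adel; exact: Ud Ux Uy.
rewrite (@nneseries_split _ _ 0 L); last by move=> *; exact: hausdorff_weight_ge0.
rewrite eseries0 ?adde0; last first.
  move=> i; rewrite add0n => Li _; rewrite /hausdorff_weight U0//.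
  by case: asboolP.
rewrite add0n; apply: (@le_trans _ _ (\sum_(0 <= k < L) (a `^ s)%:E)%E).
  by apply: lee_sum => i _; apply: hausdorff_weight_le => //; exact: Ud.
by rewrite sumEFin lee_fin sumr_const_nat subn0 mulr_natl.
Qed.

Lemma exists_small_sqrt (C e del k : R) : 0 < e -> 0 < del -> 0 < k ->
  exists N : nat, [/\ (0 < N)%N, (k * N%:R)^-1 <= del & C * Num.sqrt (k * N%:R)^-1 <= e].
Proof.
move=> e0 del0 k0.
have C1 : 0 < `|C| + 1 by rewrite ltr_wpDl.
pose r := Num.min del ((e / (`|C| + 1)) ^+ 2).
have eC : 0 < e / (`|C| + 1) by rewrite divr_gt0.
have r0 : 0 < r by rewrite /r lt_min del0 exprn_gt0.
have kr : 0 <= (k * r)^-1 by rewrite invr_ge0 mulr_ge0// ltW.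
pose N := (Num.bound (k * r)^-1).+1.
have N0 : 0 < N%:R :> R by rewrite ltr0n.
have Nr : (k * N%:R)^-1 <= r.
  rewrite invf_ple ?posrE ?mulr_gt0//.
  have h : (k * r)^-1 <= N%:R.
    by apply: le_trans (ltW (archi_boundP kr)) _; rewrite ler_nat.
  by rewrite -(ler_pM2l k0) in h; apply: le_trans h; rewrite invfM mulrA divff ?mul1r// gt_eqF.
exists N; split=> //; first by apply: le_trans Nr _; rewrite ge_min lexx.
have sq : Num.sqrt (k * N%:R)^-1 <= e / (`|C| + 1).
  rewrite -[X in _ <= X](ger0_norm (ltW eC)) -sqrtr_sqr ler_wsqrtr//.
  by apply: le_trans Nr _; rewrite ge_min lexx orbT.
have sq0 : 0 <= Num.sqrt (k * N%:R)^-1 by exact: sqrtr_ge0.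
move: sq; rewrite ler_pdivlMr// => sq; apply: le_trans sq.
by rewrite mulrC ler_wpM2l//; have := ler_norm C; lra.
Qed.

(** Cells of side 1 / N in the coordinates give about N^m sets of diameter [a] = 1 / (k N), so their
    total weight in dimension m + 1/2 is of order sqrt a. An exponent strictly between m and m + 1
    is enough to exclude dimension n > m. *)
Lemma hausdorff_dim_chart (m : nat) (u : nat -> M -> R) (D k : R) : 0 < k ->
  (forall i x, (i < m)%N -> 0 <= u i x <= D) ->
  (forall x y, x != y -> exists2 i, (i < m)%N & k * mdist x y < `|u i x - u i y|) ->
  (hausdorff_dim [set: M] <= (m%:R + 2^-1)%:E)%E.
Proof.
move=> k0 uD usep; apply: ge_ereal_inf; exists (m%:R + 2^-1)%:E => //.
exists (m%:R + 2^-1) => //; split; first by rewrite addr_ge0// invr_ge0.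
apply/eqP; rewrite eq_le; apply/andP; split; last first.
  apply: le_ereal_sup_tmp; exists (hausdorff_content (m%:R + 2^-1) 1 [set: M]).
    by exists 1 => //=; exact: ltr01.
  exact: hausdorff_content_ge0.
apply: ge_ereal_sup => _ [del /= del0 <-].
apply/lee_addgt0Pr => e e0; rewrite add0e.
pose Dn := Num.bound `|D|.
have Dn_gt : D < Dn%:R.
  by apply: le_lt_trans (ler_norm D) _; apply: archi_boundP.
have [N [N0 Ndel Ne]] := @exists_small_sqrt ((Dn.+1%:R / k) ^+ m) e del k e0 del0 k0.
have NR0 : 0 < N%:R :> R by rewrite ltr0n.
set a := (k * N%:R)^-1 in Ndel Ne *.
have a0 : 0 < a by rewrite invr_gt0 mulr_gt0.
pose K := (N * Dn).+1.
pose digit i x : nat := Num.truncn (N%:R * u i x).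
have digitK i x : (i < m)%N -> (digit i x < K)%N.
  move=> im; have /andP[u0 u1] := uD i x im.
  rewrite truncn_lt_nat ?mulr_ge0// /K -natr1 natrM.
  have : N%:R * u i x <= N%:R * Dn%:R by rewrite ler_wpM2l// (le_trans u1)// ltW.
  by lra.
pose T : finType := {ffun 'I_m -> 'I_K}.
pose U (j : nat) : set M := [set x | exists v : T, enum_rank v = j :> nat /\
   forall i : 'I_m, digit i x = v i].
have cov : [set: M] `<=` \bigcup_i U i.
  move=> x _; pose v : T := [ffun i : 'I_m => Ordinal (digitK i x (ltn_ord i))].
  by exists (enum_rank v) => //; exists v; split=> // i; rewrite ffunE.
have Ud j x y : U j x -> U j y -> mdist x y <= a.
  move=> [v [vj xv]] [v' [v'j yv]].
  have vv : v = v' by apply: enum_rank_inj; apply: val_inj; rewrite /= vj.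
  have [->|xy] := eqVneq x y; first by rewrite mdistxx ltW.
  have [i im] := usep x y xy.
  have := xv (Ordinal im); have := yv (Ordinal im); rewrite -vv /= => <- dxy.
  have /andP[x0 _] := uD i x im; have /andP[y0 _] := uD i y im.
  have Nu z : 0 <= u i z -> (digit i z)%:R <= N%:R * u i z < (digit i z)%:R + 1.
    move=> uz; have Nz : 0 <= N%:R * u i z by rewrite mulr_ge0.
    by rewrite natr1; exact: truncn_itv.
  have := Nu x x0; have := Nu y y0; rewrite dxy => h1 h2 h.
  have h3 : `|N%:R * u i x - N%:R * u i y| < 1 by rewrite ltr_norml; lra.
  rewrite -mulrBr normrM (gtr0_norm NR0) in h3.
  rewrite -(ler_pM2l (mulr_gt0 k0 NR0)) divff ?gt_eqF ?mulr_gt0// ltW//.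
  by apply: lt_trans h3; rewrite mulrAC mulrC ltr_pM2l.
have U0 j : (#|T| <= j)%N -> U j = set0.
  move=> Tj; apply/seteqP; split=> // x [v [vj _]].
  by have := ltn_ord (enum_rank v); rewrite vj ltnNge cardT -cardE Tj.
apply: le_trans (@hausdorff_content_fin_cover (m%:R + 2^-1) del a #|T| U _ (ltW a0) Ndel cov Ud U0) _.
  by rewrite addr_ge0// invr_ge0.
rewrite lee_fin card_ffun !card_ord natrX powRD; last first.
  by apply/implyP => _; rewrite gt_eqF.
rewrite powR_mulrn ?(ltW a0)// powR12_sqrt ?(ltW a0)// mulrA -exprMn.
apply: le_trans Ne; rewrite ler_wpM2r ?sqrtr_ge0//.
have Ka : K%:R * a <= Dn.+1%:R / k.
  have KN : K%:R <= N%:R * Dn.+1%:R :> R.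
    by rewrite -natrM ler_nat /K mulnS -addn1 addnC leq_add2r.
  apply: le_trans (ler_wpM2r (ltW a0) KN) _.
  rewrite /a le_eqVlt; apply/orP; left; apply/eqP.
  by field; rewrite !gt_eqF.
have Ka0 : 0 <= K%:R * a by rewrite mulr_ge0// ltW.
by apply: lerXn2r => //; rewrite nnegrE// (le_trans Ka0 Ka).
Qed.

End Dimension.

(** * Every ball has full dimension *)

Section Vertical.
Variables (R : realType) (M : metricType R) (D : R).
Hypotheses (Mc : compact [set: M]) (Mi : intrinsic M) (Mk : curvature_ge_m1 M).
Hypotheses (D0 : 0 < D) (MD : forall x y : M, mdist x y <= D).

Lemma sh_scale_ge (la a : R) : 0 <= la -> 0 <= a <= D ->
  la / ch D * sh a <= sh (la * a).
Proof.
move=> la0 /andP[a0 aD]; apply: (@le_trans _ _ (la * a)); last by rewrite sh_ge// mulr_ge0.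
rewrite -mulrA ler_wpM2l// mulrC ler_pdivrMr ?ch_gt0//.
apply: le_trans (sh_le_mul a0) _; rewrite ler_wpM2l//; exact: ch_le.
Qed.

(** Pulling y and z toward p does not decrease the comparison angle at p. The law of cosines then
    splits cosh - 1 into a radial and an angular part, and each shrinks at most by a factor of order
    la^2. *)
Lemma contraction_estimate (p y z y' z' : M) (la : R) : 0 < la -> la <= 1 ->
  between p y' y -> between p z' z -> mdist p y' = la * mdist p y ->
  mdist p z' = la * mdist p z ->
  la ^+ 2 / (2 * ch D ^+ 2) * (ch (mdist y z) - 1) <= ch (mdist y' z') - 1.
Proof.
move=> la0 la1 py pz yla zla.
have C0 := ch_gt0 D; have C1 := ch_ge1 D.
have key : ch (la * mdist p y - la * mdist p z) - 1
     + sh (la * mdist p y) * sh (la * mdist p z) * (1 - hcos p y z) <= ch (mdist y' z') - 1.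
  have := hcosE p y' z'; rewrite yla zla => E.
  have [py0|py0] := eqVneq p y.
    by move: E; rewrite -py0 !(mdistxx, mulr0, sh0, ch0, mul0r, sub0r, chN, mul1r); lra.
  have [pz0|pz0] := eqVneq p z.
    by move: E; rewrite -pz0 !(mdistxx, mulr0, sh0, ch0, mul0r, subr0, mulr1); lra.
  have py'0 : p != y' by rewrite -mdist_gt0 yla mulr_gt0// mdist_gt0.
  have pz'0 : p != z' by rewrite -mdist_gt0 zla mulr_gt0// mdist_gt0.
  have h := hcos_mono2 Mc Mi Mk py pz py'0 pz'0.
  have s0 : 0 <= sh (la * mdist p y) * sh (la * mdist p z).
    by rewrite mulr_ge0// sh_ge0// mulr_ge0 ?mdist_ge0// ltW.
  have := ler_wpM2l s0 h; rewrite chB; lra.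
apply: le_trans key.
have E := hcosE p y z.
have -> : ch (mdist y z) - 1 = ch (mdist p y - mdist p z) - 1
   + sh (mdist p y) * sh (mdist p z) * (1 - hcos p y z) by rewrite chB; lra.
rewrite mulrDr; apply: lerD.
  rewrite -mulrBr.
  have h1 := ch_sub1_ge (la * (mdist p y - mdist p z)).
  have h2 : ch (mdist p y - mdist p z) - 1 <= (mdist p y - mdist p z) ^+ 2 * ch D.
    rewrite -ch_norm -[X in _ <= X * _]real_normK ?num_real//.
    apply: ch_sub1_le; rewrite normr_ge0 /=.
    rewrite ler_norml; have := mdist_ge0 p y; have := mdist_ge0 p z.
    by have := MD p y; have := MD p z; lra.
  apply: le_trans h1; rewrite exprMn.
  apply: (@le_trans _ _ (la ^+ 2 / (2 * ch D ^+ 2) * ((mdist p y - mdist p z) ^+ 2 * ch D))).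
    by rewrite ler_wpM2l// divr_ge0// ?sqr_ge0// mulr_ge0// sqr_ge0.
  have -> : la ^+ 2 / (2 * ch D ^+ 2) * ((mdist p y - mdist p z) ^+ 2 * ch D) =
     la ^+ 2 * (mdist p y - mdist p z) ^+ 2 / 2 * (ch D)^-1.
    by field; rewrite gt_eqF.
  by rewrite ler_piMr// ?invf_le1// divr_ge0// mulr_ge0// sqr_ge0.
have [->|py0] := eqVneq p y; first by rewrite !(mdistxx, mulr0, sh0, mul0r).
have [->|pz0] := eqVneq p z; first by rewrite !(mdistxx, mulr0, sh0, mul0r).
rewrite mulrA ler_wpM2r//.
  by have /andP[_ h] := hcos_bound py0 pz0; rewrite subr_ge0.
apply: (@le_trans _ _ ((la / ch D * sh (mdist p y)) * (la / ch D * sh (mdist p z)))); last first.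
  have ld : 0 <= la / ch D by rewrite divr_ge0// ltW.
  have ss a : 0 <= a <= D -> la / ch D * sh a <= sh (la * a) by exact: sh_scale_ge (ltW la0).
  by apply: ler_pM; [exact: mulr_ge0 ld (sh_ge0 (mdist_ge0 _ _))|
    exact: mulr_ge0 ld (sh_ge0 (mdist_ge0 _ _))| |]; apply: ss; rewrite mdist_ge0 MD.
have -> : la / ch D * sh (mdist p y) * (la / ch D * sh (mdist p z)) =
   2 * (la ^+ 2 / (2 * ch D ^+ 2) * (sh (mdist p y) * sh (mdist p z))).
  by field; rewrite gt_eqF.
have : 0 <= la ^+ 2 / (2 * ch D ^+ 2) * (sh (mdist p y) * sh (mdist p z)).
  apply: mulr_ge0; last by apply: mulr_ge0; exact: sh_ge0 (mdist_ge0 _ _).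
  by apply: divr_ge0; [exact: sqr_ge0|rewrite mulr_ge0// sqr_ge0].
by lra.
Qed.

(** Transports the global dimension of M into an arbitrarily small ball: a chart of the ball,
    composed with [phi], charts all of M. *)
Lemma exists_contraction (p : M) (r : R) : 0 < r -> exists (phi : M -> M) (k : R),
  [/\ 0 < k, forall y, mdist p (phi y) < r &
    forall y z, k * mdist y z <= mdist (phi y) (phi z)].
Proof.
move=> r0; pose la := Num.min 1 (r / (2 * D)).
have la0 : 0 < la by rewrite /la lt_min ltr01 divr_gt0// mulr_gt0.
have la1 : la <= 1 by rewrite /la ge_min lexx.
have laD : la * D < r.
  apply: (@le_lt_trans _ _ (r / 2)); last by lra.
  have : la * (2 * D) <= r by rewrite -ler_pdivlMr ?mulr_gt0// /la ge_min lexx orbT.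
  by lra.
have ex y : exists y', mdist p y' = la * mdist p y /\ between p y' y.
  have [|y' [? _ ?]] := @exists_between _ _ Mc Mi p y (la * mdist p y); last by exists y'.
  by rewrite mulr_ge0 ?mdist_ge0 ?(ltW la0)//= ler_piMl// mdist_ge0.
have [phi phiP] := choice ex.
have C0 := ch_gt0 D.
pose e := la ^+ 2 / (2 * ch D ^+ 2) / (2 * ch D).
have e0 : 0 < e by rewrite !divr_gt0// ?mulr_gt0// exprn_gt0.
pose k := Num.min 1 e.
have k0 : 0 < k by rewrite /k lt_min ltr01.
exists phi, k; split=> // [y|y z].
  have [-> _] := phiP y; apply: le_lt_trans laD.
  by rewrite ler_wpM2l// ltW.
have [yla py] := phiP y; have [zla pz] := phiP z.
have := contraction_estimate la0 la1 py pz yla zla.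
have h1 := ch_sub1_ge (mdist y z).
have h2 : ch (mdist (phi y) (phi z)) - 1 <= mdist (phi y) (phi z) ^+ 2 * ch D.
  by apply: ch_sub1_le; rewrite mdist_ge0 MD.
set c := la ^+ 2 / (2 * ch D ^+ 2) => h3.
have c0 : 0 < c by rewrite divr_gt0 ?mulr_gt0 ?exprn_gt0.
have h4 : c * (mdist y z ^+ 2 / 2) <= mdist (phi y) (phi z) ^+ 2 * ch D.
  by apply: le_trans h2; apply: le_trans h3; rewrite ler_pM2l.
have h5 : e * mdist y z ^+ 2 <= mdist (phi y) (phi z) ^+ 2.
  rewrite -(ler_pM2r C0); apply: le_trans h4.
  by rewrite /e -/c le_eqVlt; apply/orP; left; apply/eqP; field; rewrite gt_eqF.
have h6 : (k * mdist y z) ^+ 2 <= mdist (phi y) (phi z) ^+ 2.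
  apply: le_trans h5; rewrite exprMn ler_wpM2r ?sqr_ge0//.
  have kk : k ^+ 2 <= k by rewrite expr2 ler_piMl ?(ltW k0)// /k ge_min lexx.
  by apply: le_trans kk _; rewrite /k ge_min lexx orbT.
by rewrite -ler_sqr ?nnegrE ?mulr_ge0 ?mdist_ge0 ?(ltW k0).
Qed.

(** Otherwise the distances to the f i, composed with the contraction, separate all points of M at a
    linear rate, and M has dimension at most m + 1/2 < n. *)
Lemma vertical_pair (n m : nat) (f : nat -> M) (p : M) (rho eta del : R) :
  hausdorff_dim [set: M] = n%:R%:E -> (m < n)%N -> 0 < rho -> 0 < eta -> 0 < del ->
  exists p' q', [/\ mdist p p' < rho, mdist p q' < rho, p' != q', mdist p' q' < del &
    forall i, (i < m)%N -> `|mdist p' (f i) - mdist q' (f i)| <= eta * mdist p' q'].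
Proof.
move=> dimM mn rho0 eta0 del0; apply: contrapT => no.
pose r := Num.min rho (del / 2).
have r0 : 0 < r by rewrite /r lt_min rho0 divr_gt0.
have rr : r <= rho by rewrite /r ge_min lexx.
have rd : r <= del / 2 by rewrite /r ge_min lexx orbT.
have [phi [k [k0 phir phik]]] := exists_contraction p r0.
have sep x y : x != y -> exists2 i, (i < m)%N &
    eta * k * mdist x y < `|mdist (phi x) (f i) - mdist (phi y) (f i)|.
  move=> xy; apply: contrapT => nosep; apply: no.
  have xy0 : 0 < mdist x y by rewrite mdist_gt0.
  have pxy : 0 < mdist (phi x) (phi y) by apply: lt_le_trans (phik x y); rewrite mulr_gt0.
  exists (phi x), (phi y); split.
  - exact: lt_le_trans (phir x) rr.
  - exact: lt_le_trans (phir y) rr.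
  - by rewrite -mdist_gt0.
  - have := metric_triangle (phi x) p (phi y); rewrite (metric_sym (phi x) p).
    by have := phir x; have := phir y; lra.
  - move=> i im; rewrite leNgt; apply/negP => h; apply: nosep; exists i => //.
    by apply: le_lt_trans h; rewrite -mulrA ler_pM2l.
have ek : 0 < eta * k by rewrite mulr_gt0.
have := @hausdorff_dim_chart R M m (fun i x => mdist (phi x) (f i)) D (eta * k) ek _ sep.
rewrite dimM lee_fin => h; have {h} := h _.
have mn' : m%:R + 1 <= n%:R :> R by rewrite natr1 ler_nat.
by move=> /(_ (fun i x _ => introT andP (conj (mdist_ge0 _ _) (MD _ _)))); lra.
Qed.

End Vertical.

(** * Distance maps *)

Section OpenDistanceMap.
Variables (R : realType) (M : metricType R) (D : R).
Hypotheses (Mc : compact [set: M]) (Mi : intrinsic M) (Mk : curvature_ge_m1 M).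
Hypothesis MD : forall x y : M, mdist x y <= D.
Variables (n : nat) (A : bool -> nat -> M) (G : nat -> nat -> R) (kap eps ell th rho : R) (p : M).
Let U := [set q | mdist p q < rho].
Hypotheses (AU : strained n A G eps ell U) (G1 : forall i, G i i = 1).
Hypothesis Gpos : forall s : nat -> R, kap * (\sum_(i < n) `|s i|) ^+ 2 <=
        \sum_(i < n) \sum_(j < n) s i * s j * G i j.
Hypotheses (eps0 : 0 < eps) (ell0 : 0 < ell) (th0 : 0 < th) (th1 : th <= 1) (kap0 : 0 < kap).
Hypothesis E_le : slope_error D eps th + eps ^+ 2 <= kap / 2.

Lemma slope_toward (z z' : M) (e : bool) (i j : nat) : U z -> U z' -> z != z' ->
  mdist z z' <= th * ell -> (i < n)%N -> (j < n)%N -> between z z' (A e j) ->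
  `|slope (A true i) z z' - sg R e * G i j| <= kap / 2.
Proof.
move=> Uz Uz' zz' zth im jm bz.
have h e' : hcos z (A e' i) z' <= sg R e' * sg R e * G i j + eps ^+ 2.
  have [_ hz] := AU Uz; apply: le_trans (hz e' e i j im jm).
  rewrite ![hcos z (A e' i) _]hcosC; apply: (hcos_mono Mc Mi Mk) => //.
  exact: (strained_neq AU ell0).
have s e' := strained_hcos Mc Mi Mk MD AU G1 eps0 ell0 th0 th1 e' Uz Uz' zz' im zth.
move: (h true) (h false) (s true) (s false) E_le; rewrite !ler_norml /=.
by case: (e) => /=; lra.
Qed.

(** If every column sum were below kap S, weighting them with the r j would give a quadratic form
    below kap S^2. *)
Lemma large_column (r : nat -> R) : 0 < \sum_(i < n) `|r i| ->
  exists2 j, (j < n)%N & kap * (\sum_(i < n) `|r i|) <= `|\sum_(i < n) r i * G i j|.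
Proof.
set S := \sum_(i < n) `|r i| => S0; apply: contrapT => no.
have lt j : (j < n)%N -> `|\sum_(i < n) r i * G i j| < kap * S.
  by move=> jn; rewrite ltNge; apply/negP => h; apply: no; exists j.
have := Gpos r; rewrite -/S exchange_big /= => h.
have [j rj] : exists j : 'I_n, r j != 0.
  apply: contrapT => all0; move: S0; rewrite /S big1 ?ltxx// => i _.
  by apply/eqP; rewrite normr_eq0; apply/negPn/negP => ri; apply: all0; exists i.
have : \sum_(j < n) \sum_(i < n) r i * r j * G i j < \sum_(j < n) `|r j| * (kap * S).
  have le (k : 'I_n) : \sum_(i < n) r i * r k * G i k <= `|r k| * `|\sum_(i < n) r i * G i k|.
    rewrite -normrM; apply: le_trans (ler_norm _); rewrite mulr_sumr le_eqVlt.
    by apply/orP; left; apply/eqP; apply: eq_bigr => i _; ring.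
  rewrite (bigD1 j)//= [X in _ < X](bigD1 j)//=; apply: ltr_leD.
    by apply: le_lt_trans (le j) _; rewrite ltr_pM2l ?normr_gt0// lt.
  apply: ler_sum => k _; apply: le_trans (le k) _.
  by rewrite ler_wpM2l// ltW// lt.
rewrite -mulr_suml -/S; move: h; rewrite expr2 => h1 h2.
have := le_lt_trans h1 h2; have -> : S * (kap * S) = kap * (S * S) by ring.
by rewrite ltxx.
Qed.

(** A variational argument in the manner of Ekeland, with no differentiability. At a minimizer with
    nonzero residual, moving toward a suitable [A e j] lowers the residual at rate about kap / 2 or
    more, while the penalty grows at rate at most kap / 4. *)
Lemma distance_map_surjective (c : nat -> R) :
  Num.sqrt (\sum_(i < n) (mdist p (A true i) - c i) ^+ 2) < kap / 4 * rho ->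
  exists z, forall i, (i < n)%N -> mdist z (A true i) = c i.
Proof.
move=> small.
pose Q z := \sum_(i < n) (mdist z (A true i) - c i) ^+ 2.
have Q0 z : 0 <= Q z by apply: sumr_ge0 => i _; exact: sqr_ge0.
have contd a : continuous (fun z : M => mdist z a).
  apply: (@lipschitz_continuous _ _ _ 1) => x y; rewrite mul1r.
  have := mdist_norm a x y; rewrite !(metric_sym a) ler_norml; lra.
have contQ : continuous Q.
  suff cont k : continuous (fun z => \sum_(i < k) (mdist z (A true i) - c i) ^+ 2) by exact: cont.
  elim: k => [|k IH].
    have -> : (fun z => \sum_(i < 0) (mdist z (A true i) - c i) ^+ 2) = cst 0.
      by apply/funext => z; rewrite big_ord0.
    by move=> z; exact: cvg_cst.
  have -> : (fun z => \sum_(i < k.+1) (mdist z (A true i) - c i) ^+ 2) =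
    (fun z => \sum_(i < k) (mdist z (A true i) - c i) ^+ 2 + (mdist z (A true k) - c k) ^+ 2).
    by apply/funext => z; rewrite big_ord_recr.
  move=> z; apply: cvgD; first exact: IH.
  apply: (@continuous_comp _ _ _ (fun z => mdist z (A true k) - c k) (fun x => x ^+ 2)).
    by apply: cvgB; [exact: contd|exact: cvg_cst].
  exact: exprn_continuous.
have M0 : [set: M] !=set0 by exists p.
(* Comparison with p, where the penalty vanishes, keeps the minimizer within [rho] of p by
   hypothesis [small]. *)
have [|z _ zmin] := @compact_EVT_min M R (fun z => Num.sqrt (Q z) + kap / 4 * mdist z p) setT M0 Mc.
  apply: continuous_subspaceT => z; apply: cvgD.
    by apply: (@continuous_comp _ _ _ Q Num.sqrt); [exact: contQ|exact: sqrt_continuous].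
  by apply: cvgM; [exact: cvg_cst|exact: contd].
have {}zmin y : Num.sqrt (Q z) + kap / 4 * mdist z p <= Num.sqrt (Q y) + kap / 4 * mdist y p.
  by apply: zmin; rewrite inE.
have Uz : U z.
  have := zmin p; rewrite mdistxx mulr0 addr0 => h; rewrite /U /= (metric_sym p z).
  have k4 : 0 < kap / 4 by rewrite divr_gt0.
  rewrite -(ltr_pM2l k4); apply: le_lt_trans small; apply: le_trans h.
  by rewrite lerDr sqrtr_ge0.
exists z; apply: contrapT => no.
pose r i : R := mdist z (A true i) - c i.
pose S : R := \sum_(i < n) `|r i|.
have S0 : 0 < S.
  rewrite lt_neqAle sumr_ge0 ?andbT//; apply/negP => /eqP S0; apply: no => i im.
  have := psumr_eq0P (fun (i : 'I_n) _ => normr_ge0 (r i)) (esym S0) (i := Ordinal im) isT.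
  by move=> /eqP; rewrite normr_eq0 subr_eq0 => /eqP.
have QS : Q z <= S ^+ 2.
  rewrite /S expr2 mulr_suml /Q; apply: ler_sum => i _.
  rewrite -/(r i) -real_normK ?num_real// expr2 ler_wpM2l//.
  by rewrite (bigD1 i)//= lerDl sumr_ge0.
have [j jn hj] := large_column S0.
set nu := Num.sqrt (Q z) in zmin.
have nuS : nu <= S.
  by rewrite /nu -[S]ger0_norm ?(ltW S0)// -sqrtr_sqr ler_wsqrtr.
have nu2 : nu ^+ 2 = Q z by rewrite sqr_sqrtr.
have nu0 : 0 < nu.
  rewrite sqrtr_gt0 lt_neqAle Q0 andbT; apply/negP => /eqP Q00; apply: no => i im.
  have := psumr_eq0P (fun (i : 'I_n) _ => sqr_ge0 (r i)) (esym Q00) (i := Ordinal im) isT.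
  by move=> /eqP; rewrite sqrf_eq0 subr_eq0 => /eqP.
pose e := 0 <= \sum_(i < n) r i * G i j.
have ej : kap * S <= sg R e * \sum_(i < n) r i * G i j.
  apply: le_trans hj _; rewrite /e; case: (lerP 0 (\sum_(i < n) r i * G i j)) => h /=.
    by rewrite mul1r ger0_norm.
  by rewrite mulN1r ltr0_norm.
have zA : z != A e j by exact: (strained_neq AU ell0).
pose gap := rho - mdist p z.
have gap0 : 0 < gap by rewrite subr_gt0.
have thell : 0 < th * ell by rewrite mulr_gt0.
have n1 : 0 < n%:R + 1 :> R by rewrite ltr_wpDl.
have nk : 0 < kap * nu / (4 * (n%:R + 1)) by rewrite divr_gt0// mulr_gt0.
have nuk : 0 < nu / (kap / 4) by rewrite !divr_gt0.
(* The four bounds keep z' in U, make the slope estimate available, keep the quadratic term n s^2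
   below the linear gain, and make nu - kap / 4 * s nonnegative so that it can be squared. *)
have [s [s0 s_gap s_th s_nk s_nuk]] := exists_min4 (divr_gt0 gap0 (ltr0n _ 2)) thell nk nuk.
pose s1 := Num.min s (mdist z (A e j)).
have s10 : 0 < s1 by rewrite lt_min s0 mdist_gt0.
have s1s : s1 <= s by rewrite ge_min lexx.
have [|z' [zz' _ bz]] := @exists_between _ _ Mc Mi z (A e j) s1.
  by rewrite (ltW s10) ge_min lexx orbT.
have Uz' : U z'.
  by rewrite /U /=; have := metric_triangle p z z'; rewrite zz' /gap in s_gap *; lra.
have zz'0 : z != z' by rewrite -mdist_gt0 zz'.
have zz'th : mdist z z' <= th * ell by rewrite zz' (le_trans s1s).
pose sl i := slope (A true i) z z'.
have slb i : (i < n)%N -> `|sl i - sg R e * G i j| <= kap / 2.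
  by move=> im; exact: slope_toward.
have rz' i : mdist z' (A true i) - c i = r i - s1 * sl i.
  rewrite /sl /slope zz' mulrC divfK ?gt_eqF// /r; ring.
have Qz' : Q z' <= Q z - s1 * kap * S + n%:R * s1 ^+ 2.
  have -> : Q z' = Q z - 2 * s1 * (\sum_(i < n) r i * sl i) + s1 ^+ 2 * \sum_(i < n) sl i ^+ 2.
    rewrite /Q !mulr_sumr -sumrB -big_split /=; apply: eq_bigr => i _.
    by rewrite rz' /r; ring.
  have h1 : \sum_(i < n) sl i ^+ 2 <= n%:R.
    rewrite -[n in n%:R]card_ord -sumr_const; apply: ler_sum => i _.
    have := slope_bound (A true i) zz'0; rewrite -/(sl i) => /andP[a1 a2].
    by rewrite -real_normK ?num_real// expr_le1// ler_norml a1.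
  have h2 : kap / 2 * S <= \sum_(i < n) r i * sl i.
    have h3 : \sum_(i < n) r i * (sg R e * G i j) - \sum_(i < n) r i * sl i <= kap / 2 * S.
      rewrite -sumrB /S mulr_sumr; apply: ler_sum => i _.
      rewrite -mulrBr; apply: le_trans (ler_norm _) _.
      by rewrite normrM mulrC ler_wpM2r// distrC slb.
    have h4 : \sum_(i < n) r i * (sg R e * G i j) = sg R e * \sum_(i < n) r i * G i j.
      by rewrite mulr_sumr; apply: eq_bigr => i _; ring.
    by move: h3 ej; rewrite h4; lra.
  have h5 := ler_wpM2l (sqr_ge0 s1) h1.
  have h6 := ler_wpM2l (ltW s10) h2.
  by lra.
have hmin : nu - kap / 4 * s1 <= Num.sqrt (Q z').
  have := zmin z'; have := metric_triangle z' z p; rewrite (metric_sym z' z) zz' => h1 h2.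
  have k4 : 0 <= kap / 4 by rewrite divr_ge0// ltW.
  by have := ler_wpM2l k4 h1; rewrite mulrDr; lra.
have pos : 0 <= nu - kap / 4 * s1.
  have := le_trans s1s s_nuk; rewrite ler_pdivlMr ?divr_gt0//; lra.
have sq : (nu - kap / 4 * s1) ^+ 2 <= Q z'.
  by rewrite -(sqr_sqrtr (Q0 z')) ler_sqr// nnegrE sqrtr_ge0.
have h7 : s1 * kap * nu <= s1 * kap * S by rewrite ler_wpM2l// mulr_ge0// ltW.
have h8 : s1 * (4 * (n%:R + 1)) <= kap * nu.
  by rewrite -ler_pdivlMr ?mulr_gt0//; exact: le_trans s_nk.
have h9 := ler_wpM2l (ltW s10) h8.
have h10 := sqr_ge0 (kap / 4 * s1).
have h11 : 0 < s1 * (kap * nu) by rewrite !mulr_gt0.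
have h12 : 0 <= s1 ^+ 2 by exact: sqr_ge0.
by rewrite -nu2 in Qz'; have := le_trans sq Qz'; rewrite sqrrB; lra.
Qed.

End OpenDistanceMap.

(** * Hausdorff measure *)

Lemma expr_add_le (R : realFieldType) (a b : R) n : 0 <= a -> 0 <= b ->
  (a + b) ^+ n <= 2 ^+ n * (a ^+ n + b ^+ n).
Proof.
move=> a0 b0; wlog ab : a b a0 b0 / a <= b => [hw|].
  have [|/ltW] := leP a b; first exact: hw.
  by rewrite [a + b]addrC [_ ^+ n + _]addrC; exact: hw.
apply: (@le_trans _ _ ((2 * b) ^+ n)).
  by apply: lerXn2r; rewrite ?nnegrE ?addr_ge0 ?mulr_ge0//; lra.
by rewrite exprMn ler_wpM2l ?exprn_ge0// lerDr exprn_ge0.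
Qed.

Lemma card_grid_le (n N t : nat) (S : {set {ffun 'I_n -> 'I_N}}) :
  (forall v v' j, v \in S -> v' \in S -> (v j <= v' j + t)%N) ->
  (#|S| <= (2 * t).+1 ^ n)%N.
Proof.
move=> h; have [->|[v0 v0S]] := set_0Vmem S; first by rewrite cards0.
pose f (v : {ffun 'I_n -> 'I_N}) : {ffun 'I_n -> 'I_(2 * t).+1} :=
  [ffun j => inord (v j + t - v0 j)].
rewrite -[X in (_ <= X)%N](_ : #|{ffun 'I_n -> 'I_(2 * t).+1}| = _); last first.
  by rewrite card_ffun !card_ord.
apply: (@leq_card_in _ _ f) => v v' vS v'S /ffunP e; apply/ffunP => j; apply: val_inj.
have := congr1 val (e j); rewrite !ffunE /= !inordK.
- move=> /(congr1 (addn^~ (v0 j))); rewrite !subnK ?h//.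
  by move=> /addIn.
- by rewrite ltnS leq_subLR mulSn mul1n addnA leq_add2r h.
- by rewrite ltnS leq_subLR mulSn mul1n addnA leq_add2r h.
Qed.

Section HausdorffLowerBound.
Variables (R : realType) (M : metricType R).
Hypothesis Mc : compact [set: M].

Lemma finite_ball_cover (V : nat -> set M) :
  (forall x, exists i e, 0 < e /\ forall y, mdist x y < e -> V i y) ->
  exists L : nat, forall x, exists2 i, (i < L)%N & V i x.
Proof.
move=> cov; apply: contrapT => no.
have ex L : exists x, forall i, (i < L)%N -> ~ V i x.
  apply: contrapT => h; apply: no; exists L => x; apply: contrapT => hx.
  by apply: h; exists x => i iL Vi; apply: hx; exists i.
have [W WP] := choice ex.
have [x [_ xW]] := Mc (fmap_proper_filter W eventually_filter) filterT.
have [i [e [e0 iV]]] := cov x.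
have [y [[L iL Wy] yx]] : (W @` [set L | (i < L)%N]) `&` ball x e !=set0.
  apply: xW; last exact: nbhsx_ballx.
  have : \oo [set L | (i < L)%N] by exists i.+1.
  by apply: filterS => L hL; exists L.
by apply: (WP L i iL); apply: iV; move: yx; rewrite ballEmdist -Wy.
Qed.

Lemma geometric_sum_le (L : nat) : \sum_(i < L) (2^-1 : R) ^+ i <= 2.
Proof.
suff : \sum_(i < L) (2^-1 : R) ^+ i = 2 - 2 * 2^-1 ^+ L.
  have p0 : 0 <= 2^-1 ^+ L :> R by rewrite exprn_ge0// invr_ge0.
  by move=> ->; lra.
elim: L => [|L IH]; first by rewrite big_ord0 expr0; lra.
by rewrite big_ord_recr IH /= exprS; lra.
Qed.

Lemma diam_fin (A : set M) (a : R) : (diam A <= a%:E)%E ->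
  exists d : R, [/\ diam A = d%:E, 0 <= d & forall x y, A x -> A y -> mdist x y <= d].
Proof.
move=> h; have h0 : (0 <= diam A)%E by rewrite /diam le_max lexx.
have dE : diam A = (fine (diam A))%:E.
  by rewrite fineK// ge0_fin_numE// (le_lt_trans h)// ltry.
exists (fine (diam A)); split=> //; first by rewrite -lee_fin -dE.
move=> x y Ax Ay; rewrite -lee_fin -dE /diam le_max; apply/orP; right.
by apply: le_ereal_sup_tmp; exists (mdist x y)%:E => //; exists x => //; exists y.
Qed.

Lemma hausdorff_weight_diam (n : nat) (A : set M) (d : R) : (0 < n)%N ->
  diam A = d%:E -> 0 <= d -> ((d ^+ n)%:E <= hausdorff_weight n%:R A)%E.
Proof.
move=> n0 dA d0; rewrite /hausdorff_weight; case: asboolP => [A0|_].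
  have : (diam A <= 0%:E)%E by apply: diam_le => // x y; rewrite A0.
  rewrite dA lee_fin => d0'; have -> : d = 0 by apply/eqP; rewrite eq_le d0'.
  by rewrite expr0n gtn_eqF.
by rewrite dA poweR_EFin powR_mulrn.
Qed.

Variables (n : nat) (u : nat -> M -> R) (c0 : nat -> R) (w : R).
Hypotheses (n0 : (0 < n)%N) (w0 : 0 < w).
Hypothesis ulip : forall i x y, `|u i x - u i y| <= mdist x y.
Hypothesis usurj : forall c : nat -> R, (forall i, (i < n)%N -> `|c i - c0 i| <= w) ->
  exists z, forall i, (i < n)%N -> u i z = c i.

(** Volume by counting: lift the N^n points of a grid of spacing 2 w / N in the cube to M. As the
    coordinates are 1-Lipschitz, a set of diameter d contains lifts whose grid indices differ by at
    most d N / (2 w), hence at most (d N / w + 1)^n of them. *)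
Lemma grid_cover_le (L N : nat) (V : nat -> set M) (d : nat -> R) : (0 < N)%N ->
  (forall i, 0 <= d i) ->
  (forall x, exists2 i, (i < L)%N & V i x) ->
  (forall i x y, V i x -> V i y -> mdist x y <= d i) ->
  N%:R ^+ n <= \sum_(i < L) (d i * N%:R / w + 1) ^+ n.
Proof.
move=> N0 d0 cov Vd; have NR : 0 < N%:R :> R by rewrite ltr0n.
pose T : finType := {ffun 'I_n -> 'I_N}.
pose pos (v : T) (i : nat) : R :=
  c0 i - w + 2 * w * ((if insub i is Some j then (v j)%:R else 0) / N%:R).
have ex (v : T) : exists z, forall i, (i < n)%N -> u i z = pos v i.
  apply: usurj => i im; rewrite /pos insubT /=.
  have v0 : 0 <= (v (Ordinal im))%:R / N%:R :> R by rewrite divr_ge0.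
  have v1 : (v (Ordinal im))%:R / N%:R <= 1 :> R.
    by rewrite ler_pdivrMr// mul1r ler_nat ltnW.
  have := ler_wpM2l (ltW w0) v1; have := mulr_ge0 (ltW w0) v0.
  by rewrite ler_norml; set q := _ / _; lra.
have [z zP] := choice ex.
pose t i := Num.truncn (d i * N%:R / (2 * w)).
pose S (i : nat) : {set T} := finset (fun v : T => `[< V i (z v) >]).
have Scard i : (#|S i| <= (2 * t i).+1 ^ n)%N.
  apply: card_grid_le => v v' j; rewrite !finset.in_set => /asboolP Vv /asboolP Vv'.
  have := le_trans (ulip j (z v) (z v')) (Vd i _ _ Vv Vv').
  rewrite !zP// /pos !(valK j).
  set a := v j; set b := v' j => h.
  have h1 : a%:R - b%:R <= d i * N%:R / (2 * w).
    rewrite ler_pdivlMr ?mulr_gt0//.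
    have {}h := le_trans (ler_norm _) h.
    have e : (c0 j - w + 2 * w * (a%:R / N%:R) - (c0 j - w + 2 * w * (b%:R / N%:R))) * N%:R =
       (a%:R - b%:R) * (2 * w) by field; rewrite gt_eqF.
    by rewrite -e ler_pM2r.
  have h2 := truncnS_gt (d i * N%:R / (2 * w)).
  have : a%:R < (b + (t i).+1)%:R :> R by rewrite natrD /t; lra.
  by rewrite ltr_nat addnS ltnS.
have total : (N ^ n <= \sum_(i < L) #|S i|)%N.
  have -> : (N ^ n = \sum_(v : T) 1)%N by rewrite sum1_card card_ffun !card_ord.
  have -> : (\sum_(i < L) #|S i| = \sum_(v : T) \sum_(i < L) (v \in S i))%N.
    rewrite exchange_big /=; apply: eq_bigr => i _.
    by rewrite -sum1_card big_mkcond /=; apply: eq_bigr => v _; case: (v \in S i).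
  apply: leq_sum => v _; have [i iL Vi] := cov (z v).
  rewrite (bigD1 (Ordinal iL))//= finset.in_set.
  by have -> : `[< V i (z v) >] by apply/asboolP.
have : (N ^ n)%:R <= (\sum_(i < L) (2 * t i).+1 ^ n)%:R :> R.
  by rewrite ler_nat (leq_trans total)//; apply: leq_sum => i _; exact: Scard.
rewrite natrX natr_sum; move=> h; apply: le_trans h _; apply: ler_sum => i _.
have X0 : 0 <= d i * N%:R / (2 * w) by rewrite divr_ge0 ?mulr_ge0// ltW.
have e : d i * N%:R / w = 2 * (d i * N%:R / (2 * w)) by field; rewrite gt_eqF.
rewrite natrX; apply: lerXn2r; rewrite ?nnegrE//.
  by rewrite e addr_ge0// mulr_ge0.
have /andP[tX _] := truncn_itv X0.
by rewrite -natr1 natrM e lerD2r ler_pM2l.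
Qed.

(** Thicken a cover of too small weight to neighbourhoods, pass to finitely many and count grid
    points. The constant 16 gives (4 / w)^n (w / 16)^n = 4^-n <= 1/4. The content at scale 1 is
    already a lower bound for the measure, and makes the diameters finite. *)
Lemma hausdorff_raw_ge : (((w / 16) ^+ n)%:E <= hausdorff_measure_raw n%:R [set: M])%E.
Proof.
apply: le_ereal_sup_tmp; exists (hausdorff_content n%:R 1 [set: M]).
  by exists 1 => //=; exact: ltr01.
apply: le_ereal_inf_tmp => _ [U [cov Udiam] <-]; rewrite leNgt; apply/negP => small.
have [d dP] := choice (fun i => diam_fin (Udiam i)).
have d_ge0 i : 0 <= d i by have [] := dP i.
have partial L : \sum_(i < L) d i ^+ n < (w / 16) ^+ n.
  rewrite -lte_fin; apply: le_lt_trans small; rewrite -sumEFin.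
  apply: le_trans (nneseries_lim_ge L _); last by move=> *; exact: hausdorff_weight_ge0.
  rewrite big_mkord; apply: lee_sum => i _.
  by have [dE di _] := dP i; exact: hausdorff_weight_diam.
have kw : 0 < (4 / w) ^+ n by rewrite exprn_gt0// divr_gt0.
have e40 : 0 < 1 / 4 :> R by rewrite divr_gt0.
have [e1 e10 he1] := exists_small ((4 / w) ^+ n * 4) e40.
have [e [e0 ee1 e_half _ _]] := exists_min4 e10 (divr_gt0 (ltr01 : 0 < 1 :> R) (ltr0n _ 2))
  (ltr01 : 0 < 1 :> R) (ltr01 : 0 < 1 :> R).
pose ep i : R := e * 2^-1 ^+ i.
have ep0 i : 0 < ep i by rewrite mulr_gt0// exprn_gt0// invr_gt0.
have ep1 i : 2 * ep i <= 1.
  have : 2^-1 ^+ i <= 1 :> R by rewrite exprn_ile1//; lra.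
  by move=> /(ler_wpM2l (ltW e0)); rewrite -/(ep i); lra.
pose V i : set M := [set x | exists2 y, U i y & mdist y x < ep i].
have Vd i x y : V i x -> V i y -> mdist x y <= d i + 2 * ep i.
  move=> [x' Ux xx] [y' Uy yy]; have [_ _ /(_ x' y' Ux Uy) h] := dP i.
  have := metric_triangle x x' y; have := metric_triangle x' y' y.
  by rewrite (metric_sym x x'); lra.
have [L VL] : exists L : nat, forall x, exists2 i, (i < L)%N & V i x.
  apply: finite_ball_cover => x; have [i _ Ui] := cov x Logic.I.
  by exists i, (ep i); split=> // y xy; exists x.
have dep0 i : 0 <= d i + 2 * ep i by rewrite addr_ge0// mulr_ge0// ltW.
(* The grid is chosen after the finite cover, so that the rounding terms 2^n per set amount to at
   most N / 4. The weights and the thickening each take at most a quarter of N^n, so fewer than N^n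
   points would be covered. *)
pose N := (Num.bound (4 * (2 ^+ n * L%:R) : R)).+1.
have NL : 4 * (2 ^+ n * L%:R) <= N%:R :> R.
  have b0 : 0 <= 4 * (2 ^+ n * L%:R) :> R by rewrite !mulr_ge0// exprn_ge0.
  by apply: le_trans (ltW (archi_boundP b0)) _; rewrite ler_nat.
have NR : 0 < N%:R :> R by rewrite ltr0n.
have N1 : 1 <= N%:R :> R by rewrite ler1n.
have := @grid_cover_le L N V (fun i => d i + 2 * ep i) isT dep0 VL Vd.
have term i : ((d i + 2 * ep i) * N%:R / w + 1) ^+ n <=
    N%:R ^+ n * (4 / w) ^+ n * (d i ^+ n + 2 * ep i) + 2 ^+ n.
  have Nw : 0 <= N%:R / w by rewrite divr_ge0 ?ltW.
  apply: le_trans (expr_add_le n _ ler01) _; first by rewrite -mulrA mulr_ge0.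
  rewrite expr1n mulrDr mulr1 lerD2r -mulrA exprMn.
  have h1 := expr_add_le n (d_ge0 i) (mulr_ge0 (ler0n _ 2) (ltW (ep0 i))).
  have h2 : (2 * ep i) ^+ n <= 2 * ep i.
    have x0 : 0 <= 2 * ep i by rewrite mulr_ge0// ltW.
    by rewrite -[X in _ ^+ X](prednK n0) exprS ler_piMr// exprn_ile1.
  have h3 : (d i + 2 * ep i) ^+ n <= 2 ^+ n * (d i ^+ n + 2 * ep i).
    by apply: le_trans h1 _; rewrite ler_wpM2l ?exprn_ge0// lerD2l.
  have -> : N%:R ^+ n * (4 / w) ^+ n * (d i ^+ n + 2 * ep i) =
     2 ^+ n * (2 ^+ n * (d i ^+ n + 2 * ep i) * (N%:R / w) ^+ n).
    rewrite !exprMn; have -> : 4 = 2 * 2 :> R by ring.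
    by rewrite exprMn; ring.
  by rewrite ler_wpM2l ?exprn_ge0// ler_wpM2r// exprn_ge0.
move=> h; have {h} := le_trans h (ler_sum _ (fun (i : 'I_L) _ => term i)).
rewrite big_split /= sumr_const card_ord -mulr_sumr big_split /= -mulr_sumr.
have -> : \sum_(i < L) ep i = e * \sum_(i < L) 2^-1 ^+ i by rewrite mulr_sumr.
have Nn : N%:R <= N%:R ^+ n :> R by rewrite -[n]prednK// exprS ler_peMr ?(ltW NR)// exprn_ege1.
have Nn0 : 0 < N%:R ^+ n :> R by rewrite exprn_gt0.
have a1 : (4 / w) ^+ n * (w / 16) ^+ n <= 1 / 4.
  rewrite -exprMn; have -> : 4 / w * (w / 16) = 4^-1 by field; rewrite gt_eqF.
  by rewrite -[n]prednK// exprS div1r ler_piMr ?invr_ge0// exprn_ile1 ?invr_ge0// invf_le1// ler1n.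
have a2 : (4 / w) ^+ n * \sum_(i < L) d i ^+ n <= 1 / 4.
  by apply: le_trans a1; rewrite ler_wpM2l ?(ltW kw)// ltW// partial.
have a3 : (4 / w) ^+ n * (2 * (e * \sum_(i < L) 2^-1 ^+ i)) <= 1 / 4.
  have he := he1 e; rewrite (ltW e0) ee1 in he; apply: le_trans (he isT).
  rewrite -mulrA ler_wpM2l ?(ltW kw)//.
  have := ler_wpM2l (ltW e0) (geometric_sum_le L); lra.
have a4 := lerD a2 a3; rewrite -mulrDr in a4.
have a5 := ler_wpM2l (ltW Nn0) a4.
rewrite mulr_natr in NL; rewrite mulrA in a5.
by move: a5 NL Nn Nn0; move: (2 ^+ n *+ L) (N%:R ^+ n) (_ * (_ + _)) => a b c; clear small; lra.
Qed.

End HausdorffLowerBound.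

(** * Obtuse constants *)

Section Angles.
Variables (R : realType) (M : metricType R).
Implicit Types p q x y : M.

Lemma comparison_cos_bound p x y : p != x -> p != y ->
  -1 <= (mdist p x ^+ 2 + mdist p y ^+ 2 - mdist x y ^+ 2) / (2 * mdist p x * mdist p y) <= 1.
Proof.
rewrite -!mdist_gt0 => a0 b0.
have ab0 : 0 < 2 * mdist p x * mdist p y by rewrite !mulr_gt0.
rewrite ler_pdivlMr// ler_pdivrMr//.
have := metric_triangle x p y; have := mdist_norm p x y; rewrite (metric_sym x p).
have := mdist_ge0 x y; move: (mdist p x) (mdist p y) (mdist x y) a0 b0 {ab0} => a b c a0 b0 c0.
rewrite ler_norml => /andP[h1 h2] h3.
by apply/andP; split; nra.
Qed.

Lemma min_geodesic_mdist p q (g : R -> M) (s : R) : min_geodesic p q g ->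
  0 <= s <= mdist p q -> mdist p (g s) = s.
Proof.
move=> [g0 _ gg] sq; rewrite -[p in LHS]g0 gg//; last by rewrite lexx mdist_ge0.
by rewrite sub0r normrN ger0_norm//; case/andP: sq.
Qed.

Lemma angle_le_pi p q x (g h : R -> M) : p != q -> p != x ->
  min_geodesic p q g -> min_geodesic p x h -> angle p g h <= pi.
Proof.
rewrite -!mdist_gt0 => pq px gg hh.
have [cv|dv] := pselect (cvg (comparison_angle p (g st.1) (h st.2)
    @[st --> filter_prod (at_right (0 : R)) (at_right (0 : R))])); last first.
  by rewrite /angle dvgP//; exact: pi_ge0.
apply: limr_le => //.
exists ([set s | 0 < s /\ s < mdist p q], [set s | 0 < s /\ s < mdist p x]) => /=.
  by split; apply: filterI; [exact: nbhs_right_gt|exact: nbhs_right_lt|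
    exact: nbhs_right_gt|exact: nbhs_right_lt].
move=> [s t] /= [[s0 sq] [t0 tx]]; apply: acos_lepi; apply: comparison_cos_bound.
  by rewrite -mdist_gt0 (min_geodesic_mdist gg) ?(ltW s0) ?(ltW sq).
by rewrite -mdist_gt0 (min_geodesic_mdist hh) ?(ltW t0) ?(ltW tx).
Qed.

(* The limit defining the angle is evaluated along s = t only; when it does not
   exist, [angle] has the junk value 0. *)
Lemma angle_cos_near p q x (g h : R -> M) (a : R) : p != q -> p != x ->
  min_geodesic p q g -> min_geodesic p x h -> 0 < angle p g h -> cos (angle p g h) < a ->
  \forall s \near (0 : R)^'+,
    (mdist p (g s) ^+ 2 + mdist p (h s) ^+ 2 - mdist (g s) (h s) ^+ 2)
      / (2 * mdist p (g s) * mdist p (h s)) < a.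
Proof.
rewrite -!mdist_gt0 => pq px gg hh an0 ana.
have [cv|dv] := pselect (cvg (comparison_angle p (g st.1) (h st.2)
    @[st --> filter_prod (at_right (0 : R)) (at_right (0 : R))])); last first.
  by move: an0; rewrite /angle dvgP// ltxx.
have diag : (fun s : R => (s, s)) @ (0 : R)^'+ --> filter_prod (at_right (0 : R)) (at_right (0 : R)).
  move=> S [[P Q] [/= P0 Q0] PQ].
  suff SS : nbhs (0 : R)^'+ [set s | S (s, s)] by exact: SS.
  by apply: filterS (filterI P0 Q0) => s [Ps Qs]; exact: PQ.
have lim1 : comparison_angle p (g s) (h s) @[s --> (0 : R)^'+] --> angle p g h.
  exact: (cvg_comp _ _ diag cv).
have lim2 : cos (comparison_angle p (g s) (h s)) @[s --> (0 : R)^'+] --> cos (angle p g h).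
  exact: (cvg_comp _ _ lim1 (@continuous_cos R _)).
have cosa : \forall s \near (0 : R)^'+, cos (comparison_angle p (g s) (h s)) < a.
  exact: (cvgr_lt _ lim2).
near=> s.
have s0 : 0 < s by near: s; exact: nbhs_right_gt.
have sq : s < mdist p q by near: s; exact: nbhs_right_lt.
have sx : s < mdist p x by near: s; exact: nbhs_right_lt.
rewrite -[X in X < a]acosK.
  by rewrite -/(comparison_angle p (g s) (h s)); near: s; exact: cosa.
rewrite in_itv /=; apply: comparison_cos_bound; rewrite -mdist_gt0.
  by rewrite (min_geodesic_mdist gg) ?(ltW s0) ?(ltW sq).
by rewrite (min_geodesic_mdist hh) ?(ltW s0) ?(ltW sx).
Unshelve. all: by end_near. Qed.

(** [angle] is a limit of Euclidean comparison angles, whereas [hcos] is hyperbolic; on isosceles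
    triangles the cosine changes by O(s^2). *)
Lemma hypcos_le_euclidean (s d E : R) : 0 < s -> s <= 1 -> 0 <= d -> d <= 2 * s ->
  2 * s ^+ 2 * E = 2 * s ^+ 2 - d ^+ 2 -> hypcos s s d <= E + 2 * ch 1 ^+ 2 * s ^+ 2.
Proof.
move=> s0 s1 d0 ds EE; have sh0 := sh_gt0 s0.
have K := hypcosE d s0 s0; have h1 := ch_sub1_ge d.
have h2 := sh_le_mul (ltW s0); have h3 := ch_le (ltW s0) s1.
have sh2 : 0 < sh s ^+ 2 by rewrite exprn_gt0.
have h4 : sh s <= s * ch 1 by apply: le_trans h2 _; rewrite ler_pM2l.
have h5 : sh s ^+ 2 <= s ^+ 2 * ch 1 ^+ 2.
  by rewrite -exprMn; apply: lerXn2r; rewrite ?nnegrE ?(ltW sh0)// (le_trans (ltW sh0)).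
have h6 := ch2_sh2 s.
have h7 : sh s ^+ 2 <= s ^+ 2 * (1 + sh s ^+ 2).
  have -> : 1 + sh s ^+ 2 = ch s ^+ 2 by lra.
  by rewrite -exprMn; apply: lerXn2r; rewrite ?nnegrE ?(ltW sh0)// (le_trans (ltW sh0)).
have s2 : 0 < s ^+ 2 by rewrite exprn_gt0.
have E1 : 0 <= 1 - E <= 2.
  have h8 : 2 * s ^+ 2 * (1 - E) = d ^+ 2 by lra.
  have h9 : d ^+ 2 <= 4 * s ^+ 2.
    by have : d ^+ 2 <= (2 * s) ^+ 2 by [apply: lerXn2r; rewrite ?nnegrE// mulr_ge0// ltW]; lra.
  have d2 : 0 <= d ^+ 2 by exact: sqr_ge0.
  have ss : 0 < 2 * s ^+ 2 by rewrite mulr_gt0.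
  by apply/andP; split; rewrite -(ler_pM2l ss); lra.
have Kle : sh s ^+ 2 * hypcos s s d <= sh s ^+ 2 - s ^+ 2 * (1 - E).
  by move: K; rewrite -!expr2; lra.
rewrite -(ler_pM2l sh2); apply: le_trans Kle _.
have h10 : (sh s ^+ 2 - s ^+ 2) * (1 - E) <= s ^+ 2 * sh s ^+ 2 * 2.
  have [sg|sg] := leP (sh s ^+ 2) (s ^+ 2).
    apply: (@le_trans _ _ 0).
      by rewrite mulr_le0_ge0// ?subr_le0//; case/andP: E1.
    by rewrite !mulr_ge0// ltW.
  case/andP: E1 => E0 E2; apply: ler_pM => //; first by rewrite subr_ge0 ltW.
  by lra.
have h11 : s ^+ 2 * sh s ^+ 2 * 2 <= sh s ^+ 2 * (2 * ch 1 ^+ 2 * s ^+ 2).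
  have -> : sh s ^+ 2 * (2 * ch 1 ^+ 2 * s ^+ 2) = s ^+ 2 * sh s ^+ 2 * 2 * ch 1 ^+ 2 by ring.
  by rewrite ler_peMr ?exprn_ege1 ?ch_ge1// !mulr_ge0// ltW.
by lra.
Qed.

Lemma angle_far_obtuse p q x (g h : R -> M) (c ell : R) : p != q -> p != x ->
  0 < c -> c < pi / 2 -> ell <= mdist p x ->
  min_geodesic p q g -> min_geodesic p x h -> pi / 2 + c < angle p g h ->
  far_obtuse (sin c / 2) ell p q.
Proof.
move=> pq px c0 cpi pxe gg hh an; exists x, h, g; split=> // eta eta0.
have sc : 0 < sin c by apply: sin_gt0_pihalf; rewrite c0.
have an0 : 0 < angle p g h.
  by apply: le_lt_trans an; rewrite addr_ge0 ?divr_ge0 ?pi_ge0// ltW.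
(* Of cos (pi / 2 + c) = - sin c, one quarter is slack and one quarter pays for the passage to
   hyperbolic cosines, which leaves - sin c / 2. *)
have cos_lt : cos (angle p g h) < - (3 / 4 * sin c).
  apply: (@lt_trans _ _ (cos (c + pi / 2))); last by rewrite cosDpihalf; lra.
  rewrite ltr_cos ?in_itv /= ?(ltW an0) ?(angle_le_pi pq px gg hh)//; first by lra.
  by apply/andP; split; lra.
have sc4 : 0 < sin c / 4 by rewrite divr_gt0.
have [s1 s10 hs1] := exists_small (2 * ch 1 ^+ 2) sc4.
have : \forall s \near (0 : R)^'+, 0 < s < eta /\ hcos p (h s) (g s) <= - (sin c / 2).
  have cosn := angle_cos_near pq px gg hh an0 cos_lt.
  near=> s.
  have s0 : 0 < s by near: s; exact: nbhs_right_gt.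
  have seta : s < eta by near: s; exact: nbhs_right_lt.
  have s1' : s < 1 by near: s; exact: nbhs_right_lt.
  have ss1 : s < s1 by near: s; exact: nbhs_right_lt.
  have sq : s < mdist p q by near: s; apply: nbhs_right_lt; rewrite mdist_gt0.
  have sx : s < mdist p x by near: s; apply: nbhs_right_lt; rewrite mdist_gt0.
  split; first by rewrite s0.
  have pg : mdist p (g s) = s by rewrite (min_geodesic_mdist gg) ?(ltW s0) ?(ltW sq).
  have ph : mdist p (h s) = s by rewrite (min_geodesic_mdist hh) ?(ltW s0) ?(ltW sx).
  have : (mdist p (g s) ^+ 2 + mdist p (h s) ^+ 2 - mdist (g s) (h s) ^+ 2)
      / (2 * mdist p (g s) * mdist p (h s)) < - (3 / 4 * sin c) by near: s; exact: cosn.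
  rewrite pg ph; set E := (_ + _ - _) / _ => Elt.
  have d2 : mdist (g s) (h s) <= 2 * s.
    by have := metric_triangle (g s) p (h s); rewrite (metric_sym (g s) p) pg ph; lra.
  have EE : 2 * s ^+ 2 * E = 2 * s ^+ 2 - mdist (g s) (h s) ^+ 2.
    have sn0 : s != 0 by rewrite gt_eqF.
    by rewrite /E; field.
  have := hypcos_le_euclidean s0 (ltW s1') (mdist_ge0 _ _) d2 EE.
  rewrite hcosC /hcos pg ph.
  have s2s : s ^+ 2 <= s1.
    by apply: le_trans (ltW ss1); rewrite expr2 ler_piMl// ltW.
  by have := hs1 (s ^+ 2); rewrite sqr_ge0 s2s => /(_ isT); lra.
by move/filter_ex => [s [? ?]]; exists s.
Unshelve. all: by end_near. Qed.

End Angles.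

(** * From the Alexandrov class to obtuse spaces *)

Section AlexandrovClass.
Variables (R : realType) (n : nat) (D : R) (M : metricType R).
Hypotheses (hn : (0 < n)%N) (HM : alexandrov_class M n D).

Lemma class_two_points : exists x y : M, x != y.
Proof.
apply: contrapT => no; have [_ _ _ dimM _] := HM.
have : (hausdorff_dim [set: M] <= (0%:R + 2^-1)%:E)%E.
  apply: (@hausdorff_dim_chart R M 0 (fun _ _ => 0) 0 1 ltr01) => [//|x y xy].
  by exfalso; apply: no; exists x, y.
rewrite dimM lee_fin add0r.
have n1 : 1 <= n%:R :> R by rewrite ler1n.
lra.
Qed.

Lemma class_diam : exists d0 : R, [/\ diam [set: M] = d0%:E, 0 < d0, d0 <= D &
  forall x y : M, mdist x y <= d0].
Proof.
have [_ _ _ _ dD] := HM; have [d0 [dE d00 dP]] := diam_fin dD.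
have [x [y xy]] := class_two_points.
exists d0; split=> //; last by move=> *; exact: dP.
  by apply: lt_le_trans (dP x y Logic.I Logic.I); rewrite mdist_gt0.
by rewrite -lee_fin -dE.
Qed.

(** Turns the threshold rad / 2 in the obtuse constant into the d0 / 4 of [obtuse_space]. *)
Lemma half_diam_le_rad (d0 : R) : diam [set: M] = d0%:E ->
  (forall x y : M, mdist x y <= d0) -> d0 / 2 <= fine (Defs.rad M).
Proof.
move=> dE dP; have [x [y xy]] := class_two_points.
have lo : ((d0 / 2)%:E <= Defs.rad M)%E.
  apply: le_ereal_inf_tmp => _ [p _ <-]; rewrite leNgt; apply/negP => small.
  have lt q : mdist p q < d0 / 2.
    rewrite -lte_fin; apply: le_lt_trans small.
    by apply: ereal_sup_ubound; exists q.
  have : (ereal_sup [set (mdist p q)%:E | q in [set: M]] < (d0 / 2)%:E)%E by [].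
  set S := ereal_sup _ => SS.
  have S0 : (0%:E <= S)%E by rewrite -(mdistxx p); apply: ereal_sup_ubound; exists p.
  have Sfin : S = (fine S)%:E by rewrite fineK// ge0_fin_numE// (lt_trans SS)// ltry.
  have Sq q : mdist p q <= fine S.
    by rewrite -lee_fin -Sfin; apply: ereal_sup_ubound; exists q.
  have : (diam [set: M] <= (2 * fine S)%:E)%E.
    apply: diam_le => [|a b _ _].
      by rewrite mulr_ge0// -lee_fin -Sfin.
    by have := metric_triangle a p b; have := Sq a; have := Sq b; rewrite (metric_sym a p); lra.
  by rewrite dE lee_fin; move: SS; rewrite Sfin lte_fin; lra.
have hi : (Defs.rad M <= d0%:E)%E.
  apply: ge_ereal_inf; exists (ereal_sup [set (mdist x q)%:E | q in [set: M]]).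
    by exists x.
  by apply: ge_ereal_sup => _ [q _ <-]; rewrite lee_fin.
have d00 : 0 <= d0 by apply: le_trans (dP x x); exact: mdist_ge0.
have rE : Defs.rad M = (fine (Defs.rad M))%:E.
  rewrite fineK// ge0_fin_numE; first by apply: le_lt_trans hi _; rewrite ltry.
  by apply: le_trans lo; rewrite lee_fin divr_ge0.
by rewrite -lee_fin -rE.
Qed.

Lemma obtuse_constant_gt (c : R) : (c%:E < obtuse_constant M)%E ->
  exists2 del : R, 0 < del & forall p q : M, p != q -> mdist p q < del ->
    (c%:E < ob_at p q)%E \/ (c%:E < ob_at q p)%E.
Proof.
move=> obc; apply: contrapT => no; move: obc; apply/negP; rewrite -leNgt.
rewrite /obtuse_constant limf_einfE; apply: ge_ereal_sup => _ [V [del /= del0 delV] <-].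
rewrite leNgt; apply/negP => cV; apply: no; exists del => // p q pq pqd.
apply/orP; rewrite -lt_max; apply: lt_le_trans cV _.
by apply: ereal_inf_lbound; exists (p, q) => //; apply: delV.
Qed.

Lemma ob_at_gt (p q : M) (c : R) : p != q -> (c%:E < ob_at p q)%E ->
  exists x (g h : R -> M), [/\ fine (Defs.rad M) / 2 <= mdist p x, min_geodesic p q g,
    min_geodesic p x h & pi / 2 + c < angle p g h].
Proof.
move=> pq; rewrite /ob_at lteBrDr// => big.
have [Mc Mi _ _ _] := HM.
have [g gg] := exists_min_geodesic p q Mc Mi.
apply: contrapT => no; move: big; apply/negP; rewrite -leNgt.
apply: ge_ereal_sup => _ [h [x /= xfar hh] <-].
apply: ge_ereal_inf; exists (angle p g h)%:E; first by exists g.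
rewrite -EFinD lee_fin leNgt addrC; apply/negP => an; apply: no.
by exists x, g, h.
Qed.

Lemma obtuse_constant_le : (obtuse_constant M <= (pi / 2)%:E)%E.
Proof.
rewrite leNgt; apply/negP => /obtuse_constant_gt[del del0 ob].
have [d0 [dE d00 d0D dP]] := class_diam.
have [x [y xy]] := class_two_points; have [Mc Mi _ _ _] := HM.
pose s := Num.min (del / 2) (mdist x y).
have s0 : 0 < s by rewrite lt_min divr_gt0//= mdist_gt0.
have sdel : s <= del / 2 by rewrite ge_min lexx.
have [|q [xq _ _]] := @exists_between _ _ Mc Mi x y s.
  by rewrite (ltW s0) ge_min lexx orbT.
have xq0 : x != q by rewrite -mdist_gt0 xq.
have contra (p' q' : M) : p' != q' -> ((pi / 2)%:E < ob_at p' q')%E -> False.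
  move=> pq /(ob_at_gt pq)[z [g [h [zfar gg hh an]]]].
  have pz : p' != z.
    rewrite -mdist_gt0; apply: lt_le_trans zfar.
    by have := half_diam_le_rad dE dP; lra.
  by have := angle_le_pi pq pz gg hh; lra.
have xqd : mdist x q < del by rewrite xq; lra.
have [h|h] := ob x q xq0 xqd; first exact: contra h.
by apply: contra h; rewrite eq_sym.
Qed.

Lemma class_obtuse_space (c : R) : 0 < c -> c < pi / 2 -> (c%:E < obtuse_constant M)%E ->
  exists d0 : R, [/\ diam [set: M] = d0%:E, 0 < d0 & obtuse_space D (sin c / 2) n M d0].
Proof.
move=> c0 cpi /obtuse_constant_gt[del del0 ob].
have [d0 [dE d00 d0D dP]] := class_diam.
have [Mc Mi Mk dimM _] := HM; have [x0 _] := class_two_points.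
have MD (x y : M) : mdist x y <= D by exact: le_trans (dP x y) d0D.
have rad_ge := half_diam_le_rad dE dP.
have obt (p q : M) : p != q -> (c%:E < ob_at p q)%E -> far_obtuse (sin c / 2) (d0 / 4) p q.
  move=> pq /(ob_at_gt pq)[x [g [h [xfar gg hh an]]]].
  have xd : d0 / 4 <= mdist p x by apply: le_trans xfar; lra.
  have px : p != x by rewrite -mdist_gt0; apply: lt_le_trans xd; rewrite divr_gt0.
  exact: angle_far_obtuse gg hh an.
exists d0; split=> //; split=> //.
- by move=> m f p rho eta e mn *; exact: (vertical_pair Mc Mi Mk (lt_le_trans d00 d0D) MD _ _ dimM mn).
- exists del => // p q pq pqd; have [h|h] := ob p q pq pqd; [left|right]; apply: obt => //.
  by rewrite eq_sym.
Qed.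

End AlexandrovClass.

Lemma unit_ball_volume_gt0 (R : realType) n : 0 < unit_ball_volume n :> R.
Proof.
have : (0 < unit_ball_volume n :> R) /\ (0 < unit_ball_volume n.+1 :> R).
  elim: n => [|n [IH1 IH2]]; first by split; [exact: ltr01|exact: ltr0n].
  split=> //; rewrite [unit_ball_volume n.+2]/=.
  by rewrite mulr_gt0// divr_gt0// mulr_gt0// pi_gt0.
by case.
Qed.

(** Positivity of the normalized volume rules out the default value 0 that [fine] gives to an
    infinite measure. *)
Lemma normalized_volume_ge (R : realType) (n : nat) (D : R) : (0 < n)%N -> 0 < D ->
  forall c : R, 0 < c -> exists2 v : R, 0 < v & forall M : metricType R,
    alexandrov_class M n D -> (c%:E < obtuse_constant M)%E ->
    0 < normalized_volume M n -> v <= normalized_volume M n.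
Proof.
move=> hn D0 c c0; have [pic|cpi] := leP (pi / 2) c.
  exists 1 => // M HM obc _; exfalso.
  have := lt_le_trans obc (obtuse_constant_le hn HM).
  by rewrite lte_fin ltNge pic.
have sc : 0 < sin c by apply: sin_gt0_pihalf; rewrite c0.
have sc0 : 0 < sin c / 2 by rewrite divr_gt0.
have sc1 : sin c / 2 <= 1 by have := sin_le1 c; lra.
have [kap kap0 strain] := exists_strainer D sc0 sc1 (leqnn n).
pose C : R := slope_const D.
have [th1 th10 hth] := exists_small (3 * C) (divr_gt0 kap0 (ltr0n _ 4)).
pose th := Num.min 1 th1.
have th0 : 0 < th by rewrite lt_min ltr01.
have thle1 : th <= 1 by rewrite ge_min lexx.
have thC : 3 * C * th <= kap / 4 by apply: hth; rewrite (ltW th0) ge_min lexx orbT.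
pose eps := Num.min 1 (kap / 16).
have eps0 : 0 < eps by rewrite lt_min ltr01 divr_gt0.
have eps1 : eps <= 1 by rewrite ge_min lexx.
have epsk : eps <= kap / 16 by rewrite ge_min lexx orbT.
have eps2 : eps ^+ 2 <= eps by rewrite expr2 ler_piMl// ltW.
have E_le : slope_error D eps th + eps ^+ 2 <= kap / 2.
  by rewrite /slope_error; move: thC; rewrite /C; lra.
have [lam lam0 strained_ex] := strain eps eps0.
have nR : 0 < n%:R :> R by rewrite ltr0n.
(* Targets in the cube of half-side w0 d0 have residual at most n w0 d0 = kap / 8 * (lam d0), within
   the kap / 4 * rho allowed by [distance_map_surjective]. *)
pose w0 := kap * lam / (8 * n%:R).
have w00 : 0 < w0 by rewrite divr_gt0 ?mulr_gt0.
have om := unit_ball_volume_gt0 R n.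
exists (unit_ball_volume n / 2 ^+ n * (w0 / 16) ^+ n).
  by rewrite mulr_gt0 ?divr_gt0 ?exprn_gt0// divr_gt0.
move=> M HM obc; have [d0 [dE d00 os]] := class_obtuse_space hn HM c0 cpi obc.
have [p [A [G [G1 Gpos AU]]]] := strained_ex M d0 os.
have [Mc Mi Mk MD _ _ _ _] := os.
have ell0 : 0 < lam * d0 by rewrite mulr_gt0.
have w0' : 0 < w0 * d0 by rewrite mulr_gt0.
have surj (t : nat -> R) : (forall i, (i < n)%N -> `|t i - mdist p (A true i)| <= w0 * d0) ->
    exists z, forall i, (i < n)%N -> mdist z (A true i) = t i.
  move=> tP; apply: (distance_map_surjective Mc Mi Mk MD AU G1 Gpos eps0 ell0 th0 thle1 kap0 E_le).
  apply: (@le_lt_trans _ _ (n%:R * (w0 * d0))).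
    have nw0 : 0 <= n%:R * (w0 * d0) by rewrite mulr_ge0// ltW.
    rewrite -[X in _ <= X](ger0_norm nw0) -sqrtr_sqr ler_wsqrtr//.
    apply: (@le_trans _ _ (\sum_(i < n) (w0 * d0) ^+ 2)).
      apply: ler_sum => i _; rewrite -real_normK ?num_real// distrC.
      by apply: lerXn2r; rewrite ?nnegrE ?(ltW w0')// tP.
    have -> : \sum_(i < n) (w0 * d0) ^+ 2 = n%:R * (w0 * d0) ^+ 2.
      by rewrite sumr_const card_ord mulr_natl.
    rewrite [X in _ <= X]exprMn ler_wpM2r ?sqr_ge0//.
    by rewrite expr2 ler_peMr ?(ltW nR)// ler1n.
  have -> : n%:R * (w0 * d0) = kap / 8 * (lam * d0) by rewrite /w0; field; rewrite gt_eqF.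
  by rewrite ltr_pM2r//; lra.
have ulip i (x y : M) : `|mdist x (A true i) - mdist y (A true i)| <= mdist x y.
  by rewrite !(metric_sym _ (A true i)); exact: mdist_norm.
have := @hausdorff_raw_ge R M Mc n (fun i z => mdist z (A true i))
  (fun i => mdist p (A true i)) (w0 * d0) hn w0' ulip surj.
rewrite /normalized_volume /hausdorff_measure dE /=.
set raw := hausdorff_measure_raw _ _ => raw_ge.
have k0 : 0 < unit_ball_volume n / 2 ^+ n :> R by rewrite divr_gt0 ?exprn_gt0.
set k := unit_ball_volume n / 2 ^+ n in k0 *.
have dn : 0 < d0 ^+ n by rewrite exprn_gt0.
case: raw raw_ge => [r| |]; first last.
- by [].
- by rewrite gt0_muley ?lte_fin//= mul0r ltxx.
rewrite lee_fin => rge _; rewrite /= ler_pdivlMr//.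
have -> : k * (w0 / 16) ^+ n * d0 ^+ n = k * (w0 * d0 / 16) ^+ n.
  by rewrite -mulrA -exprMn; congr (_ * _ ^+ _); ring.
by rewrite ler_pM2l.
Qed.

Theorem theorem1p2 (R : realType) (n : nat) (D : R) (hn : (0 < n)%N) (hD : 0 < D) :
  exists C : R -> R,
    [/\ forall e, 0 < e -> 0 < C e,
        forall e, 0 < e -> {for e, continuous C},
        C e @[e --> 0^'+] --> (0 : R)
      & forall M : metricType R, alexandrov_class M n D ->
          (obtuse_constant M < (C (normalized_volume M n))%:E)%E].
Proof.
have ex (c : R) : exists v : R, 0 < c -> 0 < v /\ forall M : metricType R,
    alexandrov_class M n D -> (c%:E < obtuse_constant M)%E ->
    0 < normalized_volume M n -> v <= normalized_volume M n.
  have [c0|c0] := pselect (0 < c); last by exists 0.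
  by have [v v0 vP] := normalized_volume_ge hn hD c0; exists v.
have [v vP] := choice ex.
(* C(e) = e + inf_c (c + pi e / v(c)): the term of c exceeds c, and pi if e >= v(c). *)
pose S (e : R) := [set c + pi * (e / v c) | c in [set c | 0 < c]].
pose J (e : R) := inf (S e).
have S_ge0 (e : R) : 0 < e -> lbound (S e) 0.
  move=> e0 _ [c /= c0 <-]; have [v0 _] := vP c c0.
  by rewrite addr_ge0 ?(ltW c0)// mulr_ge0 ?pi_ge0// divr_ge0// ltW.
have Sne (e : R) : S e !=set0 by exists (1 + pi * (e / v 1)), 1 => //=; exact: ltr01.
have J_le (e c : R) : 0 < e -> 0 < c -> J e <= c + pi * (e / v c).
  by move=> e0 c0; apply: ge_inf; [exists 0; exact: S_ge0|exists c].
have J_ge0 (e : R) : 0 < e -> 0 <= J e.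
  by move=> e0; apply: lb_le_inf => //; exact: S_ge0.
have J_mono (e e' : R) : 0 < e -> e <= e' -> J e <= J e'.
  move=> e0 ee'; apply: lb_le_inf => // _ [c /= c0 <-]; have [v0 _] := vP c c0.
  apply: le_trans (J_le e c e0 c0) _; rewrite lerD2l ler_wpM2l ?pi_ge0//.
  by rewrite ler_pM2r ?invr_gt0.
(* [J] is nondecreasing and J e / e nonincreasing; together they give |J e - J t| <= (J e / e) |e -
   t|, hence continuity. *)
have J_scale (e e' : R) : 0 < e -> e <= e' -> e * J e' <= e' * J e.
  move=> e0 ee'; have e'0 := lt_le_trans e0 ee'.
  rewrite -ler_pdivrMl//; apply: lb_le_inf => // _ [c /= c0 <-]; have [v0 _] := vP c c0.
  rewrite ler_pdivrMl//; apply: (@le_trans _ _ (e * (c + pi * (e' / v c)))).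
    by rewrite ler_pM2l// J_le.
  have -> : e * (c + pi * (e' / v c)) = e * c + e' * (pi * (e / v c)) by ring.
  by rewrite mulrDr lerD2r ler_pM2r.
(* The summand e makes the inequality strict. At a default normalized volume 0 the value pi exceeds
   the general bound pi / 2 on the obtuse constant. *)
pose C (e : R) := if 0 < e then e + J e else pi.
exists C; split.
- by move=> e e0; rewrite /C e0 ltr_pwDl// J_ge0.
- move=> e e0; apply/cvgrPdist_lt => eps eps0.
  pose K := 1 + J e / e.
  have K0 : 0 < K by rewrite ltr_pwDl// divr_ge0 ?J_ge0// ltW.
  have eK : 0 < eps / K by rewrite divr_gt0.
  near=> t.
  have t0 : 0 < t by near: t; exact: lt_nbhsr.
  have te : `|e - t| < eps / K by near: t; apply: cvgr_dist_lt => //; exact: cvg_id.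
  suff h : `|C e - C t| <= K * `|e - t|.
    by apply: le_lt_trans h _; rewrite mulrC -ltr_pdivlMr.
  rewrite /C e0 t0.
  have Je : e * (J e / e) = J e by rewrite mulrC divfK// gt_eqF.
  have Jq : 0 <= J e / e by rewrite divr_ge0 ?J_ge0// ltW.
  have [et|te'] := leP e t.
    have h1 := J_mono e t e0 et; have h2 := J_scale e t e0 et.
    have h3 : J t - J e <= (t - e) * (J e / e).
      rewrite -(ler_pM2l e0) mulrBr [X in _ <= X]mulrCA Je; lra.
    by rewrite !ler0_norm; rewrite /K; lra.
  have h1 := J_mono t e t0 (ltW te'); have h2 := J_scale t e t0 (ltW te').
  have h3 : J e - J t <= (e - t) * (J e / e).
    rewrite -(ler_pM2l e0) mulrBr [X in _ <= X]mulrCA Je; lra.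
  by rewrite !ger0_norm; rewrite /K; lra.
- apply/cvgrPdist_lt => eps eps0.
  have c0 : 0 < eps / 4 by rewrite divr_gt0.
  have [v0 _] := vP _ c0.
  have vp : 0 < v (eps / 4) / pi * (eps / 4) by rewrite mulr_gt0 ?divr_gt0 ?pi_gt0.
  near=> t.
  have t0 : 0 < t by near: t; exact: nbhs_right_gt.
  have t1 : t < eps / 4 by near: t; exact: nbhs_right_lt.
  have t2 : t < v (eps / 4) / pi * (eps / 4) by near: t; exact: nbhs_right_lt.
  rewrite /C t0 sub0r normrN ger0_norm; last by rewrite addr_ge0 ?J_ge0// ltW.
  have := J_le t _ t0 c0.
  have : pi * (t / v (eps / 4)) < eps / 4.
    rewrite mulrA ltr_pdivrMr// mulrC -ltr_pdivlMr ?pi_gt0//.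
    by move: t2; congr (_ < _); ring.
  by lra.
- move=> M HM; have ob_le := obtuse_constant_le hn HM.
  have pi0 := pi_gt0 R; rewrite /C; case: ifPn => [vt0|_]; last first.
    by apply: le_lt_trans ob_le _; rewrite lte_fin; lra.
  have le_term c : 0 < c ->
      (obtuse_constant M <= (c + pi * (normalized_volume M n / v c))%:E)%E.
    move=> c0; have [v0 vM] := vP c c0.
    have [obc|obc] := leP (obtuse_constant M) c%:E.
      by apply: le_trans obc _; rewrite lee_fin lerDl mulr_ge0 ?(ltW pi0)// divr_ge0// ltW.
    apply: le_trans ob_le _; rewrite lee_fin.
    have : 1 <= normalized_volume M n / v c by rewrite ler_pdivlMr// mul1r; exact: vM.
    by move=> /(ler_wpM2l (ltW pi0)); lra.
  case: (obtuse_constant M) le_term ob_le => [r le_term _|//|_ _]; last by rewrite ltNyr.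
  rewrite lte_fin; apply: (@le_lt_trans _ _ (J (normalized_volume M n))); last by rewrite ltrDr.
  by apply: lb_le_inf => // _ [c c0 <-]; rewrite -lee_fin; exact: le_term.
Unshelve. all: by end_near. Qed.
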